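(* Let $t\ge1$, $n\ge2$ and let $J=\{j_1<\cdots<j_r\}$ be a nonempty subset of $[n-1]$. Then \[\beta_n^{(t)}(J)+\beta_n^{(t)}(J\setminus\{j_r\})=\beta_{j_r}^{(t)}(J\setminus\{j_r\})\,\prod_{i=1}^t h_{n-j_r}(X^i).\]
   Context: For $m\ge1$, $B_m^{(t)}$ is the poset of $t$-tuples $(A_1,\ldots,A_t)$ of subsets of $[m]$ with $|A_1|=\cdots=|A_t|$, ordered componentwise by inclusion and graded by the common cardinality, with $\mathfrak{S}_m^{\times t}$ acting coordinatewise. For $J\subseteq[m-1]$, $B_m^{(t)}(J)$ is the subposet of elements of rank in $J$ together with bottom and top, and $\beta_m^{(t)}(J)$ is the product Frobenius characteristic of its top reduced rational homology $\tilde H_{|J|-1}$ (of the order complex of its proper part) as an $\mathfrak{S}_m^{\times t}$-module (for $J=\emptyset$ this is the trivial module). The product Frobenius characteristic of $\sum a_{\boldsymbol\mu}\chi^{\mu^1}\otimes\cdots\otimes\chi^{\mu^t}$ is $\sum a_{\boldsymbol\mu}\prod_js_{\mu^j}(X^j)$ for disjoint variable sets $X^1,\ldots,X^t$. $h_k$ is the complete homogeneous symmetric function. *)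

(* Defs.v *)
From HB Require Import structures.
From mathcomp Require Import all_boot all_order all_algebra all_fingroup.
From mathcomp Require Import gproduct mxrepresentation finmap.
From mathcomp Require Import mpoly.

Set Implicit Arguments.
Unset Strict Implicit.
Unset Printing Implicit Defensive.

Import Order.TTheory GRing.Theory Num.Theory.
Local Open Scope ring_scope.

(* Row vectors are indexed by the elements of A; g sends the basis vector of  *)
(* x to the basis vector of to x g.                                           *)
Definition set_perm_mx (gT : finGroupType) (X : finType)
    (to : {action gT &-> X}) (A : {set X}) (g : gT) : 'M[rat]_#|A| :=
  \matrix_(a, b) (to (enum_val a) g == enum_val b)%:R.

Section PermRepr.

Context (gT : finGroupType) (X : finType) (to : {action gT &-> X}).
Context (A : {set X}) (actsA : [acts [set: gT], on A | to]).

Lemma set_perm_in g a : to (enum_val (A := mem A) a) g \in A.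
Proof. by rewrite (acts_act actsA) ?inE ?enum_valP. Qed.

Lemma set_perm_mulmx p g (M : 'M_(#|A|, p)) a b :
  (set_perm_mx to A g *m M) a b =
  M (enum_rank_in (set_perm_in g a) (to (enum_val a) g)) b.
Proof.
rewrite mxE (bigD1 (enum_rank_in (set_perm_in g a) (to (enum_val a) g))) //=.
rewrite mxE enum_rankK_in ?set_perm_in // eqxx mul1r big1 ?addr0 // => c neq_c.
rewrite mxE; case: eqP => [eq_c|_]; last by rewrite mul0r.
case/eqP: neq_c; apply: enum_val_inj.
by rewrite enum_rankK_in ?set_perm_in.
Qed.

Lemma mulmx_set_perm p g (M : 'M_(p, #|A|)) a b :
  (M *m set_perm_mx to A g) a b =
  M a (enum_rank_in (set_perm_in g^-1%g b) (to (enum_val b) g^-1%g)).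
Proof.
set in_b := set_perm_in g^-1%g b.
rewrite mxE (bigD1 (enum_rank_in in_b (to (enum_val b) g^-1%g))) //=.
rewrite mxE enum_rankK_in // actKV eqxx mulr1 big1 ?addr0 // => c neq_c.
rewrite mxE; case: eqP => [eq_c|_]; last by rewrite mulr0.
by case/eqP: neq_c; apply: enum_val_inj; rewrite enum_rankK_in // -eq_c actK.
Qed.

Lemma set_perm_mx_repr : mx_repr [set: gT] (set_perm_mx to A).
Proof.
split=> [|g h _ _]; apply/matrixP=> a b; rewrite ?set_perm_mulmx !mxE.
  by rewrite act1 (inj_eq enum_val_inj).
by rewrite enum_rankK_in ?set_perm_in // actM.
Qed.

Definition set_perm_repr := MxRepresentation set_perm_mx_repr.

End PermRepr.

(* The faces with k vertices (dimension k - 1) of the order complex of the    *)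
(* subposet S; the empty chain is a face.                                     *)
Definition faces (d : Order.disp_t) (P : finPOrderType d) (S : {set P})
    (k : nat) : {set {set P}} :=
  [set c : {set P} | [&& c \subset S, #|c| == k
                       & [forall x in c, forall y in c, (x >=< y)%O]]].

(* The boundary of x_0 < ... < x_(k-1) is the sum of (-1)^i times the chain   *)
(* without x_i; the exponent i is the number of chain elements below x_i.     *)
(* boundary S 0 is the zero map out of the line spanned by the empty chain.   *)
Definition boundary_coef (d : Order.disp_t) (P : finPOrderType d)
    (c e : {set P}) : rat :=
  \sum_(x in c | c :\ x == e) (-1) ^+ #|[set y in c | (y < x)%O]|.

Definition boundary (d : Order.disp_t) (P : finPOrderType d) (S : {set P})
    (k : nat) : 'M[rat]_(#|faces S k|, #|faces S k.-1|) :=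
  \matrix_(a, b) boundary_coef (enum_val a) (enum_val b).

Section Homology.

Context (d : Order.disp_t) (P : finPOrderType d) (S : {set P}).
Context (gT : finGroupType) (to : {action gT &-> P}).
Context (to_mono : forall g, {mono (to^~ g) : x y / (x <= y)%O}).
Context (actsS : [acts [set: gT], on S | to]).

Lemma acts_faces k : [acts [set: gT], on faces S k | to^*%act].
Proof.
apply/subsetP=> g _; rewrite !inE; apply/subsetP=> c.
rewrite !inE => /and3P[sub_c card_c /forall_inP chain_c].
apply/and3P; split.
- apply/subsetP=> _ /imsetP[x x_c ->].
  by rewrite (acts_act actsS) ?inE ?(subsetP sub_c).
- by rewrite card_setact.
- apply/forall_inP=> _ /imsetP[x x_c ->].
  apply/forall_inP=> _ /imsetP[y y_c ->].
  have /forall_inP/(_ y y_c) := chain_c x x_c.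
  by rewrite /Order.comparable !to_mono.
Qed.

Definition chain_repr k := set_perm_repr (acts_faces k).

Lemma setact_in (c : {set P}) x g :
  (to x g \in to^*%act c g) = (x \in c).
Proof. by apply: mem_imset; apply: act_inj. Qed.

Lemma boundary_coef_act (c e : {set P}) g :
  boundary_coef (to^*%act c g) (to^*%act e g) = boundary_coef c e.
Proof.
rewrite /boundary_coef (reindex_inj (act_inj to g)).
apply: eq_big => [x|x _].
  have -> : to^*%act c g :\ to x g = to^*%act (c :\ x) g.
    apply/setP=> y; rewrite -[y](actKV to g) !(inE, setact_in).
    by rewrite (inj_eq (act_inj to g)).
  by rewrite (inj_eq (act_inj to^*%act g)) setact_in.
congr (_ ^+ _); rewrite -(card_setact to [set y in c | (y < x)%O] g).
apply: eq_card => y; rewrite -[y](actKV to g) !(inE, setact_in).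
by rewrite !lt_leAnge !to_mono.
Qed.

Lemma boundary_equivariant k g :
  chain_repr k g *m boundary S k = boundary S k *m chain_repr k.-1 g.
Proof.
apply/matrixP=> a b.
rewrite (set_perm_mulmx (acts_faces k)) (mulmx_set_perm (acts_faces k.-1)) !mxE.
rewrite !enum_rankK_in ?(set_perm_in (acts_faces _)) //.
by rewrite -[RHS](boundary_coef_act _ _ g) actKV.
Qed.

Definition cycles k : 'M[rat]_#|faces S k| := kermx (boundary S k).
Definition boundaries k : 'M[rat]_#|faces S k| := <<boundary S k.+1>>%MS.

Lemma cycles_module k : mxmodule (chain_repr k) (cycles k).
Proof.
apply/mxmoduleP=> g _; apply/sub_kermxP.
by rewrite -mulmxA boundary_equivariant mulmxA mulmx_ker mul0mx.
Qed.

Lemma boundaries_module k : mxmodule (chain_repr k) (boundaries k).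
Proof.
rewrite (eqmx_module _ (genmxE _)); apply/mxmoduleP=> g _.
by rewrite -(boundary_equivariant k.+1) submxMl.
Qed.

(* section_repr modU modV acts on (U + V) / U, so this is the reduced         *)
(* homology cycles / boundaries in degree k - 1.                              *)
Definition homology_repr k :=
  section_repr (boundaries_module k) (cycles_module k).

Definition homology_char k (g : gT) : rat := \tr (homology_repr k g).

End Homology.

Definition equicard (t m : nat) (A : {ffun 'I_t -> {set 'I_m}}) : bool :=
  [forall i, forall j, #|A i| == #|A j|].

Record Bt (t m : nat) := MkBt {
  Bt_sets :> {ffun 'I_t -> {set 'I_m}};
  Bt_equicard : equicard Bt_sets
}.

HB.instance Definition _ (t m : nat) := [isSub for @Bt_sets t m].
HB.instance Definition _ (t m : nat) := [Finite of Bt t m by <:].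

Section BtOrder.

Context (t m : nat).
Implicit Types A B C : Bt t m.

Definition Bt_le A B : bool := [forall i, A i \subset B i].

Lemma Bt_le_refl : reflexive Bt_le.
Proof. by move=> A; apply/forallP. Qed.

Lemma Bt_le_anti : antisymmetric Bt_le.
Proof.
move=> A B /andP[/forallP sAB /forallP sBA]; apply/val_inj/ffunP=> i.
by apply/eqP; rewrite eqEsubset sAB sBA.
Qed.

Lemma Bt_le_trans : transitive Bt_le.
Proof.
move=> B A C /forallP sAB /forallP sBC.
by apply/forallP=> i; apply: subset_trans (sAB i) (sBC i).
Qed.

End BtOrder.

Fact Bt_display : Order.disp_t. Proof. exact: (Order.Disp tt tt). Qed.

HB.instance Definition _ (t m : nat) := Order.Le_isPOrder.Build Bt_display
  (Bt t m) (@Bt_le_refl t m) (@Bt_le_anti t m) (@Bt_le_trans t m).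

(* The maximum over i of the (equal) cardinalities of the A_i.                *)
Definition Bt_rank (t m : nat) (A : Bt t m) : nat := \max_(i < t) #|A i|.

Lemma equicard_cst t m (X : {set 'I_m}) :
  equicard [ffun _ : 'I_t => X].
Proof. by apply/forallP=> i; apply/forallP=> j; rewrite !ffunE. Qed.

Definition Bt_bot t m : Bt t m := MkBt (equicard_cst t set0).
Definition Bt_top t m : Bt t m := MkBt (equicard_cst t [set: 'I_m]).

Definition Bt_select (t m : nat) (J : {fset nat}) : {set Bt t m} :=
  [set A | (Bt_rank A \in J) || (A \in [set Bt_bot t m; Bt_top t m])].

Definition Bt_proper (t m : nat) (J : {fset nat}) : {set Bt t m} :=
  Bt_select t m J :\: [set Bt_bot t m; Bt_top t m].

Definition symt (t m : nat) : finGroupType :=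
  {dffun forall i : 'I_t, 'S_m}.

Section BtAction.

Context (t m : nat).

Lemma Bt_act_subproof (A : Bt t m) (g : symt t m) :
  equicard [ffun i => g i @: A i].
Proof.
apply/forallP=> i; apply/forallP=> j; rewrite !ffunE.
rewrite !card_imset; try exact: perm_inj.
by case: A => A /= /forallP/(_ i)/forallP/(_ j).
Qed.

Definition Bt_act (A : Bt t m) (g : symt t m) : Bt t m :=
  MkBt (Bt_act_subproof A g).

Lemma Bt_act1 : Bt_act^~ 1%g =1 id.
Proof.
move=> A; apply/val_inj/ffunP=> i; rewrite /= !ffunE.
by rewrite -[RHS]imset_id; apply: eq_imset => x; rewrite perm1.
Qed.

Lemma Bt_actM A : act_morph Bt_act A.
Proof.
move=> g h; apply/val_inj/ffunP=> i; rewrite /= !ffunE.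
by rewrite -imset_comp; apply: eq_imset => x; rewrite /= permM.
Qed.

Canonical Bt_action := TotalAction Bt_act1 Bt_actM.

End BtAction.

Section BtModule.

Context (t m : nat).

Lemma Bt_act_mono (g : symt t m) :
  {mono (@Bt_action t m)^~ g : A B / (A <= B)%O}.
Proof.
move=> A B; apply: eq_forallb => i; rewrite /= !ffunE.
apply/subsetP/subsetP => sAB x => [Ax|/imsetP[y Ay ->]].
  by have := sAB _ (imset_f (g i) Ax); rewrite mem_imset //; apply: perm_inj.
exact/imset_f/sAB.
Qed.

Lemma Bt_act_rank (A : Bt t m) (g : symt t m) :
  Bt_rank (Bt_act A g) = Bt_rank A.
Proof.
by apply: eq_bigr => i _; rewrite /= ffunE card_imset //; apply: perm_inj.
Qed.

Lemma Bt_act_bot (g : symt t m) : Bt_act (Bt_bot t m) g = Bt_bot t m.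
Proof. by apply/val_inj/ffunP=> i; rewrite /= !ffunE imset0. Qed.

Lemma Bt_act_top (g : symt t m) : Bt_act (Bt_top t m) g = Bt_top t m.
Proof.
apply/val_inj/ffunP=> i; rewrite /= !ffunE; apply/setP=> x; rewrite !inE.
by apply/imsetP; exists ((g i)^-1%g x); rewrite ?inE ?permKV.
Qed.

Lemma acts_Bt_proper (J : {fset nat}) :
  [acts [set: symt t m], on Bt_proper t m J | Bt_action t m].
Proof.
apply/subsetP=> g _; rewrite !inE; apply/subsetP=> A; rewrite !inE /=.
have act_eq B : Bt_act B g = B -> (Bt_act A g == B) = (A == B).
  by move=> gB; rewrite -{1}gB (inj_eq (act_inj (Bt_action t m) g)).
by rewrite Bt_act_rank !act_eq ?Bt_act_bot ?Bt_act_top.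
Qed.

(* homology_char is indexed by the number of vertices, so the index #|` J|    *)
(* stands for homological degree #|J| - 1.                                    *)
Definition Bt_top_char (J : {fset nat}) : symt t m -> rat :=
  homology_char (@Bt_act_mono) (acts_Bt_proper J) #|` J|.

End BtModule.

(* A partition of m, padded with zeros to m parts.                            *)
Definition is_part (m : nat) (mu : {ffun 'I_m -> 'I_m.+1}) : bool :=
  [forall i : 'I_m, forall j : 'I_m, (i <= j)%N ==> (mu j <= mu i)%N] &&
  (\sum_(i < m) mu i == m)%N.

Record part (m : nat) := MkPart {
  part_row :> {ffun 'I_m -> 'I_m.+1};
  partP : is_part part_row
}.

HB.instance Definition _ (m : nat) := [isSub for @part_row m].
HB.instance Definition _ (m : nat) := [Finite of part m by <:].

(* Cells are pairs (row, column).                                             *)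
Definition diagram (m : nat) (mu : part m) : {set 'I_m * 'I_m} :=
  [set c : 'I_m * 'I_m | (c.2 < mu c.1)%N].

(* A bijective filling of the diagram is encoded by the map from entries to   *)
(* cells; injectivity suffices since the diagram has m cells.                 *)
Definition tableaux (m : nat) (mu : part m) : {set {ffun 'I_m -> 'I_m * 'I_m}} :=
  [set T : {ffun 'I_m -> 'I_m * 'I_m} |
     injectiveb T && [forall x, T x \in diagram mu]].

(* A tabloid (row-equivalence class of tableaux) is encoded by the map from   *)
(* entries to row indices.                                                    *)
Definition tabloids (m : nat) (mu : part m) : {set {ffun 'I_m -> 'I_m}} :=
  [set r : {ffun 'I_m -> 'I_m} | [forall i, #|[set x | r x == i]| == mu i]].

Section TabloidAction.

Context (m : nat).

(* Entry g x of r.g lies in the row of entry x of r.                          *)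
Definition tabloid_act (r : {ffun 'I_m -> 'I_m}) (g : 'S_m) :
    {ffun 'I_m -> 'I_m} := [ffun x => r (g^-1%g x)].

Lemma tabloid_act1 : tabloid_act^~ 1%g =1 id.
Proof. by move=> r; apply/ffunP=> x; rewrite ffunE invg1 perm1. Qed.

Lemma tabloid_actM r : act_morph tabloid_act r.
Proof. by move=> g h; apply/ffunP=> x; rewrite !ffunE invMg permM. Qed.

Canonical tabloid_action := TotalAction tabloid_act1 tabloid_actM.

Lemma acts_tabloids (mu : part m) :
  [acts [set: 'S_m], on tabloids mu | tabloid_action].
Proof.
apply/subsetP=> g _; rewrite !inE; apply/subsetP=> r.
rewrite !inE => /forallP card_r; apply/forallP=> i; rewrite -(eqP (card_r i)).
rewrite -(card_imset [set x | r x == i] (@perm_inj _ g)); apply/eqP.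
apply: eq_card => x; rewrite -[x](permKV g) mem_imset; last exact: perm_inj.
by rewrite !inE ffunE permK.
Qed.

End TabloidAction.

(* Coefficient of the tabloid r in the polytabloid of T, the sum over the     *)
(* column stabilizer of T of sgn(s) times the tabloid of s T.                 *)
Definition polytabloid_coef (m : nat) (T : {ffun 'I_m -> 'I_m * 'I_m})
    (r : {ffun 'I_m -> 'I_m}) : rat :=
  \sum_(s : 'S_m | [forall x, (T (s x)).2 == (T x).2])
     (-1) ^+ s * (r == tabloid_act [ffun x => (T x).1] s)%:R.

Section Specht.

Context (m : nat) (mu : part m).

Definition polytabloid_mx : 'M[rat]_(#|tableaux mu|, #|tabloids mu|) :=
  \matrix_(a, b) polytabloid_coef (enum_val a) (enum_val b).

Definition specht_mx : 'M[rat]_#|tabloids mu| := <<polytabloid_mx>>%MS.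

Definition tabloid_repr := set_perm_repr (acts_tabloids mu).

Lemma polytabloid_coef_act (T : {ffun 'I_m -> 'I_m * 'I_m}) r (g : 'S_m) :
  polytabloid_coef [ffun x => T (g^-1%g x)] (tabloid_act r g) =
  polytabloid_coef T r.
Proof.
rewrite /polytabloid_coef (reindex_inj (conjg_inj g)); apply: eq_big => [s|s _].
  apply/forallP/forallP=> colT x; move: (colT (g x)) (colT (g^-1%g x));
    by rewrite !ffunE /conjg !permM ?permK ?permKV.
have -> : [ffun x => ([ffun y => T (g^-1%g y)] x).1]
          = tabloid_act [ffun x => (T x).1] g by apply/ffunP=> x; rewrite !ffunE.
rewrite odd_permJ; congr (_ * (nat_of_bool _)%:R).
set q := [ffun x => (T x).1].
have -> : tabloid_act (tabloid_act q g) (s ^ g)%g = tabloid_act (tabloid_act q s) g.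
  by rewrite -!tabloid_actM -conjgC.
exact: (inj_eq (act_inj (tabloid_action m) g)).
Qed.

Lemma specht_module : mxmodule tabloid_repr specht_mx.
Proof.
rewrite (eqmx_module _ (genmxE _)); apply/mxmoduleP=> g _.
apply/row_subP=> a; set T := enum_val a.
pose Tg : {ffun 'I_m -> 'I_m * 'I_m} := [ffun x => T (g^-1%g x)].
have Tg_in : Tg \in tableaux mu.
  have := enum_valP a; rewrite -/T !inE => /andP[/injectiveP injT /forallP inT].
  apply/andP; split; last by apply/forallP=> x; rewrite ffunE; exact: inT.
  by apply/injectiveP=> x y; rewrite !ffunE => /injT /perm_inj.
suff -> : row a (polytabloid_mx *m tabloid_repr g)
          = row (enum_rank_in Tg_in Tg) polytabloid_mx by apply: row_sub.
apply/rowP=> b; rewrite mxE (mulmx_set_perm (acts_tabloids mu)) !mxE.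
rewrite !enum_rankK_in ?(set_perm_in (acts_tabloids mu)) //.
by rewrite -(polytabloid_coef_act _ _ g) -[X in polytabloid_coef _ X]/
  (tabloid_action m _ g) actKV.
Qed.

Definition specht_repr := submod_repr specht_module.

(* The irreducible character chi^mu of S_m is that of the Specht module.      *)
Definition specht_char (g : 'S_m) : rat := \tr (specht_repr g).

End Specht.

(* Symmetric functions in t alphabets X^1, ..., X^t are represented by their  *)
(* restrictions to N variables per alphabet, for all N; the k-th variable of  *)
(* X^i is 'X_(mxvec_index i k).                                               *)
Definition alph_var (t N : nat) (i : 'I_t) (k : 'I_N) : {mpoly rat[t * N]} :=
  'X_(mxvec_index i k).

(* Complete homogeneous h_k(X^i); the sum is over weakly increasing words.    *)
Definition hsym (t N : nat) (i : 'I_t) (k : nat) : {mpoly rat[t * N]} :=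
  \sum_(u : k.-tuple 'I_N | sorted leq (map val u)) \prod_(a <- u) alph_var i a.

Notation cell mu := {c | c \in diagram mu}.

Definition semistandard (m N : nat) (mu : part m) (T : {ffun cell mu -> 'I_N}) :
    bool :=
  [forall c : cell mu, forall e : cell mu,
     (((val c).1 == (val e).1) && ((val c).2 <= (val e).2)%N ==> (T c <= T e)%N)
  && (((val c).2 == (val e).2) && ((val c).1 < (val e).1)%N ==> (T c < T e)%N)].

Definition schur (t N : nat) (i : 'I_t) (m : nat) (mu : part m) :
    {mpoly rat[t * N]} :=
  \sum_(T : {ffun cell mu -> 'I_N} | semistandard T)
     \prod_(c : cell mu) alph_var i (T c).

(* The coefficient of chi^(mu_1) x ... x chi^(mu_t) in the character phi, by  *)
(* orthonormality of the irreducible characters.                              *)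
Definition frob_mult (t m : nat) (phi : symt t m -> rat)
    (mu : {ffun 'I_t -> part m}) : rat :=
  #|{: symt t m}|%:R^-1 *
  \sum_(g : symt t m) phi g * \prod_(i < t) specht_char (mu i) (g i)^-1%g.

Definition product_frob (t m N : nat) (phi : symt t m -> rat) :
    {mpoly rat[t * N]} :=
  \sum_(mu : {ffun 'I_t -> part m})
     frob_mult phi mu *: \prod_(i < t) schur N i (mu i).

Definition beta (t m : nat) (J : {fset nat}) (N : nat) : {mpoly rat[t * N]} :=
  product_frob N (@Bt_top_char t m J).

(* Main.v *)
Require Import Defs.
From mathcomp Require Import all_boot all_order all_algebra all_fingroup.
From mathcomp Require Import mxrepresentation finmap.
From mathcomp Require Import mpoly zify ring.

(* Write alpha_n(J) for the product Frobenius characteristic of the           *)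
(* permutation module on the flags of type J.  The theorem follows from       *)
(*   (1) alpha_n(J) = \sum_(I c J) beta_n(I), and                              *)
(*   (2) alpha_n(J) = the product over the alphabets of h_a, a ranging over    *)
(*       the gaps of {0} u J u {n},                                            *)
(* since (2) gives alpha_n(J' u {j_r}) = alpha_(j_r)(J') \prod_i h_(n - j_r),  *)
(* and (1) turns this into the claim by induction on J'.                      *)
(*   For (1): the top cycles of type I, pulled back to the flags of type J,   *)
(* span the chain space (rational orthogonality of kernel and image), and     *)
(* the sum is direct by a dimension count.  Call an element x of a flag an    *)
(* ascent if replacing x by any other element increases the sum of the        *)
(* entries; a cycle is determined by its values on the flags without ascents, *)
(* and those of all types I c J are the images of the flags of type J under   *)
(* deletion of the ascents.                                                   *)
(*   For (2): by Frobenius' formula, the sum of chi^mu(g) s_mu over all mu is *)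
(* the sum of the monomials of the words fixed by g, so that the              *)
(* characteristic of a permutation module is an orbit count.  Frobenius'      *)
(* formula is Young's rule: Specht characters are orthonormal and occur       *)
(* unitriangularly in the tabloid characters M^nu, the Kostka numbers are     *)
(* unitriangular as well, and both Gram matrices of (M^nu) agree by Cauchy's  *)
(* identity, hence the multiplicities are the Kostka numbers.                 *)

Set Implicit Arguments.
Unset Strict Implicit.
Unset Printing Implicit Defensive.

Import Order.TTheory GRing.Theory Num.Theory.
Local Open Scope ring_scope.

(** The fixed points of the group on the flags of type [J] are counted in two ways.

    On the homological side ([card_fixed_flags]) the permutation module on these flags is the direct
    sum, over all [I] inside [J], of the top homology of the rank selection [I]. In top degree
    homology is the space of cycles. The chain space is the sum of the cycles and the image of the
    transposed boundary, and the latter is pulled back from smaller types; by induction the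
    pulled-back cycles of all types span ([flag_pull_summands]). No Betti number has to be known for
    directness: [rank_cycles] bounds each cycle space by the number of essential flags,
    [sum_ess_flags] bounds the total number of these by the number of flags of type [J], and all
    inequalities collapse in [rank_flag_summand].

    On the combinatorial side ([card_fixed_flags_words]) a flag is a tuple of words of prescribed
    content, one for each coordinate, so the count is a product over coordinates. It becomes a
    product of complete homogeneous functions ([sum_cum_words]) by means of [frobenius_formula]: the
    sum of the Schur functions weighted by the character values at [g] is the power sum of [g]. That
    formula follows from Young's rule, which combines the homomorphisms from Specht modules to
    tabloid modules ([hom_not_dominates], [hom_diag]) with the Cauchy identity ([cauchy],
    [word_count_pair]).

    Together they give [sum_beta]. Adjoining j_r to a set J' of smaller ranks appends the single gap
    n - j_r, so the theorem holds after summation over all subsets K of J'; induction on J' cancels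
    the proper subsets and leaves the term K = J'. *)

Lemma card_ord_lt m k : #|[set i : 'I_m | (i < k)%N]| = minn k m.
Proof.
rewrite -sum1dep_card -(big_mkord (fun i => i < k)%N (fun=> 1%N)).
case: (leqP k m) => [le_km|/ltnW le_mk].
  rewrite -(big_nat_widen 0 k m xpredT (fun=> 1%N)) //.
  by rewrite sum_nat_const_nat muln1 subn0.
rewrite big_nat_cond (eq_bigl (fun i => (0 <= i < m)%N && true)); last first.
  by move=> i /=; case: ltnP => // lt_i; rewrite (leq_trans lt_i).
by rewrite -big_nat_cond sum_nat_const_nat muln1 subn0.
Qed.

Lemma mem_initial_ord m (X : {set 'I_m}) :
    (forall i j : 'I_m, j \in X -> (i <= j)%N -> i \in X) ->
  forall j, (j \in X) = (j < #|X|)%N.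
Proof.
move=> clX j; apply/idP/idP=> [jX|].
  rewrite -[X in (X <= _)%N](minn_idPl (ltn_ord j)) -card_ord_lt.
  by apply: subset_leq_card; apply/subsetP=> i; rewrite inE ltnS; apply: clX.
apply: contraLR => jX; rewrite -leqNgt.
rewrite -[leqRHS](minn_idPl (ltnW (ltn_ord j))) -card_ord_lt.
apply: subset_leq_card; apply/subsetP=> i iX; rewrite inE ltnNge.
by apply: contra jX; apply: clX.
Qed.

(** * Homology of flags *)

Section SubmodTrace.

Context (F : fieldType) (gT : finGroupType) (G : {group gT}) (n : nat).
Context (rG : mx_representation F G n).

(** Passing from the basis chosen by [submod_repr] to [v] conjugates the matrix, so the trace may be
    read off in any convenient basis. *)
Lemma mxtrace_submod_basis (V : 'M_n) (modV : mxmodule rG V) r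
    (v : 'M_(r, n)) (A : 'M_r) g :
    row_free v -> (v :=: V)%MS -> v *m rG g = A *m v ->
  \tr (submod_repr modV g) = \tr A.
Proof.
move=> v_free defV vg; set b := val_submod (1%:M : 'M_(\rank V)).
have sbv : (b <= v)%MS by rewrite defV -(val_submod1 V).
pose C := in_submod V v; pose D := b *m pinvmx v.
have Dv : D *m v = b by rewrite mulmxKpV.
have Cb : C *m b = v.
  by rewrite -val_submodE in_submodK // defV.
have CD : C *m D = 1%:M.
  by apply: (row_free_inj v_free); rewrite -mulmxA Dv Cb mul1mx.
have -> : submod_repr modV g = D *m A *m C.
  rewrite /= /submod_mx -/b -Dv -mulmxA vg mulmxA.
  by rewrite /C in_submodE [in_submod V v]in_submodE !mulmxA.
by rewrite -mulmxA mxtrace_mulC -mulmxA CD mulmx1.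
Qed.

(** Homology is defined as a section, cycles modulo boundaries; this applies when the boundaries
    vanish, as in top degree. *)
Lemma mxtrace_section0 (U V : 'M_n) (modU : mxmodule rG U)
    (modV : mxmodule rG V) g :
  g \in G -> U = 0 -> \tr (section_repr modU modV g) = \tr (submod_repr modV g).
Proof.
move=> Gg U0; set W := <<in_factmod U V>>%MS.
pose b := val_submod (1%:M : 'M_(\rank W)).
have fvK m (X : 'M_(m, n)) : val_factmod (in_factmod U X) = X.
  have := add_sub_fact_mod U X.
  suff -> : val_submod (in_submod U X) = 0 by rewrite add0r.
  apply/eqP; rewrite -submx0 -[X in (_ <= X)%MS]U0; exact: val_submodP.
symmetry; apply: (@mxtrace_submod_basis _ _ _ (val_factmod b)).
- rewrite /row_free.
  have b_free : row_free b by rewrite /row_free val_submod1.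
  apply/row_freeP; case/row_freeP: b_free => b' bb'.
  by exists (in_factmod U 1%:M *m b'); rewrite mulmxA -in_factmodE val_factmodK.
- apply/eqmxP/andP; split.
    rewrite -(fvK _ V) val_factmodS.
    by apply: submx_trans (val_submodP _) _; rewrite genmxE.
  rewrite -(fvK _ V) val_factmodS val_submod1.
  by rewrite genmxE.
- rewrite -[LHS]fvK (in_factmodJ modU) // val_factmodK.
  have -> : b *m factmod_mx modU g = section_repr modU modV g *m b.
    rewrite -[in RHS]val_submodE -[section_repr _ _ g]mul1mx.
    exact/esym/(val_submodJ (section_module modU modV)).
  by rewrite [LHS]val_factmodE -mulmxA -val_factmodE.
Qed.

End SubmodTrace.

Section RationalKernel.

Lemma dotmx_eq0 (R : realFieldType) n (v : 'rV[R]_n) : v *m v^T = 0 -> v = 0.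
Proof.
move/matrixP/(_ 0 0); rewrite !mxE => /eqP.
rewrite psumr_eq0 => [/allP v0|i _]; last by rewrite mxE -expr2 sqr_ge0.
apply/rowP=> i; rewrite mxE; apply/eqP.
by have /implyP/(_ isT) := v0 i (mem_index_enum _); rewrite mxE mulf_eq0 orbb.
Qed.

(** The two spaces are orthogonal for the dot product, which is definite over an ordered field, so
    they meet in zero; their dimensions add up. *)
Lemma kermx_add_tr (R : realFieldType) m n (A : 'M[R]_(m, n)) :
  (1%:M <= kermx A + A^T)%MS.
Proof.
rewrite sub1mx -col_leq_rank -(leq_add2r (\rank (kermx A :&: A^T)%MS)).
rewrite mxrank_sum_cap mxrank_ker mxrank_tr subnK ?rank_leq_row //.
suff -> : (kermx A :&: A^T)%MS = 0 by rewrite mxrank0 addn0.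
apply/eqP; rewrite -submx0; apply/rV_subP=> v; rewrite sub_capmx.
case/andP=> /sub_kermxP vA /submxP[u def_v]; rewrite submx0; apply/eqP.
by apply: dotmx_eq0; rewrite {1}def_v -mulmxA -trmx_mul vA trmx0 mulmx0.
Qed.

End RationalKernel.

(** * Flags of the rank-selected poset *)

Section Flags.

Context (t n : nat).
Context (t_gt0 : (0 < t)%N).
Implicit Types (x y z : Bt t n) (c d e : {set Bt t n}) (I J : {fset nat}).

Lemma Bt_card x i : #|x i| = Bt_rank x.
Proof.
apply/eqP; rewrite eqn_leq leq_bigmax_cond //=.
apply/bigmax_leqP=> j _.
by have /forallP/(_ j)/forallP/(_ i)/eqP-> := Bt_equicard x.
Qed.

Lemma Bt_leP x y : reflect (forall i, x i \subset y i) (x <= y)%O.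
Proof. exact: forallP. Qed.

Lemma Bt_le_rank x y : (x <= y)%O -> (Bt_rank x <= Bt_rank y)%N.
Proof.
move/Bt_leP=> le_xy; have i0 := Ordinal t_gt0.
by rewrite -!(Bt_card _ i0) subset_leq_card.
Qed.

Lemma Bt_le_rank_eq x y : (x <= y)%O -> Bt_rank x = Bt_rank y -> x = y.
Proof.
move/Bt_leP=> le_xy eq_r; apply/val_inj/ffunP=> i; apply/eqP.
by rewrite eqEcard le_xy !Bt_card eq_r /=.
Qed.

Lemma Bt_lt_rank x y : (x < y)%O -> (Bt_rank x < Bt_rank y)%N.
Proof.
rewrite lt_neqAle => /andP[neq_xy le_xy].
rewrite ltn_neqAle Bt_le_rank // andbT.
by apply: contra neq_xy => /eqP/(Bt_le_rank_eq le_xy)/eqP.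
Qed.

Lemma comparable_rank_lt x y :
  (x >=< y)%O -> (Bt_rank x < Bt_rank y)%N = (x < y)%O.
Proof.
move=> cmp; apply/idP/idP=> [lt_r|]; last exact: Bt_lt_rank.
case/comparable_ltgtP: cmp lt_r => // [lt_yx|->]; last by rewrite ltnn.
by rewrite ltnNge ltnW // Bt_lt_rank.
Qed.

Lemma comparable_rank_inj x y : (x >=< y)%O -> Bt_rank x = Bt_rank y -> x = y.
Proof.
case/orP=> le_xy eq_r; first exact: Bt_le_rank_eq.
by apply/esym/Bt_le_rank_eq.
Qed.

(** Comparable elements of equal rank coincide, so a face with as many vertices as [J] has proper
    ranks meets each of these ranks exactly once. *)
Definition flags J : {set {set Bt t n}} := faces (Bt_proper t n J) #|` J|.

Definition chain c := {in c &, forall x y, (x >=< y)%O}.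

Definition proper_ranks J := forall j, j \in J -> (0 < j < n)%N.

Lemma Bt_properE J x : proper_ranks J -> (x \in Bt_proper t n J) = (Bt_rank x \in J).
Proof.
move=> prJ; rewrite !inE; have i0 := Ordinal t_gt0.
case: eqP => [->|_] /=.
  apply/esym/negbTE/negP=> /prJ.
  by rewrite -(Bt_card _ i0) ffunE cards0.
case: eqP => [->|_] /=; last by rewrite orbF.
apply/esym/negbTE/negP=> /prJ.
by rewrite -(Bt_card _ i0) ffunE cardsT card_ord ltnn andbF.
Qed.

Lemma facesP J k c : proper_ranks J ->
  reflect [/\ {in c, forall x, Bt_rank x \in J}, #|c| = k & chain c]
          (c \in faces (Bt_proper t n J) k).
Proof.
move=> prJ; rewrite inE; apply: (iffP and3P) => [[/subsetP sc /eqP cc ch]|[sc cc ch]].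
  split=> // [x /sc|x y xc yc]; first by rewrite Bt_properE.
  by have /forall_inP/(_ x xc)/forall_inP/(_ y yc) := ch.
split; first by apply/subsetP=> x /sc; rewrite Bt_properE.
  by apply/eqP.
by apply/forall_inP=> x xc; apply/forall_inP=> y yc; apply: ch.
Qed.

Lemma chain_sub c d : c \subset d -> chain d -> chain c.
Proof. by move=> /subsetP scd ch x y /scd xd /scd; apply: ch. Qed.

Lemma chain_rank_inj c : chain c -> {in c &, injective (@Bt_rank t n)}.
Proof. by move=> ch x y xc yc; apply: comparable_rank_inj; apply: ch. Qed.

Lemma chain_ranks_uniq c : chain c -> uniq [seq Bt_rank x | x <- enum c].
Proof.
move=> ch; rewrite map_inj_in_uniq ?enum_uniq // => x y.
by rewrite !mem_enum; apply: chain_rank_inj.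
Qed.

Lemma chain_card J c :
  {in c, forall x, Bt_rank x \in J} -> chain c -> (#|c| <= #|` J|)%N.
Proof.
move=> rc ch; rewrite cardE -(size_map (@Bt_rank t n)).
apply: uniq_leq_size (chain_ranks_uniq ch) _ => _ /mapP[x xc ->].
by apply: rc; rewrite mem_enum in xc.
Qed.

Lemma flag_rank_surj J c j : proper_ranks J -> c \in flags J -> j \in J ->
  exists2 x, x \in c & Bt_rank x = j.
Proof.
move=> prJ /(facesP _ _ prJ)[rc cc ch] jJ.
have [||_ eqs] := uniq_min_size (chain_ranks_uniq ch) (s2 := J).
  by move=> _ /mapP[x xc ->]; apply: rc; rewrite mem_enum in xc.
  by rewrite size_map -cardE cc.
have := eqs j; rewrite jJ => /mapP[x xc ->].
by exists x => //; rewrite mem_enum in xc.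
Qed.

Definition rank_sel I d := [set x in d | Bt_rank x \in I].

Lemma rank_sel_sub I d : rank_sel I d \subset d.
Proof. by apply/subsetP=> x; rewrite inE => /andP[]. Qed.

Lemma chain_flag J c : proper_ranks J -> chain c ->
    {in c, forall x, Bt_rank x \in J} ->
    (forall j, j \in J -> exists2 x, x \in c & Bt_rank x = j) ->
  c \in flags J.
Proof.
move=> prJ ch rc surj; apply/(facesP _ _ prJ); split=> //.
rewrite cardE -(size_map (@Bt_rank t n)); apply: perm_size.
apply: uniq_perm; [exact: chain_ranks_uniq | exact: fset_uniq|] => j.
apply/mapP/idP=> [[x xc ->]|/surj[x xc <-]].
  by apply: rc; rewrite mem_enum in xc.
by exists x; rewrite ?mem_enum.
Qed.

Lemma proper_ranksS I J : (I `<=` J)%fset -> proper_ranks J -> proper_ranks I.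
Proof. by move=> /fsubsetP sIJ prJ j /sIJ; apply: prJ. Qed.

Lemma rank_sel_flag I J d : proper_ranks J -> (I `<=` J)%fset ->
  d \in flags J -> rank_sel I d \in flags I.
Proof.
move=> prJ sIJ dJ; have [rd cd ch] := facesP _ _ prJ dJ.
apply: chain_flag; first exact: proper_ranksS prJ.
- exact: chain_sub (rank_sel_sub I d) ch.
- by move=> x; rewrite inE => /andP[].
move=> j jI; have [x xd rx] := flag_rank_surj prJ dJ (fsubsetP sIJ _ jI).
by exists x; rewrite // inE xd rx.
Qed.

(** A flag has exactly one subflag of each smaller type, which makes restriction of flags a map. *)
Lemma flag_sub_sel I J c d : proper_ranks J -> (I `<=` J)%fset ->
  c \in flags I -> d \in flags J -> (c \subset d) = (c == rank_sel I d).
Proof.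
move=> prJ sIJ cI dJ; apply/idP/eqP=> [scd|->]; last exact: rank_sel_sub.
have prI := proper_ranksS sIJ prJ.
have [rc cc _] := facesP _ _ prI cI.
have [_ cs _] := facesP _ _ prI (rank_sel_flag prJ sIJ dJ).
apply/eqP; rewrite eqEcard cc cs leqnn andbT.
by apply/subsetP=> x xc; rewrite inE (subsetP scd) ?rc.
Qed.

End Flags.

(** * Top cycles and an upper bound for their dimension *)

Section Cycles.

Context (t n : nat).
Context (t_gt0 : (0 < t)%N).
Implicit Types (x y z : Bt t n) (c d e : {set Bt t n}) (I J : {fset nat}).

(** When [e] misses a single rank of [J], this counts the elements of [e] below that rank: the
    exponent of the sign for deleting it. Only [J] and [e] enter, not the flag that contains [e]. *)
Definition gap_count J e : nat :=
  #|[set y in e | has (fun j => (Bt_rank y < j)%N &&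
                         [forall x in e, Bt_rank x != j]) J]|.

Lemma boundary_coef_flag J c e :
    proper_ranks n J -> (0 < #|` J|)%N ->
    c \in flags t n J -> e \in faces (Bt_proper t n J) #|` J|.-1 ->
  boundary_coef c e = (-1) ^+ gap_count J e * (e \subset c)%:R.
Proof.
move=> prJ J_gt0 cJ eJ.
have [rc cc chc] := facesP t_gt0 _ _ prJ cJ.
have [re ce che] := facesP t_gt0 _ _ prJ eJ.
have [sec|nsec] := boolP (e \subset c); last first.
  rewrite mulr0 /boundary_coef big1 // => x /andP[_ /eqP def_e].
  by rewrite -def_e subD1set in nsec.
rewrite mulr1.
have /cards1P[x def_x] : #|c :\: e| == 1%N.
  by rewrite cardsD (setIidPr sec) cc ce -[in X in (X - _)%N](prednK J_gt0) subSnn.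
have xce : x \in c :\: e by rewrite def_x set11.
have [xc xe] : x \in c /\ x \notin e by move: xce; rewrite inE => /andP[].
have def_e : c :\ x = e.
  by rewrite -def_x setDDr setDv set0U (setIidPr sec).
rewrite /boundary_coef (bigD1 x) /= ?xc ?def_e ?eqxx // big1 => [|y]; last first.
  case/andP=> /andP[yc /eqP ye] neq_yx.
  have : y \in e by rewrite -def_e !inE neq_yx yc.
  by rewrite -ye !inE eqxx.
rewrite addr0; congr (_ ^+ _); apply: eq_card => y; rewrite !inE -def_e !inE.
have [-> /=|neq_yx /=] := eqVneq y x; first by rewrite ltxx andbF.
have [yc /=|//] := boolP (y \in c).
rewrite -(comparable_rank_lt t_gt0 (chc _ _ yc xc)).
apply/idP/hasP=> [lt_yx|[j jJ /andP[lt_yj /forall_inP ne_j]]].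
  exists (Bt_rank x); rewrite ?rc // lt_yx /=.
  apply/forall_inP=> z; rewrite !inE => /andP[neq_zx zc].
  by apply: contra neq_zx => /eqP/(chain_rank_inj chc zc xc)/eqP.
have [z zc rz] := flag_rank_surj t_gt0 prJ cJ jJ.
have [zx|neq_zx] := eqVneq z x; first by rewrite -zx rz.
by have := ne_j z; rewrite !inE neq_zx zc rz eqxx => /(_ isT).
Qed.

(** The sign in [boundary_coef_flag] depends on the face alone, so it factors out of the cycle
    condition. *)
Lemma cycleP J (v : 'rV_#|flags t n J|) :
    proper_ranks n J -> (0 < #|` J|)%N ->
    (v <= cycles (Bt_proper t n J) #|` J|)%MS ->
  forall e, e \in faces (Bt_proper t n J) #|` J|.-1 ->
  \sum_a v 0 a * (e \subset enum_val a)%:R = 0.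
Proof.
move=> prJ J_gt0 /sub_kermxP/rowP vK e eJ.
have := vK (enum_rank_in eJ e); rewrite !mxE.
under eq_bigr => a _.
  rewrite mxE enum_rankK_in // (boundary_coef_flag prJ J_gt0 (enum_valP _) eJ).
  rewrite mulrCA; over.
by rewrite -mulr_sumr => /eqP; rewrite mulf_eq0 signr_eq0 => /eqP.
Qed.

(* x is coordinatewise the set with the smallest entries among the elements   *)
(* of its rank that are comparable to all of c :\ x; the conditions on a and  *)
(* b say that exchanging a for b keeps x inside the chain.                    *)
Definition asc c x : bool :=
  [forall l, forall a, forall b,
     [&& a \in x l, b \notin x l,
         [forall y in c, (y < x)%O ==> (a \notin y l)]
       & [forall y in c, (x < y)%O ==> (b \in y l)]] ==> (a < b)%N].

Lemma ascP c x :
  reflect (forall l a b, a \in x l -> b \notin x l ->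
             (forall y, y \in c -> (y < x)%O -> a \notin y l) ->
             (forall y, y \in c -> (x < y)%O -> b \in y l) -> (a < b)%N)
          (asc c x).
Proof.
apply: (iffP forallP) => [asc_cx l a b ax bx ay byy|asc_cx l].
  have /forallP/(_ a)/forallP/(_ b)/implyP-> // := asc_cx l.
  rewrite ax bx /=; apply/andP; split.
    by apply/forall_inP=> y yc; apply/implyP; apply: ay.
  by apply/forall_inP=> y yc; apply/implyP; apply: byy.
apply/forallP=> a; apply/forallP=> b; apply/implyP=> /and4P[ax bx ay byy].
apply: (asc_cx l) => // y yc; apply/implyP.
  by have /forall_inP/(_ y yc) := ay.
by have /forall_inP/(_ y yc) := byy.
Qed.

Definition weight x : nat := \sum_(l < t) \sum_(a in x l) a.

Lemma sum_ltn_set (X Y : {set 'I_n}) :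
    #|X| = #|Y| -> X != Y ->
    (forall a b, a \in X :\: Y -> b \in Y :\: X -> (a < b)%N) ->
  (\sum_(a in X) a < \sum_(a in Y) a)%N.
Proof.
move=> cXY neqXY ltXY.
have cD : #|X :\: Y| = #|Y :\: X|.
  by apply: (@addnI #|X :&: Y|); rewrite cardsID [X :&: Y]setIC cardsID.
have D_gt0 : (0 < #|X :\: Y|)%N.
  rewrite card_gt0; apply: contra neqXY => /eqP D0.
  rewrite eqEsubset -setD_eq0 D0 eqxx /= -setD_eq0 -cards_eq0 -cD D0.
  by rewrite cards0.
rewrite (big_setID Y) /= [ltnRHS](big_setID X) /= setIC ltn_add2l.
have /card_gt0P[b0 b0Y] : (0 < #|Y :\: X|)%N by rewrite -cD.
pose M := \max_(a in X :\: Y) a.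
have leM : (\sum_(a in X :\: Y) a <= #|X :\: Y| * M)%N.
  rewrite -sum_nat_const; apply: leq_sum => a aXY.
  exact: (@leq_bigmax_cond _ (mem (X :\: Y)) (@nat_of_ord n)).
apply: leq_ltn_trans leM _; apply: (@leq_trans (#|Y :\: X| * M.+1)%N).
  by rewrite -cD ltn_mul2l D_gt0 /=.
rewrite -sum_nat_const; apply: leq_sum => b bYX.
have /card_gt0P[a0 a0X] := D_gt0.
have [a1 a1X defM] := @eq_bigmax_cond _ (mem (X :\: Y)) (@nat_of_ord n) D_gt0.
have -> : M = a1 by exact: defM.
exact: ltXY.
Qed.

(** Elements of [c] below [x] stay below [y] and those above stay above. Hence [asc] applies to
    every exchange made in passing from [x] to [y], and each entry lost is smaller than each entry
    gained. *)
Lemma asc_weight c x y : chain c -> x \in c -> asc c x -> y != x ->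
    Bt_rank y = Bt_rank x -> chain (y |: c :\ x) ->
  (weight x < weight y)%N.
Proof.
move=> chc xc /ascP asc_cx neq_yx ryx ch'.
have cmp z : z \in c -> z != x ->
    ((z < x)%O -> (z <= y)%O) /\ ((x < z)%O -> (y <= z)%O).
  move=> zc zx.
  have zyc : (y >=< z)%O by apply: ch'; rewrite !inE ?eqxx ?zc ?zx ?orbT.
  split=> /(Bt_lt_rank t_gt0); rewrite -ryx.
    by rewrite (comparable_rank_lt t_gt0) 1?comparable_sym // => /ltW.
  by rewrite (comparable_rank_lt t_gt0) // => /ltW.
have lt_l l a b : a \in x l :\: y l -> b \in y l :\: x l -> (a < b)%N.
  rewrite !inE => /andP[ay ax] /andP[bx byl]; apply: (asc_cx l) => // z zc ltz.
    have [le_zy _] := cmp z zc (negbT (lt_eqF ltz)).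
    by apply: contra ay; apply/subsetP; move/Bt_leP: (le_zy ltz).
  have [_ le_yz] := cmp z zc (negbT (gt_eqF ltz)).
  by have /Bt_leP/(_ l)/subsetP := le_yz ltz; apply.
have le_l l : (\sum_(a in x l) a <= \sum_(a in y l) a)%N.
  have [->//|neq_l] := eqVneq (x l) (y l).
  by apply/ltnW/sum_ltn_set => // [|a b]; [rewrite !Bt_card | apply: lt_l].
have [l neq_l] : exists l, x l != y l.
  apply/existsP; apply: contraNT neq_yx; rewrite negb_exists => /forallP eq_l.
  by apply/eqP/val_inj/ffunP=> l; apply/esym/eqP; have := eq_l l; rewrite negbK.
rewrite /weight (bigD1 l) //= [ltnRHS](bigD1 l) //= -addSn leq_add //.
  by apply: sum_ltn_set => // [|a b]; [rewrite !Bt_card | apply: lt_l].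
by apply: leq_sum => i _.
Qed.

Definition essential c : bool := [forall x in c, ~~ asc c x].

Definition ess_flags J := [set c in flags t n J | essential c].

(* At a flag of maximal weight in the support, an ascent x would make it the  *)
(* only flag of the support containing the face without x.                    *)
Lemma cycle_ess0 J (v : 'rV_#|flags t n J|) : proper_ranks n J ->
    (v <= cycles (Bt_proper t n J) #|` J|)%MS ->
    (forall a, essential (enum_val a) -> v 0 a = 0) ->
  v = 0.
Proof.
move=> prJ vK v_ess; apply/eqP/rV0Pn; case=> a0 va0.
pose W (a : 'I_#|flags t n J|) := (\sum_(x in enum_val a) weight x)%N.
have [a va maxa] := arg_maxnP W (P := fun a => v 0 a != 0) va0.
have aJ := enum_valP a; have [rc cc chc] := facesP t_gt0 _ _ prJ aJ.
set c := enum_val a in aJ rc cc chc.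
have : ~~ essential c by apply: contra va => /v_ess->.
rewrite negb_forall => /existsP[x]; rewrite negb_imply negbK => /andP[xc asc_x].
have J_gt0 : (0 < #|` J|)%N by rewrite -cc card_gt0; apply/set0Pn; exists x.
have eJ : c :\ x \in faces (Bt_proper t n J) #|` J|.-1.
  apply/(facesP t_gt0 _ _ prJ); split.
  - by move=> y; rewrite !inE => /andP[_ /rc].
  - by rewrite -cc (cardsD1 x c) xc.
  - exact: chain_sub (subD1set c x) chc.
have /eqP := cycleP prJ J_gt0 vK eJ.
rewrite (bigD1 a) //= subD1set mulr1 big1 ?addr0 => [|b neq_ba].
  by apply/negP.
have [sxb|] := boolP (_ \subset _); last by rewrite mulr0.
have bJ := enum_valP b; have [rb cb chb] := facesP t_gt0 _ _ prJ bJ.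
set d := enum_val b in sxb bJ rb cb chb *.
suff : (W a < W b)%N.
  rewrite mulr1 ltnNge => nle; apply/eqP.
  by apply: contraNT nle; apply: maxa.
have [y yd ry] := flag_rank_surj t_gt0 prJ bJ (rc x xc).
have ye : y \notin c :\ x.
  apply/negP; rewrite !inE => /andP[neq_yx yc].
  by case/eqP: neq_yx; apply: (chain_rank_inj chc).
have def_d : y |: c :\ x = d.
  apply/eqP; rewrite eqEcard subUset sub1set yd sxb /= cb cardsU1 ye.
  by rewrite -cc (cardsD1 x c) xc.
have neq_yx : y != x.
  apply: contra neq_ba => /eqP yx; apply/eqP/enum_val_inj.
  by rewrite -/c -/d -def_d yx setD1K.
rewrite /W -/c -/d -def_d (big_setD1 x) //= big_setU1 //= ltn_add2r.
by apply: (asc_weight chc) => //; rewrite def_d.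
Qed.

(** By [cycle_ess0] the restriction of cycles to essential flags, given by the matrix [R], is
    injective. *)
Lemma rank_cycles J : proper_ranks n J ->
  (\rank (cycles (Bt_proper t n J) #|` J|) <= #|ess_flags J|)%N.
Proof.
move=> prJ; set K := cycles _ _.
pose R : 'M[rat]_(#|flags t n J|, #|ess_flags J|) :=
  \matrix_(a, b) (enum_val a == enum_val b)%:R.
rewrite -(mxrank_mul_ker K R).
suff -> : (K :&: kermx R)%MS = 0 by rewrite mxrank0 addn0 rank_leq_col.
apply/eqP; rewrite -submx0; apply/rV_subP=> v; rewrite sub_capmx.
case/andP=> vK /sub_kermxP/rowP vR; rewrite submx0; apply/eqP.
apply: (cycle_ess0 prJ vK) => a ess_a.
have aE : enum_val a \in ess_flags J by rewrite inE enum_valP.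
have := vR (enum_rank_in aE (enum_val a)).
rewrite !mxE (bigD1 a) //= mxE enum_rankK_in // eqxx mulr1 big1 ?addr0 //.
move=> b neq_ba; rewrite mxE enum_rankK_in // (inj_eq enum_val_inj).
by rewrite (negbTE neq_ba) mulr0.
Qed.

End Cycles.

(** * Initial segments for an injective key *)

Section InitialSegments.

Context (T : finType) (key : T -> nat).
Context (key_inj : injective key).

Definition key_index a := #|[set b | (key b < key a)%N]|.

Definition init_seg j := [set a | (key_index a < j)%N].

Definition key_closed (X : {set T}) :=
  forall a b, a \in X -> (key b < key a)%N -> b \in X.

Lemma key_index_lt a b : (key b < key a)%N -> (key_index b < key_index a)%N.
Proof.
move=> lt_ba; apply: proper_card; apply/properP; split.
  by apply/subsetP=> z; rewrite !inE => /ltn_trans->.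
by exists b; rewrite !inE ?ltnn.
Qed.

Lemma key_index_inj : injective key_index.
Proof.
move=> a b eq_ab; apply: key_inj.
by case: (ltngtP (key a) (key b)) => // /key_index_lt; rewrite eq_ab ltnn.
Qed.

Lemma key_index_bound a : (key_index a < #|T|)%N.
Proof.
rewrite -cardsT; apply: proper_card; apply/properP; split=> //.
by exists a; rewrite !inE ?ltnn.
Qed.

Lemma card_init_seg j : #|init_seg j| = minn j #|T|.
Proof.
pose f a := Ordinal (key_index_bound a).
have f_inj : injective f by move=> a b /(congr1 val) /key_index_inj.
have f_bij : bijective f by apply: inj_card_bij; rewrite ?card_ord.
rewrite -card_ord_lt.
rewrite -(on_card_preimset (subon_bij (subsetP (subsetT _)) (onW_bij _ f_bij))).
by apply: eq_card => a; rewrite !inE.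
Qed.

Lemma key_closed_init_seg X : key_closed X -> X = init_seg #|X|.
Proof.
move=> clX; apply/eqP; rewrite eqEcard card_init_seg geq_minl andbT.
apply/subsetP=> a aX; rewrite inE; apply: proper_card; apply/properP; split.
  by apply/subsetP=> b; rewrite inE; apply: clX.
by exists a; rewrite ?inE ?ltnn.
Qed.

Lemma init_seg_closed j : key_closed (init_seg j).
Proof. by move=> a b; rewrite !inE => lt_a /key_index_lt/ltn_trans->. Qed.

End InitialSegments.

(** * Sorted refinements and the number of essential flags *)

Section EssentialFlags.

Context (t n : nat).
Context (t_gt0 : (0 < t)%N).
Implicit Types (x y z : Bt t n) (c d e : {set Bt t n}) (I J : {fset nat}).

(* The index of the step of the chain at which a enters coordinate l.         *)
Definition block c l (a : 'I_n) := #|[set x in c | a \notin x l]|.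
(** Lexicographic order by step of entry, then by size, since every letter is less than [n]. *)
Definition block_key c l (a : 'I_n) := (block c l a * n + a)%N.

Lemma block_key_inj c l : injective (block_key c l).
Proof.
move=> a b; rewrite /block_key => eq_ab; apply: val_inj => /=.
by have := congr1 (modn^~ n) eq_ab; rewrite /= !modnMDl !modn_small.
Qed.

Lemma block_key_lt c l a b :
  (block_key c l a < block_key c l b)%N -> (block c l a <= block c l b)%N.
Proof.
rewrite /block_key; case: (leqP (block c l a) (block c l b)) => // lt_ba lt_k.
have := ltn_ord b; have := ltn_ord a; nia.
Qed.

Definition block_seg_fun c j : {ffun 'I_t -> {set 'I_n}} :=
  [ffun l => init_seg (block_key c l) j].

Lemma block_seg_card c j l : #|block_seg_fun c j l| = minn j n.
Proof. by rewrite ffunE card_init_seg ?card_ord //; apply: block_key_inj. Qed.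

Lemma block_seg_equicard c j : equicard (block_seg_fun c j).
Proof.
by apply/forallP=> l; apply/forallP=> l'; rewrite !block_seg_card.
Qed.

Definition block_seg c j : Bt t n := MkBt (block_seg_equicard c j).

Lemma block_seg_rank c j : (j <= n)%N -> Bt_rank (block_seg c j) = j.
Proof.
by move=> le_j; rewrite -(Bt_card _ (Ordinal t_gt0)) block_seg_card (minn_idPl _).
Qed.

Lemma block_seg_le c i j : (i <= j)%N -> (block_seg c i <= block_seg c j)%O.
Proof.
move=> le_ij; apply/Bt_leP=> l; rewrite !ffunE; apply/subsetP=> a; rewrite !inE.
by move/leq_trans->.
Qed.

Lemma block_seg_closed c j l : key_closed (block_key c l) (block_seg c j l).
Proof. by rewrite ffunE; apply: init_seg_closed. Qed.

Lemma chain_key_closed c x l :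
  chain c -> x \in c -> key_closed (block_key c l) (x l).
Proof.
move=> chc xc a b ax /block_key_lt le_blk; apply/negPn/negP=> bx.
suff : (block c l a < block c l b)%N by rewrite ltnNge le_blk.
apply: proper_card; apply/properP; split; last by exists x; rewrite !inE ?xc ?ax.
apply/subsetP=> y; rewrite !inE => /andP[yc ay]; rewrite yc /=.
have /orP[/Bt_leP/(_ l)/subsetP sxy|/Bt_leP/(_ l)/subsetP syx] := chc x y xc yc.
  by rewrite sxy in ay.
by apply: contra bx; apply: syx.
Qed.

Lemma chain_block_seg c x : chain c -> x \in c -> x = block_seg c (Bt_rank x).
Proof.
move=> chc xc; apply/val_inj/ffunP=> l; rewrite /= ffunE.
rewrite -(Bt_card x l); apply: key_closed_init_seg; first exact: block_key_inj.
exact: chain_key_closed.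
Qed.

(** Each step of [c] is filled in increasing order of letters, in every coordinate, and the sets of
    the ranks in [J] are kept; elements inserted in this way are ascents. *)
Definition sorted_refinement J c : {set Bt t n} :=
  [set block_seg c (val j) | j : J].

Definition ess_part d := [set x in d | ~~ asc d x].

Lemma sorted_refinement_flag J c : proper_ranks n J ->
  sorted_refinement J c \in flags t n J.
Proof.
move=> prJ; have leJ j : j \in J -> (j <= n)%N by case/prJ/andP=> _ /ltnW.
apply: chain_flag => //.
- move=> _ _ /imsetP[i _ ->] /imsetP[j _ ->].
  rewrite /Order.comparable; case: (leqP (val i) (val j)) => [|/ltnW] le_ij.
    by rewrite block_seg_le.
  by rewrite (block_seg_le _ le_ij) orbT.
- by move=> _ /imsetP[i _ ->]; rewrite block_seg_rank ?leJ ?fsvalP.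
- move=> j jJ; exists (block_seg c j); last by rewrite block_seg_rank ?leJ.
  by apply/imsetP; exists [` jJ]%fset.
Qed.

Lemma sub_sorted_refinement I J c : proper_ranks n J -> (I `<=` J)%fset ->
  c \in flags t n I -> c \subset sorted_refinement J c.
Proof.
move=> prJ sIJ cI; have prI := proper_ranksS sIJ prJ.
have [rc _ chc] := facesP t_gt0 _ _ prI cI.
apply/subsetP=> x xc; have rJ := fsubsetP sIJ _ (rc x xc).
by apply/imsetP; exists [` rJ]%fset; rewrite //= -chain_block_seg.
Qed.

(** Deleting ascents undoes the refinement: every inserted element is an ascent, and an element of
    [c] that is an ascent of the refinement would already be an ascent of [c]. *)
Lemma ess_part_sorted_refinement I J c : proper_ranks n J -> (I `<=` J)%fset ->
  c \in ess_flags t n I -> ess_part (sorted_refinement J c) = c.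
Proof.
move=> prJ sIJ; rewrite inE => /andP[cI /forall_inP ess_c].
have prI := proper_ranksS sIJ prJ.
have [rc _ chc] := facesP t_gt0 _ _ prI cI.
have scd := sub_sorted_refinement prJ sIJ cI.
have [rd _ chd] := facesP t_gt0 _ _ prJ (sorted_refinement_flag c prJ).
set d := sorted_refinement J c in scd rd chd *.
have clos y l : y \in d -> key_closed (block_key c l) (y l).
  by case/imsetP=> j _ ->; apply: block_seg_closed.
have mem_le y z l a : (y <= z)%O -> a \in y l -> a \in z l.
  by move/Bt_leP/(_ l)/subsetP; apply.
have same l a b : (forall y, y \in c -> (a \notin y l) = (b \notin y l)) ->
    (block_key c l a <= block_key c l b)%N = (a <= b)%N.
  move=> eq_ab; rewrite /block_key.
  suff -> : block c l a = block c l b by rewrite leq_add2l.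
  by apply: eq_card => y; rewrite !inE; apply: andb_id2l => /eq_ab.
apply/setP=> x; rewrite inE; have [xd /=|xd] := boolP (x \in d); last first.
  by apply/esym/negbTE; apply: contra xd; apply/subsetP.
apply/idP/idP=> [|xc].
  (* Here [x] was inserted: no element of [c] separates [a] from [b], so both enter at the same step
     and their keys compare as the letters do. *)
  apply: contraR => xc; apply/ascP=> l a b ax bx ay byy.
  have neq_ab : a != b by apply: contraTneq ax => ->.
  have lt_k : (block_key c l a <= block_key c l b)%N.
    by rewrite leqNgt; apply: contra bx; apply: (clos x).
  rewrite ltn_neqAle neq_ab -(@same l) // => y yc.
  have yd := subsetP scd y yc.
  have neq_xy : x != y by apply: contraNneq xc => ->.
  case: (comparable_ltgtP (chd x y xd yd)) neq_xy => [lt _|lt _|] //.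
    by rewrite byy // (mem_le x y) // ltW.
  by rewrite ay //; apply/esym; apply: contra bx; apply/mem_le/ltW.
apply: contra (ess_c x xc) => /ascP asc_d; apply/ascP=> l a b ax bx ay byy.
(* The last letter of [x] and the first letter outside it, in the order of keys, form the critical
   exchange: an exchange allowed in [c] has [a] at most [a'] and [b] at least [b']. *)
have [a' a'x maxa'] := @arg_maxnP _ a (fun a => a \in x l) (block_key c l) ax.
have [b' b'x minb'] := @arg_minnP _ b (fun b => b \notin x l) (block_key c l) bx.
have clos_le y u v : y \in d -> u \in y l ->
    (block_key c l v <= block_key c l u)%N -> v \in y l.
  move=> yd uy; rewrite leq_eqVlt => /orP[/eqP/block_key_inj->//|].
  exact: (clos y l yd u v uy).
have le_aa' : (a <= a')%N.
  rewrite -(@same l) => [|y yc]; [exact: maxa'|]; have yd := subsetP scd y yc.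
  case: (comparable_ltgtP (chd x y xd yd)) => [lt|lt|<-].
  - by rewrite !(mem_le x y) // ltW.
  - rewrite ay //; apply/esym; apply: contra (ay y yc lt) => a'y.
    exact: clos_le yd a'y (maxa' _ ax).
  - by rewrite ax a'x.
have le_b'b : (b' <= b)%N.
  rewrite -(@same l) => [|y yc]; [exact: minb'|]; have yd := subsetP scd y yc.
  case: (comparable_ltgtP (chd x y xd yd)) => [lt|lt|<-].
  - by rewrite byy // (clos_le y b b') ?byy // minb'.
  - have ny u : u \notin x l -> u \notin y l by apply/contra/mem_le/ltW.
    by rewrite !ny.
  - by rewrite bx b'x.
apply: leq_ltn_trans le_aa' _; apply: leq_trans le_b'b.
(* An element of the refinement that is below [x] and contains [a'] contains all of [x l], against
   the ranks; dually above [x] for [b']. *)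
apply: (asc_d l) => // y yd lt.
  apply/negP=> a'y; have := Bt_lt_rank t_gt0 lt; rewrite ltnNge => /negP[].
  rewrite -!(Bt_card _ l); apply: subset_leq_card; apply/subsetP=> u ux.
  exact: clos_le yd a'y (maxa' _ ux).
have := Bt_lt_rank t_gt0 lt; rewrite -!(Bt_card _ l) ltnNge.
case: (boolP (y l \subset x l)) => [/subset_leq_card->//|/subsetPn[u uy ux] _].
exact: clos_le yd uy (minb' _ ux).
Qed.

Lemma flags_type I J c : proper_ranks n I -> proper_ranks n J ->
  c \in flags t n I -> c \in flags t n J -> I = J.
Proof.
have sub I' J' : proper_ranks n I' -> proper_ranks n J' ->
    c \in flags t n I' -> c \in flags t n J' -> (I' `<=` J')%fset.
  move=> pI pJ cI cJ; apply/fsubsetP=> j.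
  case/(flag_rank_surj t_gt0 pI cI)=> x xc <-.
  by have [rc _ _] := facesP t_gt0 _ _ pJ cJ; apply: rc.
by move=> pI pJ cI cJ; apply/eqP; rewrite eqEfsubset !sub.
Qed.

(** The image under [ess_part] of the flags of type [J] contains the essential flags of every type
    inside [J], and these sets are disjoint because a flag determines its type. *)
Lemma sum_ess_flags J : proper_ranks n J ->
  (\sum_(I : fpowerset J) #|ess_flags t n (val I)| <= #|flags t n J|)%N.
Proof.
move=> prJ; apply: leq_trans (leq_imset_card ess_part _).
have subJ (I : fpowerset J) : (val I `<=` J)%fset.
  by rewrite -fpowersetE; apply: fsvalP.
under eq_bigr do rewrite -sum1_card big_mkcond.
rewrite exchange_big /= -sum1_card [leqRHS]big_mkcond.
apply: leq_sum => c _.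
have [I0 cI0|no] := pickP (fun I : fpowerset J => c \in ess_flags t n (val I));
  last by rewrite big1 // => I _; rewrite no.
have -> : c \in ess_part @: flags t n J.
  rewrite -(ess_part_sorted_refinement prJ (subJ I0) cI0).
  by apply: imset_f; apply: sorted_refinement_flag.
rewrite (bigD1 I0) //= cI0 big1 ?addn0 // => I neq_I; case: ifP => // cI.
case/eqP: neq_I; apply: val_inj.
move: cI cI0; rewrite inE => /andP[cI _]; rewrite inE => /andP[cI0 _].
by apply: (flags_type _ _ cI cI0); apply: proper_ranksS (subJ _) prJ.
Qed.

End EssentialFlags.

Lemma mxtrace_set_perm_mx (gT : finGroupType) (X : finType)
    (to : {action gT &-> X}) (A : {set X}) (g : gT) :
  \tr (set_perm_mx to A g) = #|[set x in A | to x g == x]|%:R.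
Proof.
rewrite /mxtrace; under eq_bigr do rewrite mxE.
rewrite -(big_enum_val (A := mem A) (fun x => (to x g == x)%:R)).
rewrite -sum1_card natr_sum [RHS]big_mkcond [LHS]big_mkcond /=.
by apply: eq_bigr => x _; rewrite !inE; case: (x \in A); case: (_ == x).
Qed.

(** * Decomposition of the flag module *)

Section FlagModules.

Context (t n : nat).
Context (t_gt0 : (0 < t)%N).
Implicit Types (x y z : Bt t n) (c d e : {set Bt t n}) (I J : {fset nat}).

Local Notation flag_repr I :=
  (chain_repr (@Bt_act_mono t n) (@acts_Bt_proper t n I) #|` I|).
Local Notation Z I := (cycles (Bt_proper t n I) #|` I|).
Local Notation modZ I :=
  (cycles_module (@Bt_act_mono t n) (@acts_Bt_proper t n I) #|` I|).

(** No chain has more elements than [I], so there are no boundaries in this degree. *)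
Lemma Bt_top_char_cycles I (g : symt t n) : proper_ranks n I ->
  Bt_top_char I g = \tr (submod_repr (modZ I) g).
Proof.
move=> prI; apply: mxtrace_section0; first by rewrite inE.
rewrite /boundaries; suff -> : boundary (Bt_proper t n I) #|` I|.+1 = 0.
  by rewrite genmx0.
apply/eqP; rewrite -mxrank_eq0 -leqn0; apply: leq_trans (rank_leq_row _) _.
rewrite leqn0 cards_eq0; apply/eqP/setP=> c; rewrite in_set0.
apply/negbTE/negP=> /(facesP t_gt0 _ _ prI)[rc cc chc].
by have := chain_card rc chc; rewrite cc ltnn.
Qed.

(** Pullback along the restriction of flags: a flag of type [I] goes to the sum of the flags of type
    [J] extending it. *)
Definition flag_pull I J : 'M[rat]_(#|flags t n I|, #|flags t n J|) :=
  \matrix_(a, b) ((enum_val a : {set Bt t n}) \subset (enum_val b : {set Bt t n}))%:R.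

Lemma setact_subset c d (g : symt t n) :
  (((Bt_action t n)^*)%act c g \subset d) = (c \subset ((Bt_action t n)^*)%act d g^-1%g).
Proof.
apply/subsetP/subsetP=> sub x.
  move=> xc; rewrite -[x](actK (Bt_action t n) g).
  by apply/imset_f/sub/imset_f.
by case/imsetP=> y yc ->; have /imsetP[z zd ->] := sub y yc; rewrite actKV.
Qed.

Lemma flag_pull_equivariant I J g :
  flag_repr I g *m flag_pull I J = flag_pull I J *m flag_repr J g.
Proof.
apply/matrixP=> a b.
rewrite (set_perm_mulmx (acts_faces (@Bt_act_mono t n) (@acts_Bt_proper t n I) _)).
rewrite (mulmx_set_perm (acts_faces (@Bt_act_mono t n) (@acts_Bt_proper t n J) _)).
have inI := set_perm_in (acts_faces (@Bt_act_mono t n) (@acts_Bt_proper t n I) #|` I|).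
have inJ := set_perm_in (acts_faces (@Bt_act_mono t n) (@acts_Bt_proper t n J) #|` J|).
by rewrite !mxE !enum_rankK_in ?inI ?inJ // setact_subset.
Qed.

Definition flag_summand J I : 'M[rat]_#|flags t n J| :=
  <<Z I *m flag_pull I J>>%MS.

Lemma flag_summand_module J I : mxmodule (flag_repr J) (flag_summand J I).
Proof.
rewrite (eqmx_module _ (genmxE _)); apply/mxmoduleP=> g Gg.
rewrite -mulmxA -flag_pull_equivariant mulmxA submxMr //.
by have /mxmoduleP/(_ g Gg) := modZ I.
Qed.

(** A row of the transposed boundary is, up to a common sign, the sum of the flags of type [I]
    through a face [e]. Now [e] is itself a flag of a smaller type, and pulling back the sum gives
    the same as pulling back [e]. *)
Lemma boundary_tr_pull I J : proper_ranks n J -> (I `<=` J)%fset ->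
    (0 < #|` I|)%N -> forall a, exists2 I' : {fset nat},
      (I' `<=` J)%fset && (#|` I'| < #|` I|)%N &
      (row a ((boundary (Bt_proper t n I) #|` I|)^T *m flag_pull I J)
         <= flag_pull I' J)%MS.
Proof.
move=> prJ sIJ I_gt0 a; set e := enum_val a.
have prI := proper_ranksS sIJ prJ.
have eI : e \in faces (Bt_proper t n I) #|` I|.-1 := enum_valP a.
have [re ce che] := facesP t_gt0 _ _ prI eI.
pose I' := [fset j in I | [exists x in e, Bt_rank x == j]]%fset.
have sI'I : (I' `<=` I)%fset by apply/fsubsetP=> j; rewrite !inE => /andP[].
have prI' := proper_ranksS sI'I prI.
have eI' : e \in flags t n I'.
  apply: chain_flag => // [x xe|j].
    by rewrite !inE re //=; apply/existsP; exists x; rewrite xe /=.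
  by rewrite !inE => /andP[_ /existsP[x /andP[xe /eqP<-]]]; exists x.
have [_ ce' _] := facesP t_gt0 _ _ prI' eI'.
exists I'; first by rewrite (fsubset_trans sI'I sIJ) -ce' ce prednK // leqnn.
apply/submxP; exists ((-1) ^+ gap_count I e *: delta_mx 0 (enum_rank_in eI' e)).
apply/rowP=> b; rewrite -scalemxAl -rowE !mxE enum_rankK_in //.
have bJ := enum_valP b; set d := enum_val b in bJ *.
have dI := rank_sel_flag t_gt0 prJ sIJ bJ.
rewrite (bigD1 (enum_rank_in dI (rank_sel I d))) //= !mxE enum_rankK_in //.
rewrite (boundary_coef_flag t_gt0 prI I_gt0 dI eI) rank_sel_sub mulr1.
rewrite big1 ?addr0 => [|a' neq_a']; last first.
  rewrite !mxE (flag_sub_sel t_gt0 prJ sIJ (enum_valP a') bJ).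
  rewrite (_ : _ == _ = false) ?mulr0 //; apply: contraNF neq_a' => /eqP def_a'.
  by apply/eqP/enum_val_inj; rewrite enum_rankK_in.
congr (_ * (nat_of_bool _)%:R); apply/idP/idP=> [|/subsetP sed].
  by move/subset_trans; apply; apply: rank_sel_sub.
by apply/subsetP=> x xe; rewrite inE sed ?re.
Qed.

(** Induction on the size of [I], by [kermx_add_tr]: cycles land in the summand of [I], the image of
    the transposed boundary in those of smaller types. *)
Lemma flag_pull_summands I J : proper_ranks n J -> (I `<=` J)%fset ->
  (flag_pull I J <= \sum_(K : fpowerset J) flag_summand J (val K))%MS.
Proof.
move=> prJ; have [k] := ubnP #|` I|; elim: k I => // k IHk I ltIk sIJ.
have prI := proper_ranksS sIJ prJ.
rewrite -[X in (X <= _)%MS]mul1mx.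
have full := kermx_add_tr (boundary (Bt_proper t n I) #|` I|).
apply: submx_trans (submxMr (flag_pull I J) full) _.
rewrite addsmxMr addsmx_sub; apply/andP; split.
  have IJ : I \in fpowerset J by rewrite fpowersetE.
  apply: submx_trans (sumsmx_sup [` IJ]%fset _ (submx_refl _)) => //.
  by rewrite /flag_summand genmxE.
(* The empty chain has zero boundary by convention, so for empty [I] there is nothing besides
   cycles. *)
case: (posnP #|` I|) => [I0|I_gt0].
  suff -> : boundary (Bt_proper t n I) #|` I| = 0 by rewrite trmx0 mul0mx sub0mx.
  apply/matrixP=> a b; rewrite !mxE /boundary_coef big1 // => x /andP[xa _].
  have [_ ca _] := facesP t_gt0 _ _ prI (enum_valP a).
  by move: xa; rewrite (cards0_eq (etrans ca I0)) inE.
apply/row_subP=> a.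
have [I' /andP[sI'J ltI'] sub] := boundary_tr_pull prJ sIJ I_gt0 a.
apply: submx_trans sub (IHk _ _ sI'J).
by rewrite -ltnS; apply: leq_trans ltIk.
Qed.

Lemma sum_flag_summands J : proper_ranks n J ->
  (\sum_(K : fpowerset J) flag_summand J (val K) :=: 1%:M)%MS.
Proof.
move=> prJ; apply/eqmxP; rewrite submx1 /=.
suff <- : flag_pull J J = 1%:M by apply: flag_pull_summands.
apply/matrixP=> a b; rewrite !mxE.
have [_ ca _] := facesP t_gt0 _ _ prJ (enum_valP a).
have [_ cb _] := facesP t_gt0 _ _ prJ (enum_valP b).
congr (nat_of_bool _)%:R; rewrite -(inj_eq enum_val_inj) eqEcard.
by rewrite (etrans ca (esym cb)) leqnn andbT.
Qed.

(** The dimensions are squeezed: the number of flags is at most the sum of the ranks of the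
    summands, which is at most that of the cycle spaces, which is at most the number of flags. *)
Lemma rank_flag_summand J : proper_ranks n J ->
  mxdirect (\sum_(K : fpowerset J) flag_summand J (val K))%MS /\
  forall K : fpowerset J, \rank (flag_summand J (val K)) = \rank (Z (val K)).
Proof.
move=> prJ; have rank1 := mxrank1 rat #|flags t n J|.
have subJ (I : fpowerset J) : (val I `<=` J)%fset.
  by rewrite -fpowersetE; apply: fsvalP.
have leNZ (K : fpowerset J) : (\rank (flag_summand J (val K)) <= \rank (Z (val K)))%N.
  by rewrite genmxE mxrankM_maxl.
have leZ : (\sum_(K : fpowerset J) \rank (Z (val K)) <= #|flags t n J|)%N.
  apply: leq_trans (sum_ess_flags t_gt0 prJ); apply: leq_sum => K _.
  by apply: rank_cycles => //; apply: proper_ranksS prJ.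
have geN : (#|flags t n J| <= \sum_(K : fpowerset J) \rank (flag_summand J (val K)))%N.
  apply: (@leq_trans (\rank (\sum_(K : fpowerset J) flag_summand J (val K))%MS)).
    by rewrite (sum_flag_summands prJ) rank1.
  elim/big_rec2: _ => [|K m A _ leA]; first by rewrite mxrank0.
  apply: leq_trans (mxrank_adds_leqif _ _).1 _; exact: leq_add.
have leN : (\sum_(K : fpowerset J) \rank (flag_summand J (val K))
            <= \sum_(K : fpowerset J) \rank (Z (val K)))%N by apply: leq_sum.
split.
  rewrite mxdirectE /= eqn_leq (sum_flag_summands prJ) rank1.
  by rewrite geN (leq_trans leN).
move=> K0; apply/eqP.
have [_ eqS] := leqif_sum (fun (K : fpowerset J) (_ : true) => leqif_eq (leNZ K)).
have: (\sum_(K : fpowerset J) \rank (flag_summand J (val K)) ==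
       \sum_(K : fpowerset J) \rank (Z (val K)))%N.
  by rewrite eqn_leq leN (leq_trans leZ).
by rewrite eqS => /forallP/(_ K0).
Qed.

(** Equality of ranks makes pullback injective on cycles, hence an equivariant isomorphism onto the
    summand. *)
Lemma mxtrace_flag_summand J (K : fpowerset J) (g : symt t n) :
  proper_ranks n J ->
  \tr (submod_repr (flag_summand_module J (val K)) g) = Bt_top_char (val K) g.
Proof.
move=> prJ; have sKJ : (val K `<=` J)%fset by rewrite -fpowersetE; apply: fsvalP.
rewrite (Bt_top_char_cycles _ (proper_ranksS sKJ prJ)).
have [_ rN] := rank_flag_summand prJ.
have eqN : (val_submod (1%:M : 'M_(\rank (Z (val K)))) *m flag_pull (val K) J
            :=: flag_summand J (val K))%MS.
  rewrite /flag_summand; apply: eqmx_trans (eqmx_sym (genmxE _)).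
  by apply: eqmxMr; apply: val_submod1.
apply: mxtrace_submod_basis (eqN) _.
  by rewrite /row_free eqN rN.
rewrite -mulmxA -flag_pull_equivariant [LHS]mulmxA [RHS]mulmxA; congr (_ *m _).
rewrite -[in RHS]val_submodE -[submod_repr _ g in RHS]mul1mx.
by apply/esym; apply: (val_submodJ (modZ (val K))); apply: in_setT.
Qed.

Lemma card_fixed_flags J (g : symt t n) : proper_ranks n J ->
  #|[set c in flags t n J | ((Bt_action t n)^*)%act c g == c]|%:R =
  \sum_(K : fpowerset J) Bt_top_char (val K) g.
Proof.
move=> prJ; have [dxN _] := rank_flag_summand prJ.
under eq_bigr do rewrite -mxtrace_flag_summand //.
rewrite (mxtrace_dsum_mod _ (mxmodule1 (flag_repr J)) (sum_flag_summands prJ)) //.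
by rewrite mxtrace_submod1 ?inE // [flag_repr J g]/= mxtrace_set_perm_mx.
Qed.

End FlagModules.

(** * Pieri rule and Cauchy identity *)

Section ConvolutionSum.

Context (R : comNzRingType).

(** The part of degree k in the product over i < N of the series with terms [F i b] in degree b. *)
Fixpoint csum (N k : nat) (F : nat -> nat -> R) : R :=
  if N is N'.+1 then \sum_(b < k.+1) F N' b * csum N' (k - b) F else (k == 0%N)%:R.

Definition ffun_rcons N (T : finType) (p : {ffun 'I_N -> T} * T) : {ffun 'I_N.+1 -> T} :=
  [ffun i => if unlift ord_max i is Some j then p.1 j else p.2].

Lemma ffun_rcons_bij N T : bijective (@ffun_rcons N T).
Proof.
exists (fun f : {ffun 'I_N.+1 -> T} => ([ffun j => f (lift ord_max j)], f ord_max)).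
  move=> [f y]; rewrite /ffun_rcons ffunE unlift_none; congr (_, _).
  by apply/ffunP=> j; rewrite !ffunE liftK.
move=> f; apply/ffunP=> i; rewrite ffunE; case: unliftP => [j ->|->//].
by rewrite ffunE.
Qed.

Lemma csumE B N k F : (k < B)%N ->
  csum N k F =
  \sum_(be : {ffun 'I_N -> 'I_B} | (\sum_(i < N) be i == k)%N) \prod_(i < N) F i (be i).
Proof.
elim: N k => [|N IHN] k ltkB /=.
  have f0 : #|{ffun 'I_0 -> 'I_B}| = 1%N by rewrite card_ffun !card_ord expn0.
  have [be0 be0P] : exists be0, forall be : {ffun 'I_0 -> 'I_B}, be = be0.
    have /card_gt0P[be0 _] : (0 < #|{ffun 'I_0 -> 'I_B}|)%N by rewrite f0.
    by exists be0 => be; apply/ffunP=> -[].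
  rewrite (eq_big (fun=> k == 0%N) (fun=> 1)) => [|be|be _]; try by rewrite big_ord0 // eq_sym.
  case: (k == 0%N); last by rewrite big_pred0.
  by rewrite (big_pred1 be0) // => be; rewrite (be0P be) /= eqxx.
rewrite (reindex (@ffun_rcons N 'I_B)); last exact/onW_bij/ffun_rcons_bij.
have recE (be : {ffun 'I_N -> 'I_B}) (b : 'I_B) :
    (forall i : 'I_N, ffun_rcons (be, b) (widen_ord (leqnSn N) i) = be i) /\
    ffun_rcons (be, b) ord_max = b.
  split=> [i|]; rewrite ffunE ?unlift_none //.
  have -> : widen_ord (leqnSn N) i = lift ord_max i.
    by apply: val_inj; rewrite /= /bump leqNgt ltn_ord.
  by rewrite liftK.
pose G (be : {ffun 'I_N -> 'I_B}) (b : 'I_B) :=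
  (\prod_(i < N) F i (be i)) * F N b.
transitivity (\sum_(p : {ffun 'I_N -> 'I_B} * 'I_B |
    (\sum_(i < N) p.1 i + p.2 == k)%N) G p.1 p.2); last first.
  apply: eq_big => [[be b]|[be b] _] /=; have [eq1 eq2] := recE be b.
    rewrite [in RHS]big_ord_recr /= eq2; congr (_ + _ == _)%N.
    by apply: eq_bigr => i _; rewrite eq1.
  rewrite big_ord_recr /= eq2; congr (_ * _).
  by apply: eq_bigr => i _; rewrite eq1.
rewrite -(pair_big_dep xpredT
  (fun (be : {ffun 'I_N -> 'I_B}) (b : 'I_B) => \sum_(i < N) be i + b == k)%N G) /=.
rewrite (exchange_big_dep xpredT) //=.
rewrite (big_ord_widen B (fun b => F N b * csum N (k - b) F)) // big_mkcond /=.
apply: eq_bigr => b _; case: ifP => [|/negbT] le_b; last first.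
  rewrite big_pred0 // => be; apply: contraNF le_b => /eqP <-.
  by rewrite ltnS leq_addl.
rewrite IHN ?(leq_ltn_trans (leq_subr _ _)) // mulr_sumr.
apply: eq_big => [be|be _]; last by rewrite /G mulrC.
by rewrite ltnS in le_b; rewrite -(eqn_add2r b) subnK.
Qed.

(** The complete homogeneous h_k in [x 0], ..., [x (N-1)], from the product of N geometric
    series. *)
Definition hsum N k (x : nat -> R) := csum N k (fun i b => x i ^+ b).

End ConvolutionSum.

(** * Horizontal strips and their local rule *)

Section Shapes.

Context (m : nat).
Local Notation Y := {ffun 'I_m -> 'I_m.+1}.
Implicit Types (mu ka nu ta : Y).

Definition row_len mu (i : nat) : nat := if insub i is Some j then mu j else 0%N.

Lemma row_lenE mu (i : 'I_m) : row_len mu i = mu i.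
Proof. by rewrite /row_len valK. Qed.

Lemma row_len_out mu i : (m <= i)%N -> row_len mu i = 0%N.
Proof. by move=> le_mi; rewrite /row_len insubN // -leqNgt. Qed.

Lemma row_len_le mu i : (row_len mu i <= m)%N.
Proof. by rewrite /row_len; case: insub => // j; rewrite -ltnS. Qed.

Definition shape_size mu : nat := \sum_(i < m) mu i.

Lemma shape_sizeE mu : shape_size mu = (\sum_(i < m) row_len mu i)%N.
Proof. by apply: eq_bigr => i _; rewrite row_lenE. Qed.

(* mu / ta is a horizontal strip; this forces both mu and ta to be weakly     *)
(* decreasing, so hstrip mu mu expresses that mu is a partition.              *)
Definition hstrip ta mu : bool :=
  [forall i : 'I_m, (row_len mu i.+1 <= row_len ta i <= row_len mu i)%N].

Lemma hstripP ta mu :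
  reflect (forall i, row_len mu i.+1 <= row_len ta i <= row_len mu i)%N
          (hstrip ta mu).
Proof.
apply: (iffP forallP) => [hs i|hs i]; last exact: hs.
case: (ltnP i m) => [lt_im|le_mi]; first exact: (hs (Ordinal lt_im)).
by rewrite !row_len_out // ltnW.
Qed.

Lemma row_len_inj mu nu : (forall i, (i < m)%N -> row_len mu i = row_len nu i) -> mu = nu.
Proof.
move=> eq_mn; apply/ffunP=> i; apply: val_inj => /=.
by rewrite -!row_lenE eq_mn.
Qed.

Lemma hstrip_size ta mu : hstrip ta mu -> (shape_size ta <= shape_size mu)%N.
Proof.
move/hstripP=> hs; rewrite !shape_sizeE; apply: leq_sum => i _.
by have /andP[] := hs i.
Qed.

Lemma hstrip_size_eq ta mu : hstrip ta mu ->
  (shape_size mu <= shape_size ta)%N -> ta = mu.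
Proof.
move/hstripP=> hs; rewrite !shape_sizeE => le_s; apply: row_len_inj => i lt_im.
apply/eqP; rewrite eqn_leq; have /andP[_ ->] /= := hs i; rewrite leqNgt.
apply/negP=> lt_i; suff : (shape_size ta < shape_size mu)%N.
  by rewrite !shape_sizeE ltnNge le_s.
rewrite !shape_sizeE (bigD1 (Ordinal lt_im)) //= [ltnRHS](bigD1 (Ordinal lt_im)) //=.
by rewrite -addSn leq_add // leq_sum // => j _; have /andP[] := hs j.
Qed.

Definition shape_of (f : nat -> nat) : Y := [ffun i : 'I_m => inord (f i)].

Lemma row_len_shape_of f i : (i < m)%N -> (f i <= m)%N -> row_len (shape_of f) i = f i.
Proof.
move=> lt_im le_f; rewrite -[i]/(val (Ordinal lt_im)) row_lenE ffunE inordK //=.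
Qed.

Lemma sum_ord_recl (h : nat -> nat) k : (0 < k)%N ->
  (\sum_(i < k) h i = h 0 + \sum_(i < k.-1) h i.+1)%N.
Proof. by case: k => // k _; rewrite big_ord_recl. Qed.

Lemma sum_ord_recr (h : nat -> nat) k : (0 < k)%N ->
  (\sum_(i < k) h i = \sum_(i < k.-1) h i + h k.-1)%N.
Proof. by case: k => // k _; rewrite big_ord_recr. Qed.

Section LocalRule.

Context (mu ka : Y) (a : nat).
Context (le_am : (shape_size mu + a <= m)%N).
Context (last0 : row_len mu m.-1 = 0%N).
Context (m_gt0 : (0 < m)%N).

Local Notation mx i := (maxn (row_len mu i) (row_len ka i)).
Local Notation mn i := (minn (row_len mu i) (row_len ka i)).

(** The choice of ta_i in its interval is reflected to give nu_(i+1); row 0 takes up the remaining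
    cells. *)
Definition up_fun ta (i : nat) : nat :=
  if i is i'.+1 then (mx i + mn i' - row_len ta i')%N
  else (mx 0 + (a + shape_size ta - shape_size ka))%N.

(** The inverse reflection; row m - 1 of ta has no partner and is zero because it is so in [mu]. *)
Definition down_fun nu (i : nat) : nat :=
  if (i.+1 < m)%N then (mx i.+1 + mn i - row_len nu i.+1)%N else 0%N.

Definition up_set := [set nu : Y | [&& hstrip mu nu, hstrip ka nu
                                     & shape_size nu == shape_size mu + a]%N].
Definition down_set := [set ta : Y | [&& hstrip ta mu, hstrip ta ka
                                       & shape_size ka <= shape_size ta + a]%N].

Lemma down_setP ta : ta \in down_set ->
  (forall i, mx i.+1 <= row_len ta i <= mn i)%N /\
  (shape_size ka <= shape_size ta + a)%N.
Proof.
rewrite inE => /and3P[/hstripP h1 /hstripP h2 le_s]; split=> // i.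
have := h1 i; have := h2 i; lia.
Qed.

Lemma up_setP nu : nu \in up_set ->
  [/\ (mx 0 <= row_len nu 0)%N, (forall i, mx i.+1 <= row_len nu i.+1 <= mn i)%N &
      shape_size nu = (shape_size mu + a)%N].
Proof.
rewrite inE => /and3P[/hstripP h1 /hstripP h2 /eqP ->].
split=> // [|i]; first by have := h1 0%N; have := h2 0%N; lia.
have := h1 i.+1; have := h2 i.+1; have := h1 i; have := h2 i; lia.
Qed.

Lemma sum_mx_mn : (\sum_(i < m) mx i + \sum_(i < m) mn i = shape_size mu + shape_size ka)%N.
Proof.
rewrite !shape_sizeE -!big_split /=; apply: eq_bigr => i _; lia.
Qed.

(** Two reflected rows add up to the end points of their interval, so the total size is fixed except
    for the excess [b] in row 0. *)
Lemma sum_shift (f : nat -> nat) (g : nat -> nat) (b : nat) :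
  (forall i, (i.+1 < m)%N -> f i.+1 + g i = mx i.+1 + mn i)%N -> g m.-1 = 0%N ->
  (f 0 = mx 0 + b)%N ->
  (\sum_(i < m) f i + \sum_(i < m) g i = shape_size mu + shape_size ka + b)%N.
Proof.
move=> fg g0 f0; rewrite -sum_mx_mn.
rewrite (sum_ord_recl f) // (sum_ord_recr g) // (sum_ord_recl (fun i => mx i)) //.
rewrite (sum_ord_recr (fun i => mn i)) // last0 min0n g0 f0 !addn0.
have : (\sum_(i < m.-1) f i.+1 + \sum_(i < m.-1) g i =
        \sum_(i < m.-1) mx i.+1 + \sum_(i < m.-1) mn i)%N.
  rewrite -!big_split /=; apply: eq_bigr => i _; rewrite fg //.
  by have := ltn_ord i; lia.
lia.
Qed.

Lemma sum_ge (f : nat -> nat) i : (i < m)%N -> (f i <= \sum_(j < m) f j)%N.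
Proof. by move=> lt_im; rewrite (bigD1 (Ordinal lt_im)) //= leq_addr. Qed.

Lemma up_fun_spec ta : ta \in down_set ->
  (\sum_(i < m) up_fun ta i = shape_size mu + a)%N.
Proof.
case/down_setP=> hta le_s.
have := @sum_shift (up_fun ta) (row_len ta) (a + shape_size ta - shape_size ka).
rewrite -(shape_sizeE ta) => /(_ _ _ erefl) sumE.
have := sumE _ _; rewrite -addnA => {}sumE; suff : (\sum_(i < m) up_fun ta i + shape_size ta =
    shape_size mu + (shape_size ka + (a + shape_size ta - shape_size ka)))%N by lia.
apply: sumE => [i lt_im|]; first by rewrite /up_fun; have := hta i; lia.
by have := hta m.-1; rewrite last0; lia.
Qed.

Lemma up_fun_le ta i : ta \in down_set -> (i < m)%N -> (up_fun ta i <= m)%N.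
Proof.
move=> hta /(sum_ge (up_fun ta)) le_i; apply: leq_trans le_i _.
by rewrite up_fun_spec.
Qed.

Lemma row_len_up ta i : ta \in down_set -> (i < m)%N ->
  row_len (shape_of (up_fun ta)) i = up_fun ta i.
Proof. by move=> hta lt_im; rewrite row_len_shape_of ?up_fun_le. Qed.

Lemma down_fun_le nu i : nu \in up_set -> (i < m)%N -> (down_fun nu i <= m)%N.
Proof.
case/up_setP=> _ hnu _ lt_im; rewrite /down_fun; case: ifP => // _.
have := hnu i; have := row_len_le mu i; lia.
Qed.

Lemma row_len_down nu i : nu \in up_set -> (i < m)%N ->
  row_len (shape_of (down_fun nu)) i = down_fun nu i.
Proof. by move=> hnu lt_im; rewrite row_len_shape_of ?down_fun_le. Qed.

Lemma up_in ta : ta \in down_set -> shape_of (up_fun ta) \in up_set.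
Proof.
move=> hta; have [h le_s] := down_setP hta.
have row0 i : (m <= i)%N -> row_len (shape_of (up_fun ta)) i = 0%N.
  exact: row_len_out.
have strip la : (la = mu) + (la = ka) -> hstrip la (shape_of (up_fun ta)).
  move=> lamk; apply/hstripP=> i; apply/andP; split.
    case: (ltnP i.+1 m) => [lt_im|le_mi]; last by rewrite row0.
    by rewrite row_len_up //= ; have := h i; case: lamk => ->; lia.
  case: (ltnP i m) => [lt_im|le_mi]; last by rewrite row_len_out.
  rewrite row_len_up //; case: i lt_im => [|i] lt_im /=; first by case: lamk => ->; lia.
  by have := h i; case: lamk => ->; lia.
rewrite inE strip ?strip; [|by right|by left]; apply/eqP.
rewrite shape_sizeE -(up_fun_spec hta); apply: eq_bigr => i _.
by rewrite row_len_up.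
Qed.

Lemma down_in nu : nu \in up_set -> shape_of (down_fun nu) \in down_set.
Proof.
move=> hnu; have [h0 h le_s] := up_setP hnu.
have strip la : (la = mu) + (la = ka) -> hstrip (shape_of (down_fun nu)) la.
  move=> lamk; apply/hstripP=> i.
  case: (ltnP i m) => [lt_im|le_mi]; last by rewrite !row_len_out // ltnW.
  rewrite row_len_down // /down_fun; case: ltnP => [lt_im'|le_mi].
    by have := h i; case: lamk => ->; lia.
  by rewrite (row_len_out la).
rewrite inE strip ?strip; [|by right|by left].
have := @sum_shift (row_len nu) (down_fun nu) (row_len nu 0 - mx 0).
rewrite -(shape_sizeE nu) le_s => sumE.
suff : (shape_size mu + a + \sum_(i < m) down_fun nu i =
        shape_size mu + shape_size ka + (row_len nu 0 - mx 0))%N.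
  have -> : shape_size (shape_of (down_fun nu)) = (\sum_(i < m) down_fun nu i)%N.
    by rewrite shape_sizeE; apply: eq_bigr => i _; rewrite row_len_down.
  by lia.
apply: sumE => [i lt_im||]; last by lia.
  by rewrite /down_fun lt_im; have := h i; lia.
by rewrite /down_fun prednK // ltnn.
Qed.

Lemma local_rule_last0 : #|up_set| = #|down_set|.
Proof.
pose f ta := shape_of (up_fun ta).
have f_inj : {in down_set &, injective f}.
  move=> t1 t2 ht1 ht2 eq_f; apply: row_len_inj => i lt_im.
  have [h1 _] := down_setP ht1; have [h2 _] := down_setP ht2.
  have [lt_im'|le_mi] := ltnP i.+1 m.
    have := congr1 (row_len^~ i.+1) eq_f; rewrite /= !row_len_up //=.
    by have := h1 i; have := h2 i; lia.
  have -> : i = m.-1 by lia.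
  by have := h1 m.-1; have := h2 m.-1; rewrite last0; lia.
rewrite -(card_in_imset f_inj); apply: eq_card => nu; apply/idP/imsetP => [hnu|[ta hta ->]].
  exists (shape_of (down_fun nu)); first exact: down_in.
  have hta := down_in hnu; have [h0 h s_nu] := up_setP hnu.
  have rows i : (i.+1 < m)%N -> row_len nu i.+1 = row_len (f (shape_of (down_fun nu))) i.+1.
    move=> lt_im; rewrite row_len_up //= row_len_down ?(ltnW lt_im) // /down_fun lt_im.
    by have := h i; lia.
  apply: row_len_inj => -[|i] lt_im; last exact: rows.
  have := up_in hta; rewrite inE => /and3P[_ _ /eqP]; rewrite -s_nu.
  rewrite !shape_sizeE (sum_ord_recl (row_len nu)) // (sum_ord_recl (row_len _)) //.
  have -> : (\sum_(i < m.-1) row_len nu i.+1 =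
             \sum_(i < m.-1) row_len (f (shape_of (down_fun nu))) i.+1)%N.
    by apply: eq_bigr => i _; apply: rows; have := ltn_ord i; lia.
  by rewrite /f; lia.
exact: up_in.
Qed.

End LocalRule.

Lemma hstrip_last mu i : hstrip mu mu -> (i < m)%N -> (0 < row_len mu i)%N ->
  (i < shape_size mu)%N.
Proof.
move/hstripP=> hs lt_im pos_i.
have pos j : (j <= i)%N -> (0 < row_len mu j)%N.
  move=> le_ji; rewrite -(subKn le_ji); elim: (i - j)%N => [|d IHd]; first by rewrite subn0.
  have [->|lt_d] : (i - d.+1 = i - d)%N \/ (i - d = (i - d.+1).+1)%N by lia.
    by [].
  by have := hs (i - d.+1)%N; rewrite -lt_d; lia.
rewrite shape_sizeE.
rewrite -(big_mkord xpredT (row_len mu)) (big_cat_nat (n := i.+1)) //=.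
apply: leq_trans (leq_addr _ _).
rewrite -{1}[i.+1]subn0 -[(i.+1 - 0)%N]muln1 -sum_nat_const_nat big_nat [leqRHS]big_nat.
by apply: leq_sum => j /andP[_]; rewrite ltnS; apply: pos.
Qed.

Lemma hstrip_diag ta mu : hstrip ta mu -> hstrip ta ta /\ hstrip mu mu.
Proof.
move/hstripP=> hs; split; apply/hstripP=> i; have := hs i; have := hs i.+1; lia.
Qed.

(* ta and nu are determined by independent choices of rows in the same        *)
(* intervals: ta_i and nu_(i+1) both lie between max(mu_(i+1), ka_(i+1)) and  *)
(* min(mu_i, ka_i), and nu_0 absorbs the difference in size.                  *)
Lemma local_rule mu ka a : (shape_size mu + a <= m)%N ->
  #|[set nu : Y | [&& hstrip mu nu, hstrip ka nu & shape_size nu == shape_size mu + a]%N]| =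
  #|[set ta : Y | [&& hstrip ta mu, hstrip ta ka & shape_size ka <= shape_size ta + a]%N]|.
Proof.
move=> le_am; have [mu_mu|not_mu] := boolP (hstrip mu mu); last first.
  rewrite !(eq_card0 (A := mem [set _ | _])) // => la; rewrite inE; apply/negP=> /and3P[hs _ _];
    by case/negP: not_mu; have [] := hstrip_diag hs.
case: (posnP a) => [a0|a_gt0].
  have -> : [set nu : Y | [&& hstrip mu nu, hstrip ka nu & shape_size nu == shape_size mu + a]%N]
            = if hstrip ka mu then [set mu] else set0.
    apply/setP=> nu; rewrite inE a0 addn0; apply/and3P/idP.
      case=> hs1 hs2 /eqP eq_s.
      have eq_mn : mu = nu by apply: hstrip_size_eq; rewrite ?eq_s.
      by rewrite -eq_mn in hs2 *; rewrite hs2 set11.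
    by case: ifP => [hs|]; rewrite inE // => /eqP->; split.
  have -> : [set ta : Y | [&& hstrip ta mu, hstrip ta ka & shape_size ka <= shape_size ta + a]%N]
            = if hstrip ka mu then [set ka] else set0.
    apply/setP=> ta; rewrite inE a0 addn0; apply/and3P/idP.
      case=> hs1 hs2 le_s; have eq_tk := hstrip_size_eq hs2 le_s.
      by rewrite eq_tk in hs1 *; rewrite hs1 set11.
    case: ifP => [hs|]; rewrite inE // => /eqP->; split=> //.
    by have [] := hstrip_diag hs.
  by case: ifP; rewrite ?cards1 ?cards0.
(* With [a] positive, [mu] has fewer than [m] cells and hence an empty last row, as
   [local_rule_last0] requires; for [a = 0] both sets had at most one element. *)
have m_gt0 : (0 < m)%N by lia.
apply: local_rule_last0 => //; apply/eqP; rewrite -leqn0 leqNgt; apply/negP.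
move/(hstrip_last mu_mu) => /(_ _); lia.
Qed.

(** * Schur polynomials by branching *)

Section Schur.

Context (R : comNzRingType).
Implicit Types (x y : nat -> R).

(** The Schur polynomial in [x 0], ..., [x (N-1)], by the branching rule: the strip mu / ta carries
    the last variable. *)
Fixpoint strip_schur x (N : nat) mu : R :=
  if N is N'.+1 then
    \sum_(ta : Y | hstrip ta mu) x N' ^+ (shape_size mu - shape_size ta) * strip_schur x N' ta
  else (shape_size mu == 0%N)%:R.

Lemma shape_size0 mu : shape_size mu = 0%N -> forall i, row_len mu i = 0%N.
Proof.
move=> mu0 i; case: (ltnP i m) => [lt_im|/row_len_out//].
by apply/eqP; rewrite -leqn0 -mu0 shape_sizeE (@sum_ge (row_len mu)).
Qed.

Lemma strip_schur0 x N mu : shape_size mu = 0%N -> strip_schur x N mu = 1.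
Proof.
move=> mu0; have row0 := shape_size0 mu0.
elim: N => [|N IHN] /=; first by rewrite mu0.
rewrite (big_pred1 mu) ?subnn ?mul1r // => ta; apply/idP/eqP=> [/hstripP hs|->].
  by apply: row_len_inj => i _; have := hs i; rewrite !row0; lia.
by apply/hstripP=> i; rewrite !row0.
Qed.

(** Induction on the number of variables: split off the last variable from each s_nu, exchange nu
    for ta by [local_rule], and recognize the branching of both h_a and s_mu. The bound on the size
    keeps all nu inside the m by m box. *)
Lemma pieri x N mu a : (shape_size mu + a <= m)%N ->
  \sum_(nu : Y | hstrip mu nu && (shape_size nu == shape_size mu + a)%N) strip_schur x N nu =
  hsum N a x * strip_schur x N mu.
Proof.
rewrite /hsum; elim: N mu a => [|N IHN] mu a le_am /=.
  have [->|a_neq0] := eqVneq a 0%N.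
    rewrite mul1r addn0; case: (posnP (shape_size mu)) => [mu0|mu_gt0].
      rewrite (big_pred1 mu) ?mu0 // => nu; apply/andP/eqP=> [[_ /eqP nu0]|->].
        by apply: row_len_inj => i _; rewrite !shape_size0.
      by rewrite mu0; split=> //; apply/hstripP=> i; rewrite !shape_size0.
    rewrite big1 => [//|nu /andP[_ /eqP->]].
    by rewrite gtn_eqF.
  rewrite mul0r big1 // => nu /andP[_ /eqP->]; rewrite addn_eq0.
  by rewrite (negbTE a_neq0) andbF.
pose s ka := strip_schur x N ka.
rewrite (exchange_big_dep xpredT) //=.
transitivity (\sum_(ka : Y) x N ^+ (shape_size mu + a - shape_size ka) * s ka *+
    #|[set nu : Y | [&& hstrip mu nu, hstrip ka nu & shape_size nu == shape_size mu + a]%N]|).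
  apply: eq_bigr => ka _; rewrite -sumr_const; apply: eq_big => [nu|nu].
    by rewrite inE /=; case: (hstrip mu nu) => //=; rewrite andbC.
  by case/andP=> /andP[_ /eqP->].
rewrite (eq_bigr (fun ka => \sum_(ta in [set ta : Y | [&& hstrip ta mu, hstrip ta ka
    & shape_size ka <= shape_size ta + a]%N])
    x N ^+ (shape_size mu + a - shape_size ka) * s ka)); last first.
  by move=> ka _; rewrite sumr_const (local_rule ka le_am).
rewrite (exchange_big_dep (fun ta => hstrip ta mu)) /=; last first.
  by move=> ka ta _; rewrite inE => /andP[].
rewrite mulr_sumr; apply: eq_bigr => ta hs.
have le_tm := hstrip_size hs.
rewrite mulr_suml.
(* [b] is the power of the last variable that comes from h_a; the other power comes from the
   branching of s_mu. *)
transitivity (\sum_(b < a.+1) \sum_(ka : Y | hstrip ta ka &&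
    (shape_size ka == shape_size ta + (a - b))%N)
    x N ^+ b * (x N ^+ (shape_size mu - shape_size ta)) * s ka); last first.
  apply: eq_bigr => b _; rewrite -mulr_sumr IHN; last by lia.
  by rewrite -!mulrA; congr (_ * _); rewrite mulrCA.
rewrite (exchange_big_dep (fun ka : Y => hstrip ta ka && (shape_size ka <= shape_size ta + a)%N)) /=; last first.
  by move=> b ka _ /andP[-> /eqP->]; rewrite leq_add2l leq_subr.
apply: eq_big => [ka|ka]; first by rewrite inE hs.
rewrite inE => /and3P[_ hs' le_k]; have le_tk := hstrip_size hs'.
have lt_b : (a - (shape_size ka - shape_size ta) < a.+1)%N by rewrite ltnS leq_subr.
rewrite (big_pred1 (Ordinal lt_b)) => [|b] /=.
  by rewrite -exprD; congr (_ ^+ _ * _); lia.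
rewrite hs' /= -val_eqE /=; have := ltn_ord b; lia.
Qed.

(** Branching splits off the last variable of [x], and the sum over mu is then a Pieri sum in [y];
    so each variable x_i contributes the series with terms x_i^a h_a(y). *)
Lemma cauchy x y r N k : (k <= m)%N ->
  \sum_(mu : Y | shape_size mu == k) strip_schur x r mu * strip_schur y N mu =
  csum r k (fun i a => x i ^+ a * hsum N a y).
Proof.
elim: r k => [|r IHr] k le_km /=.
  have [->|k_neq0] := eqVneq k 0%N.
    have s0 : shape_size [ffun=> ord0] = 0%N.
      by rewrite /shape_size big1 // => i _; rewrite ffunE.
    rewrite (big_pred1 [ffun=> ord0]) ?s0 ?mul1r ?strip_schur0 // => mu.
    apply/eqP/eqP=> [mu0|->//]; apply: row_len_inj => i _.
    by rewrite !shape_size0.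
  by rewrite big1 // => mu /eqP->; rewrite (negbTE k_neq0) mul0r.
under eq_bigr do rewrite mulr_suml.
rewrite (exchange_big_dep (fun ta : Y => shape_size ta <= k)%N) /=; last first.
  by move=> mu ta /eqP<- /hstrip_size.
transitivity (\sum_(ta : Y | (shape_size ta <= k)%N)
    x r ^+ (k - shape_size ta) * hsum N (k - shape_size ta) y *
    (strip_schur x r ta * strip_schur y N ta)).
  apply: eq_bigr => ta le_tk.
  have -> : x r ^+ (k - shape_size ta) * hsum N (k - shape_size ta) y *
            (strip_schur x r ta * strip_schur y N ta) =
            x r ^+ (k - shape_size ta) * strip_schur x r ta *
            (hsum N (k - shape_size ta) y * strip_schur y N ta) by ring.
  rewrite -pieri ?subnKC // mulr_sumr; apply: eq_big => [mu|mu /andP[/eqP->//]].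
  by rewrite andbC.
rewrite (partition_big (fun ta : Y => inord (k - shape_size ta) : 'I_k.+1) xpredT) //=.
apply: eq_bigr => b _; rewrite -IHr; last by lia.
rewrite mulr_sumr.
apply: eq_big => [ta|ta /andP[le_tk /eqP def_b]].
  have := ltn_ord b; case: (leqP (shape_size ta) k) => le_tk lt_b /=; last by lia.
  by rewrite -val_eqE /= inordK; lia.
have -> : (k - shape_size ta)%N = b by rewrite -def_b inordK //; lia.
by [].
Qed.

End Schur.

End Shapes.

(** * Semistandard tableaux *)

Section Tableaux.

Context (m : nat).
Local Notation Y := {ffun 'I_m -> 'I_m.+1}.
Local Notation box := ('I_m * 'I_m)%type.
Implicit Types (mu ka ta : Y) (c e : box).

Definition shape_cells mu : {set box} := [set c : box | (c.2 < mu c.1)%N].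

Lemma mem_shape_cells mu c : (c \in shape_cells mu) = (c.2 < row_len mu c.1)%N.
Proof. by rewrite inE row_lenE. Qed.

Lemma card_shape_rows mu (P : pred 'I_m) :
  #|[set c in shape_cells mu | P c.1]| = (\sum_(i < m | P i) mu i)%N.
Proof.
rewrite -sum1_card (eq_bigl (fun c : box => P c.1 && (c.2 < mu c.1)%N)); last first.
  by move=> c; rewrite !inE andbC.
rewrite -(pair_big_dep P (fun i (j : 'I_m) => j < mu i)%N (fun _ _ => 1%N)) /=.
apply: eq_bigr => i _; rewrite sum1dep_card card_ord_lt (minn_idPl _) //.
by rewrite -ltnS.
Qed.

Lemma card_shape_cells mu : #|shape_cells mu| = shape_size mu.
Proof.
rewrite /shape_size -(card_shape_rows mu xpredT).
by apply: eq_card => c; rewrite !inE andbT.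
Qed.

Lemma decr_row_len mu i j : hstrip mu mu -> (i <= j)%N ->
  (row_len mu j <= row_len mu i)%N.
Proof.
move/hstripP=> hs /subnKC <-; elim: (j - i)%N => [|d IHd]; first by rewrite addn0.
by apply: leq_trans IHd; rewrite addnS; have /andP[] := hs (i + d)%N.
Qed.

Section Filling.

Context (R : comNzRingType) (x : nat -> R) (B : nat) (p0 : 'I_B).
Implicit Types T : {ffun box -> 'I_B}.

(** Fillings live on all boxes, with the constant [p0] outside the shape, so that tableaux of
    different shapes share one type. *)
Definition filling N mu T : bool :=
  [forall c, if c \in shape_cells mu then (T c < N)%N else T c == p0] &&
  [forall c in shape_cells mu, forall e in shape_cells mu,
     ((c.1 == e.1) && (c.2 <= e.2)%N ==> (T c <= T e)%N) &&
     ((c.2 == e.2) && (c.1 < e.1)%N ==> (T c < T e)%N)].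

Lemma fillingP N mu T :
  reflect [/\ {in shape_cells mu, forall c, (T c < N)%N},
              (forall c, c \notin shape_cells mu -> T c = p0),
              {in shape_cells mu &, forall c e,
                 c.1 = e.1 -> (c.2 <= e.2)%N -> (T c <= T e)%N} &
              {in shape_cells mu &, forall c e,
                 c.2 = e.2 -> (c.1 < e.1)%N -> (T c < T e)%N}]
          (filling N mu T).
Proof.
apply: (iffP andP) => [[/forallP bd /forall_inP ss]|[bd out row col]]; split.
- by move=> c cmu; have := bd c; rewrite cmu.
- by move=> c /negbTE cmu; have := bd c; rewrite cmu => /eqP.
- move=> c e cmu emu eq1 le2; have /forall_inP/(_ e emu)/andP[/implyP H _] := ss c cmu.
  by apply: H; rewrite eq1 eqxx.
- move=> c e cmu emu eq1 le2; have /forall_inP/(_ e emu)/andP[_ /implyP H] := ss c cmu.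
  by apply: H; rewrite eq1 eqxx.
- by apply/forallP=> c; case: ifP => [/bd//|/negbT/out->].
apply/forall_inP=> c cmu; apply/forall_inP=> e emu; apply/andP; split.
  by apply/implyP=> /andP[/eqP eq1 le2]; apply: row.
by apply/implyP=> /andP[/eqP eq1 le2]; apply: col.
Qed.

Definition fill_sum N mu : R :=
  \sum_(T : {ffun box -> 'I_B} | filling N mu T) \prod_(c in shape_cells mu) x (T c).

(** The cells with entry less than [N]; in a filling with entries at most [N] the remaining cells
    form a horizontal strip. *)
Definition sub_shape N mu T : Y :=
  [ffun i => inord #|[set j : 'I_m | (j < mu i)%N && (T (i, j) < N)%N]|].

Lemma mem_sub_shape N mu T c : filling N.+1 mu T ->
  (c \in shape_cells (sub_shape N mu T)) = (c \in shape_cells mu) && (T c < N)%N.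
Proof.
case/fillingP=> bd out row col; case: c => i j; rewrite !inE /= ffunE inordK.
  rewrite -mem_initial_ord ?inE // => j1 j2; rewrite !inE => /andP[lt_j2 Tj2] le_j.
  have lt_j1 : (j1 < mu i)%N by apply: leq_ltn_trans lt_j2.
  rewrite lt_j1 /=; apply: leq_ltn_trans Tj2.
  by apply: (row (i, j1) (i, j2)); rewrite ?inE.
by rewrite ltnS -[leqRHS]card_ord max_card.
Qed.

Lemma sub_shape_hstrip N mu T : hstrip mu mu -> filling N.+1 mu T ->
  hstrip (sub_shape N mu T) mu.
Proof.
move=> dec fT; have memS := mem_sub_shape _ fT; have [bd out row col] := fillingP _ _ _ fT.
apply/hstripP=> i; case: (ltnP i m) => [lt_im|le_mi]; last first.
  by rewrite !row_len_out // ltnW.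
pose oi := Ordinal lt_im; apply/andP; split; rewrite leqNgt; apply/negP=> lt_r.
  have lt_im' : (i.+1 < m)%N.
    by rewrite ltnNge; apply/negP=> /(row_len_out mu) r0; rewrite r0 in lt_r.
  have lt_jm : (row_len (sub_shape N mu T) i < m)%N by apply: leq_trans (row_len_le mu i.+1).
  pose j := Ordinal lt_jm; pose c := (oi, j); pose e := (Ordinal lt_im', j).
  have eM : e \in shape_cells mu by rewrite mem_shape_cells.
  have cM : c \in shape_cells mu.
    by rewrite mem_shape_cells; apply: leq_trans lt_r _; apply: decr_row_len.
  have Tc : (T c < N)%N.
    by rewrite -ltnS; apply: leq_trans (bd e eM); rewrite ltnS; apply: col.
  have : c \in shape_cells (sub_shape N mu T) by rewrite memS cM.
  by rewrite mem_shape_cells ltnn.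
have lt_jm : (row_len mu i < m)%N by apply: leq_trans lt_r (row_len_le _ i).
have : (oi, Ordinal lt_jm) \in shape_cells (sub_shape N mu T) by rewrite mem_shape_cells.
by rewrite memS mem_shape_cells ltnn.
Qed.

Lemma shape_cells_inj : injective shape_cells.
Proof.
move=> mu nu eq_mn; apply/ffunP=> i; apply: val_inj => /=.
have row la : #|[set c in shape_cells la | c.1 == i]| = la i.
  by rewrite (card_shape_rows la (pred1 i)) big_pred1_eq.
by rewrite -row eq_mn row.
Qed.

Section Extend.

Context (N : nat) (lt_NB : (N < B)%N) (mu ta : Y) (hs : hstrip ta mu).

Definition fill_ext T : {ffun box -> 'I_B} :=
  [ffun c => if c \in shape_cells ta then T c
             else if c \in shape_cells mu then Ordinal lt_NB else p0].

Definition fill_res T : {ffun box -> 'I_B} :=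
  [ffun c => if c \in shape_cells ta then T c else p0].

Lemma sub_shape_cells c : c \in shape_cells ta -> c \in shape_cells mu.
Proof.
rewrite !mem_shape_cells => /leq_trans; apply.
by have /hstripP/(_ c.1)/andP[] := hs.
Qed.

Lemma fill_ext_filling T : filling N ta T -> filling N.+1 mu (fill_ext T).
Proof.
case/fillingP=> bd out row col; have [decT decM] := hstrip_diag hs.
apply/fillingP; split.
- move=> c cM; rewrite ffunE cM; case: ifP => //= cT.
  by rewrite ltnS ltnW ?bd.
- move=> c cM; rewrite ffunE (negbTE cM) ifN //; apply: contra cM.
  exact: sub_shape_cells.
- move=> c e cM eM eq1 le2; rewrite !ffunE cM eM.
  case: (boolP (e \in _)) => [eT|eT].
    have cT : c \in shape_cells ta.
      by move: eT; rewrite !mem_shape_cells eq1; apply: leq_ltn_trans.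
    by rewrite cT; apply: row.
  by case: ifP => //= cT; rewrite ltnW ?bd.
- move=> c e cM eM eq2 lt1; rewrite !ffunE cM eM.
  have cT : c \in shape_cells ta.
    move: eM; rewrite !mem_shape_cells eq2 => /leq_trans; apply.
    apply: leq_trans (decr_row_len decM lt1) _.
    by have /hstripP/(_ c.1)/andP[] := hs.
  by rewrite cT; case: ifP => [eT|eT] /=; [apply: col | apply: bd].
Qed.

Lemma fill_res_filling T : filling N.+1 mu T -> sub_shape N mu T = ta ->
  filling N ta (fill_res T).
Proof.
move=> fT defT; have memT c := mem_sub_shape c fT; rewrite defT in memT.
have [bd out row col] := fillingP _ _ _ fT.
apply/fillingP; split.
- by move=> c cT; rewrite ffunE cT; move: cT; rewrite memT => /andP[].
- by move=> c /negbTE cT; rewrite ffunE cT.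
- move=> c e cT eT eq1 le2; rewrite !ffunE cT eT.
  by apply: row => //; apply: sub_shape_cells.
- move=> c e cT eT eq1 le2; rewrite !ffunE cT eT.
  by apply: col => //; apply: sub_shape_cells.
Qed.

Lemma sub_shape_ext T : filling N ta T -> sub_shape N mu (fill_ext T) = ta.
Proof.
move=> fT; apply: shape_cells_inj; apply/setP=> c.
rewrite (mem_sub_shape _ (fill_ext_filling fT)) ffunE.
have [bd _ _ _] := fillingP _ _ _ fT.
case: (boolP (c \in shape_cells ta)) => [cT|cT]; first by rewrite sub_shape_cells ?bd.
by case: (c \in shape_cells mu); rewrite //= ltnn.
Qed.

Lemma fill_sum_fixed_sub :
  \sum_(T : {ffun box -> 'I_B} | filling N.+1 mu T && (sub_shape N mu T == ta))
     \prod_(c in shape_cells mu) x (T c) =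
  x N ^+ (shape_size mu - shape_size ta) * fill_sum N ta.
Proof.
rewrite (reindex_onto fill_ext fill_res) => [|T /andP[fT /eqP defT]]; last first.
  have memT c := mem_sub_shape c fT; rewrite defT in memT.
  have [bd out row col] := fillingP _ _ _ fT.
  apply/ffunP=> c; rewrite !ffunE; case: (boolP (c \in shape_cells ta)) => [//|/negbTE cT].
  case: ifP => cM; last first.
    by rewrite out ?cM.
  apply: val_inj => /=; apply/eqP; rewrite eqn_leq -[(T c <= N)%N]ltnS bd // andbT.
  by rewrite leqNgt; apply/negP=> lt_T; rewrite memT cM lt_T in cT.
rewrite /fill_sum mulr_sumr; apply: eq_big => [T|T].
  apply/idP/idP=> [/andP[/andP[fT /eqP defT] /eqP defR]|fT].
    by rewrite -defR fill_res_filling.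
  rewrite fill_ext_filling // sub_shape_ext // eqxx /=; apply/eqP/ffunP=> c.
  have [_ out _ _] := fillingP _ _ _ fT.
  rewrite !ffunE; case: (boolP (c \in shape_cells ta)) => [//|cT].
  by rewrite (out c cT).
move=> _; rewrite (big_setID (shape_cells ta)) /= mulrC.
have sTM : shape_cells ta \subset shape_cells mu by apply/subsetP=> c; apply: sub_shape_cells.
congr (_ * _); last first.
  rewrite (setIidPr sTM); apply: eq_bigr => c cT; by rewrite ffunE cT.
rewrite (eq_bigr (fun=> x N)) => [|c]; last first.
  by rewrite inE => /andP[/negbTE cT cM]; rewrite ffunE cT cM.
by rewrite prodr_const cardsD (setIidPr sTM) !card_shape_cells.
Qed.

End Extend.

(** Removal of the cells with the largest admissible entry is the branching rule. *)
Lemma fill_sum_strip N mu : (N <= B)%N -> hstrip mu mu ->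
  fill_sum N mu = strip_schur x N mu.
Proof.
elim: N mu => [|N IHN] mu le_NB decM /=.
  rewrite /fill_sum; case: eqP => [mu0|neq0].
    have cells0 : shape_cells mu = set0.
      by apply/eqP; rewrite -cards_eq0 card_shape_cells mu0.
    rewrite (big_pred1 [ffun=> p0]) => [|T].
      by rewrite big_pred0 // => c; rewrite cells0 inE.
    apply/fillingP/eqP=> [[_ out _ _]|->].
      by apply/ffunP=> c; rewrite ffunE out // cells0 inE.
    by split=> [c|c _|c e|c e]; rewrite ?cells0 ?inE ?ffunE.
  have /card_gt0P[c cM] : (0 < #|shape_cells mu|)%N.
    by rewrite card_shape_cells lt0n; apply/eqP.
  by rewrite big_pred0 // => T; apply/negP=> /fillingP[/(_ c cM)].
rewrite /fill_sum (partition_big (sub_shape N mu) (fun ta => hstrip ta mu)); last first.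
  by move=> T; apply: sub_shape_hstrip.
apply: eq_bigr => ta hs; rewrite fill_sum_fixed_sub // IHN ?(ltnW le_NB) //.
by have [] := hstrip_diag hs.
Qed.

End Filling.

Lemma is_part_hstrip mu :
  is_part mu = hstrip mu mu && (shape_size mu == m).
Proof.
rewrite /is_part -/(shape_size mu); congr (_ && _); apply/idP/idP => [/forallP dec|hs].
  apply/hstripP=> i; rewrite leqnn andbT.
  case: (ltnP i.+1 m) => [lt_im|le_mi]; last by rewrite row_len_out.
  have := row_lenE mu (Ordinal lt_im); have := row_lenE mu (Ordinal (ltnW lt_im)).
  by move=> /= -> ->; have /forallP/(_ (Ordinal lt_im))/implyP-> /= := dec (Ordinal (ltnW lt_im)).
apply/forallP=> i; apply/forallP=> j; apply/implyP=> le_ij.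
by rewrite -!row_lenE decr_row_len.
Qed.

Lemma part_decr (mu : part m) : hstrip mu mu.
Proof. by have := partP mu; rewrite is_part_hstrip => /andP[]. Qed.

Lemma part_size (mu : part m) : shape_size mu = m.
Proof. by have /andP[_ /eqP] := partP mu. Qed.

Lemma sum_ssyt (R : comNzRingType) (x : nat -> R) N (mu : part m) :
  \sum_(T : {ffun cell mu -> 'I_N} | semistandard T) \prod_(c : cell mu) x (T c) =
  strip_schur x N mu.
Proof.
rewrite -(@fill_sum_strip R x N.+1 ord_max N mu) ?part_decr ?leqnSn //.
pose h (T : {ffun cell mu -> 'I_N}) : {ffun box -> 'I_N.+1} :=
  [ffun c => if insub c is Some c' then widen_ord (leqnSn N) (T c') else ord_max].
have hE T (c : cell mu) : h T (val c) = T c :> nat by rewrite ffunE valK.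
have h_inj : injective h.
  move=> T T' eq_h; apply/ffunP=> c; apply: val_inj => /=.
  by rewrite -!hE eq_h.
have hP T : filling ord_max N mu (h T) = semistandard T.
  apply/fillingP/forallP => [[bd out row col] c|ss].
    apply/forallP=> e; apply/andP; split; apply/implyP=> /andP[/eqP eq1 le2].
      by rewrite -!hE; apply: row => //; apply: (valP _).
    by rewrite -!hE; apply: col => //; apply: (valP _).
  split.
  - by move=> c cM; rewrite -[c]/(val (Sub c cM : cell mu)) hE.
  - by move=> c cM; rewrite ffunE insubN.
  - move=> c e cM eM eq1 le2.
    rewrite -[c]/(val (Sub c cM : cell mu)) -[e]/(val (Sub e eM : cell mu)) !hE.
    have /forallP/(_ (Sub e eM))/andP[/implyP H _] := ss (Sub c cM).
    by apply: H; rewrite !SubK eq1 eqxx.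
  - move=> c e cM eM eq1 le2.
    rewrite -[c]/(val (Sub c cM : cell mu)) -[e]/(val (Sub e eM : cell mu)) !hE.
    have /forallP/(_ (Sub e eM))/andP[_ /implyP H] := ss (Sub c cM).
    by apply: H; rewrite !SubK eq1 eqxx.
rewrite /fill_sum -[RHS]big_set /=.
have -> : [set T | filling ord_max N mu T] = h @: [set T | semistandard T].
  apply/setP=> Tb; rewrite inE; apply/idP/imsetP=> [fT|[T]]; last first.
    by rewrite inE => ssT ->; rewrite hP.
  have [bd out _ _] := fillingP _ _ _ _ fT.
  have ltN (c : cell mu) : (Tb (val c) < N)%N by apply: bd; apply: (valP c).
  pose T : {ffun cell mu -> 'I_N} := [ffun c => Ordinal (ltN c)].
  have defTb : Tb = h T.
    apply/ffunP=> c; apply: val_inj; case: (boolP (c \in shape_cells mu)) => cM.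
      by rewrite -[c]/(val (Sub c cM : cell mu)) [RHS]hE ffunE.
    by rewrite (out c cM) ffunE insubN.
  by exists T => //; rewrite inE -hP -defTb.
rewrite (big_imset _ (in2W h_inj)) /= big_set; apply: eq_bigr => T _.
transitivity (\prod_(c : cell mu) x (h T (val c))).
  by apply: eq_bigr => c _; rewrite hE.
by rewrite (big_sub (mem (diagram mu)) (fun c => x (h T c))).
Qed.

End Tableaux.

(** * Words *)

Definition word_act (A : finType) m (w : {ffun 'I_m -> A}) (g : 'S_m) :
  {ffun 'I_m -> A} := [ffun x => w (g^-1%g x)].

Arguments word_act {A m} w g.

Lemma count_enum (T : finType) (P : pred T) : count P (enum T) = #|[set x | P x]|.
Proof. by rewrite -sum1_count big_enum_cond /= -sum1dep_card. Qed.

Section Words.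

Context (m : nat) (A : finType).
Implicit Types (w v : {ffun 'I_m -> A}) (g : 'S_m).

Lemma word_act1 : word_act^~ 1%g =1 @id {ffun 'I_m -> A}.
Proof. by move=> w; apply/ffunP=> x; rewrite ffunE invg1 perm1. Qed.

Lemma word_actM w : act_morph (@word_act A m) w.
Proof. by move=> g h; apply/ffunP=> x; rewrite !ffunE invMg permM. Qed.

Canonical word_action := TotalAction word_act1 word_actM.

Definition content w : {ffun A -> 'I_m.+1} := [ffun a => inord #|[set x | w x == a]|].

Lemma contentE w a : content w a = #|[set x | w x == a]| :> nat.
Proof. by rewrite ffunE inordK // ltnS -[leqRHS](card_ord m) max_card. Qed.

Lemma content_act w g : content (word_act w g) = content w.
Proof.
apply/ffunP=> a; apply: val_inj; rewrite /= !contentE.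
rewrite -[RHS](card_imset _ (@perm_inj _ g)); apply: eq_card => x.
by rewrite -[x](permKV g) mem_imset ?inE ?ffunE ?permK //; apply: perm_inj.
Qed.

Lemma sum_content w : (\sum_a content w a = m)%N.
Proof.
transitivity (\sum_(a : A) \sum_(x | w x == a) 1)%N.
  by apply: eq_bigr => a _; rewrite contentE sum1dep_card.
rewrite -[RHS](card_ord m) -sum1_card [RHS](partition_big w xpredT) //=.
Qed.

Lemma content_orbit v w : content v = content w -> exists g, word_act v g = w.
Proof.
move=> eq_c; pose tv := [tuple v i | i < m]; pose tw := [tuple w i | i < m].
have cnt (u : {ffun 'I_m -> A}) a : count_mem a [tuple u i | i < m] = content u a.
  by rewrite contentE /= count_map count_enum.
have : perm_eq tw tv by apply/allP=> a _ /=; rewrite !cnt eq_c.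
case/tuple_permP=> p def_w; exists p^-1%g; apply/ffunP=> i; rewrite ffunE invgK.
have /(congr1 (fun s => nth (w i) s i)) := def_w.
by rewrite -!tnth_nth !tnth_mktuple.
Qed.

Lemma content_inj (D : {set A}) v w : #|D| = m ->
    injective v -> (forall x, v x \in D) -> injective w -> (forall x, w x \in D) ->
  content v = content w.
Proof.
move=> cD v_inj vD w_inj wD.
have cont (u : {ffun 'I_m -> A}) : injective u -> (forall x, u x \in D) ->
    forall a, #|[set x | u x == a]| = (a \in D).
  move=> u_inj uD a; have u_onto : u @: setT = D.
    apply/eqP; rewrite eqEcard card_imset // cardsT card_ord cD leqnn andbT.
    by apply/subsetP=> _ /imsetP[x _ ->].
  case: (boolP (a \in D)) => [|aD].
    rewrite -u_onto => /imsetP[x _ ->]; apply/eqP/cards1P; exists x.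
    by apply/setP=> y; rewrite !inE (inj_eq u_inj).
  apply/eqP; rewrite cards_eq0; apply/eqP/setP=> x; rewrite !inE.
  by apply: contraNF aD => /eqP <-.
by apply/ffunP=> a; apply: val_inj; rewrite /= !contentE !cont.
Qed.

Lemma content_surj (b : {ffun A -> 'I_m.+1}) :
  (\sum_a b a = m)%N -> exists w, content w = b.
Proof.
move=> sum_b; pose s := flatten [seq nseq (b a) a | a <- enum A].
have size_s : size s = m.
  rewrite size_flatten /shape -map_comp sumnE big_map -[RHS]sum_b big_enum /=.
  by apply: eq_bigr => a _; rewrite size_nseq.
have cnt a : count_mem a s = b a.
  rewrite count_flatten -map_comp sumnE big_map big_enum /= (bigD1 a) //=.
  rewrite count_nseq /= eqxx mul1n big1 ?addn0 // => a' neq_a'.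
  by rewrite count_nseq /= (negbTE neq_a').
pose w : {ffun 'I_m -> A} := [ffun i => tnth (tcast size_s (in_tuple s)) i].
exists w; apply/ffunP=> a; apply: val_inj; rewrite /= contentE -cnt.
rewrite -[s]/(tval (in_tuple s)) -(val_tcast size_s).
rewrite -(map_tnth_enum (tcast size_s _)) count_map count_enum.
by apply: eq_card => i; rewrite !inE ffunE.
Qed.

(** Words of a given content form one orbit, so orbit counting gives the order of the group. *)
Lemma card_fixed_content (b : {ffun A -> 'I_m.+1}) : (\sum_a b a = m)%N ->
  (\sum_(g : 'S_m) #|[set w | (content w == b) && (word_act w g == w)]| = m`!)%N.
Proof.
move=> /content_surj[w0 def_b]; pose S := [set w | content w == b].
have actsS : [acts [set: 'S_m], on S | word_action].
  by apply/subsetP=> g _; rewrite !inE; apply/subsetP=> w; rewrite !inE /= content_act.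
have := Frobenius_Cauchy actsS; rewrite cardsT card_Sn.
have -> : orbit word_action [set: 'S_m] @: S = [set S].
  apply/setP=> O; rewrite inE; apply/imsetP/eqP=> [[w]|->].
    rewrite inE => /eqP cw ->; apply/setP=> v; rewrite inE.
    apply/orbitP/eqP=> [[g _ <-]|cv]; first by rewrite content_act.
    by have [|g <-] := @content_orbit w v; [rewrite cw cv | exists g; rewrite ?inE].
  exists w0; rewrite ?inE ?def_b //; apply/setP=> v; rewrite inE.
  apply/eqP/orbitP=> [cv|[g _ <-]]; last by rewrite content_act.
  by have [|g <-] := @content_orbit w0 v; [rewrite cv def_b | exists g; rewrite ?inE].
rewrite cards1 mul1n => <-; apply: eq_big => [g|g _]; first by rewrite inE.
by apply: eq_card => w; rewrite inE [RHS]inE (sameP afix1P eqP) [w \in S]inE.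
Qed.

Lemma sum_fixed_content (R : comNzRingType) (Phi : {ffun A -> 'I_m.+1} -> R) :
  \sum_(g : 'S_m) \sum_(w | word_act w g == w) Phi (content w) =
  m`!%:R * \sum_(b : {ffun A -> 'I_m.+1} | (\sum_a b a == m)%N) Phi b.
Proof.
rewrite mulr_sumr.
transitivity (\sum_(g : 'S_m) \sum_(b : {ffun A -> 'I_m.+1} | (\sum_a b a == m)%N)
    \sum_(w | (word_act w g == w) && (content w == b)) Phi b).
  apply: eq_bigr => g _; rewrite (partition_big content (fun b => \sum_a b a == m)%N) /=.
    by apply: eq_bigr => b _; apply: eq_bigr => w /andP[_ /eqP->].
  by move=> w _; rewrite sum_content.
rewrite exchange_big /=; apply: eq_bigr => b /eqP sum_b.
rewrite -(card_fixed_content sum_b) natr_sum mulr_suml; apply: eq_bigr => g _.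
rewrite mulr_natl -sumr_const; apply: eq_bigl => w.
by rewrite inE andbC.
Qed.

End Words.

(** * Sums over fixed words *)

Section WordSums.

Context (m : nat) (R : comNzRingType).

(** A word is fixed by [g] when it is constant on the cycles of [g], so this is the power sum of the
    cycle type of [g]. *)
Definition word_sum (x : nat -> R) N (g : 'S_m) : R :=
  \sum_(w : {ffun 'I_m -> 'I_N} | word_act w g == w) \prod_(i < m) x (w i).

Lemma prod_content (A : finType) (f : A -> R) (w : {ffun 'I_m -> A}) :
  \prod_(i < m) f (w i) = \prod_a f a ^+ content w a.
Proof.
rewrite (partition_big w xpredT) //=; apply: eq_bigr => a _.
rewrite contentE -prodr_const; apply: eq_big => [i|i /eqP->//]; by rewrite inE.
Qed.

(** A pair of fixed words is a fixed word over the product alphabet, and its content is an r by N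
    matrix. Orbit counting replaces the group by these matrices; row [i], with prescribed sum al_i,
    contributes h of degree al_i. *)
Lemma word_sum_content (y : nat -> R) r N
    (Phi : {ffun 'I_r -> 'I_m.+1} -> R) :
  \sum_(g : 'S_m) (\sum_(v : {ffun 'I_m -> 'I_r} | word_act v g == v) Phi (content v)) *
     word_sum y N g =
  m`!%:R * \sum_(al : {ffun 'I_r -> 'I_m.+1} | (\sum_i al i == m)%N)
     Phi al * \prod_(i < r) hsum N (al i) y.
Proof.
pose A := ('I_r * 'I_N)%type.
pose rows (b : {ffun A -> 'I_m.+1}) : {ffun 'I_r -> 'I_m.+1} :=
  [ffun i => inord (\sum_(j < N) b (i, j))].
have sumA (b : {ffun A -> 'I_m.+1}) : (\sum_a b a = \sum_(i < r) \sum_(j < N) b (i, j))%N.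
  by rewrite pair_bigA; apply: eq_bigr => -[i j] _.
pose wfst (u : {ffun 'I_m -> A}) : {ffun 'I_m -> 'I_r} := [ffun x => (u x).1].
pose wsnd (u : {ffun 'I_m -> A}) : {ffun 'I_m -> 'I_N} := [ffun x => (u x).2].
have content_fst u : content (wfst u) = rows (content u).
  apply/ffunP=> i; rewrite !ffunE; congr inord.
  under [RHS]eq_bigr do rewrite contentE -sum1dep_card.
  rewrite -sum1dep_card (partition_big (fun x => (u x).2) xpredT) //=.
  apply: eq_bigr => j _; apply: eq_bigl => x; rewrite !ffunE.
  by case: (u x) => i' j'; rewrite xpair_eqE.
pose Phi' (b : {ffun A -> 'I_m.+1}) := Phi (rows b) * \prod_(a : A) y a.2 ^+ b a.
have pairE g : (\sum_(v : {ffun 'I_m -> 'I_r} | word_act v g == v) Phi (content v)) *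
    word_sum y N g = \sum_(u : {ffun 'I_m -> A} | word_act u g == u) Phi' (content u).
  rewrite /word_sum big_distrlr /= pair_big /=.
  rewrite (reindex (fun u => (wfst u, wsnd u))) /=; last first.
    exists (fun p : {ffun 'I_m -> 'I_r} * {ffun 'I_m -> 'I_N} => [ffun x => (p.1 x, p.2 x)]).
      by move=> u _; apply/ffunP=> x; rewrite !ffunE; case: (u x).
    by case=> v w _; congr (_, _); apply/ffunP=> x; rewrite !ffunE.
  apply: eq_big => [u|u _].
    apply/andP/eqP=> [[/eqP/ffunP e1 /eqP/ffunP e2]|eu].
      apply/ffunP=> x; have := e1 x; have := e2 x; rewrite !ffunE.
      by case: (u _) (u _) => [a1 a2] [b1 b2] /= -> ->.
    by split; apply/eqP/ffunP=> x; rewrite -[in RHS]eu !ffunE.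
  rewrite content_fst /Phi'; congr (_ * _).
  by rewrite -(prod_content (fun a : A => y a.2)); apply: eq_bigr => x _; rewrite ffunE.
rewrite (eq_bigr _ (fun g _ => pairE g)) sum_fixed_content; congr (_ * _).
rewrite (partition_big rows (fun al => \sum_i al i == m)%N) /=; last first.
  move=> b /eqP sum_b; rewrite -[X in _ == X]sum_b sumA; apply/eqP.
  apply: eq_bigr => i _; rewrite ffunE inordK // ltnS -[leqRHS]sum_b sumA (bigD1 i) //=.
  exact: leq_addr.
apply: eq_bigr => al /eqP sum_al.
transitivity (Phi al * \prod_(i < r) \sum_(be : {ffun 'I_N -> 'I_m.+1} |
    (\sum_(j < N) be j == al i)%N) \prod_(j < N) y j ^+ be j); last first.
  by congr (_ * _); apply: eq_bigr => i _; rewrite /hsum (@csumE _ m.+1).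
rewrite bigA_distr_big_dep mulr_sumr /=.
pose curry (ga : {ffun 'I_r -> {ffun 'I_N -> 'I_m.+1}}) : {ffun A -> 'I_m.+1} :=
  [ffun a => ga a.1 a.2].
rewrite (reindex curry) /=; last first.
  exists (fun b => [ffun i => [ffun j => b (i, j)]]).
    by move=> ga _; apply/ffunP=> i; apply/ffunP=> j; rewrite !ffunE.
  by move=> b _; apply/ffunP=> -[i j]; rewrite !ffunE.
have sumC ga : (\sum_a curry ga a = \sum_(i < r) \sum_(j < N) ga i j)%N.
  by rewrite pair_bigA; apply: eq_bigr => a _; rewrite ffunE.
apply: eq_big => [ga|ga /andP[_ /eqP rE]]; last first.
  by rewrite /Phi' rE pair_bigA; congr (_ * _); apply: eq_bigr => a _; rewrite ffunE.
rewrite sumC; apply/andP/familyP=> [[/eqP sum_ga /eqP/ffunP eq_r] i|fam].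
  have := congr1 val (eq_r i); rewrite ffunE /= inordK => [<-|].
    by rewrite -topredE /=; apply/eqP/eq_bigr=> j _; rewrite ffunE.
  rewrite ltnS -[leqRHS]sum_ga (bigD1 i) //= (eq_bigr (fun j => ga i j : nat)) ?leq_addr //.
  by move=> j _; rewrite ffunE.
have row i : (\sum_(j < N) ga i j = al i)%N.
  by have := fam i; rewrite -topredE => /eqP.
split; first by rewrite (eq_bigr _ (fun i _ => row i)) sum_al.
apply/eqP/ffunP=> i; apply: val_inj; rewrite ffunE /= -row inordK.
  by apply: eq_bigr => j _; rewrite ffunE.
rewrite (eq_bigr (fun j => ga i j : nat)) ?row // => j _.
by rewrite ffunE.
Qed.

(** Both sides are m! times the degree m part of the Cauchy kernel. *)
Lemma word_sum_pair (x y : nat -> R) r N :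
  \sum_(g : 'S_m) word_sum x r g * word_sum y N g =
  m`!%:R * \sum_(mu : {ffun 'I_m -> 'I_m.+1} | shape_size mu == m)
     strip_schur x r mu * strip_schur y N mu.
Proof.
rewrite cauchy // (@csumE _ m.+1) //.
have := word_sum_content y N (fun al : {ffun 'I_r -> 'I_m.+1} => \prod_(i < r) x i ^+ al i).
under [X in _ -> _ = _ * X]eq_bigr do rewrite big_split /=.
move=> <-; apply: eq_bigr => g _; congr (_ * _); apply: eq_bigr => w _.
by rewrite (prod_content (fun i : 'I_r => x i)).
Qed.

End WordSums.

(** * Flags as tuples of words *)

Definition fset_ranks (J : {fset nat}) : seq nat := sort leq (enum_fset J).

(** Encodes chains of sets of sizes [s]: the letter at a point is the index of the first set
    containing it, and the extra letter [size s] means that no set does. *)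
Definition cum_words n (s : seq nat) : {set {ffun 'I_n -> 'I_(size s).+1}} :=
  [set v : {ffun 'I_n -> 'I_(size s).+1} |
     [forall i : 'I_(size s), #|[set a | (v a <= i)%N]| == nth 0%N s i]].

Section FlagWords.

Context (t n : nat).
Context (t_gt0 : (0 < t)%N).
Context (J : {fset nat}).
Context (prJ : proper_ranks n J).
Implicit Types (x y z : Bt t n) (c d e : {set Bt t n}).

Local Notation s := (fset_ranks J).
Local Notation k := (size (fset_ranks J)).
Local Notation words := {ffun 'I_t -> {ffun 'I_n -> 'I_k.+1}}.

Lemma size_fset_ranks : k = #|` J|. Proof. by rewrite size_sort. Qed.

Lemma mem_fset_ranks j : (j \in s) = (j \in J). Proof. by rewrite mem_sort. Qed.

Lemma fset_ranks_sorted : sorted ltn s.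
Proof. by rewrite ltn_sorted_uniq_leq sort_uniq fset_uniq sort_sorted. Qed.

Lemma nth_fset_ranks_lt i j : (i < k)%N -> (j < k)%N ->
  (nth 0 s i < nth 0 s j)%N = (i < j)%N.
Proof.
move=> ik jk; have mono := sorted_ltn_nth ltn_trans 0%N fset_ranks_sorted.
case: (ltngtP i j) => [lt|lt|->]; last by rewrite ltnn.
  by rewrite mono ?inE.
by apply/negbTE; rewrite -leqNgt ltnW // mono ?inE.
Qed.

Definition flag_word c : words :=
  [ffun l => [ffun a => inord (block c l a)]].

Definition word_elt (V : words) (i : 'I_k) : Bt t n :=
  insubd (Bt_bot t n) [ffun l => [set a | (V l a <= i)%N]].

Definition word_flag (V : words) : {set Bt t n} := [set word_elt V i | i : 'I_k].

Lemma flag_wordE c l a : c \in flags t n J -> flag_word c l a = block c l a :> nat.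
Proof.
move=> cJ; rewrite !ffunE inordK // ltnS /block size_fset_ranks.
have [_ <- _] := facesP t_gt0 _ _ prJ cJ; apply: subset_leq_card.
by apply/subsetP=> x; rewrite inE => /andP[].
Qed.

Lemma mem_flag_block c x l a : chain c -> x \in c ->
  (a \in x l) = (block c l a <= #|[set y in c | (y < x)%O]|)%N.
Proof.
move=> chc xc; apply/idP/idP=> [ax|].
  apply: subset_leq_card; apply/subsetP=> y; rewrite !inE => /andP[yc ay].
  rewrite yc /=; case: (comparable_ltgtP (chc x y xc yc)) => [|//|] xy.
    by move/ltW/Bt_leP/(_ l)/subsetP/(_ a ax): xy; rewrite (negbTE ay).
  by rewrite -xy ax in ay.
apply: contraLR => ax; rewrite -ltnNge.
apply: (@leq_trans #|[set y in c | (y <= x)%O]|).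
  rewrite [leqRHS](cardsD1 x) inE xc lexx add1n ltnS; apply: subset_leq_card.
  by apply/subsetP=> y; rewrite !inE => /andP[-> lt]; rewrite ltW // lt_eqF.
apply: subset_leq_card; apply/subsetP=> y; rewrite !inE => /andP[-> le_yx] /=.
by apply: contra ax; move/Bt_leP/(_ l)/subsetP: le_yx; apply.
Qed.

Lemma flag_pos c x : c \in flags t n J -> x \in c ->
  #|[set y in c | (y < x)%O]| = index (Bt_rank x) s.
Proof.
move=> cJ xc; have [rc cc chc] := facesP t_gt0 _ _ prJ cJ.
have xs : (index (Bt_rank x) s < k)%N by rewrite index_mem mem_fset_ranks rc.
transitivity (size (take (index (Bt_rank x) s) s)); last by rewrite size_takel // ltnW.
rewrite cardE -(size_map (@Bt_rank t n)); apply: perm_size; apply: uniq_perm.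
- rewrite map_inj_in_uniq ?enum_uniq // => y z.
  rewrite !mem_enum !inE => /andP[yc _] /andP[zc _].
  exact: (chain_rank_inj chc).
- by rewrite take_uniq ?sort_uniq ?fset_uniq.
move=> j; apply/mapP/idP=> [[y]|].
  rewrite mem_enum inE => /andP[yc lt_yx] ->.
  rewrite in_take ?mem_fset_ranks ?rc //.
  rewrite -(nth_fset_ranks_lt _ xs) ?index_mem ?mem_fset_ranks ?rc //.
  by rewrite !nth_index ?mem_fset_ranks ?rc // Bt_lt_rank.
move=> jt; have js : j \in s by apply: mem_take jt.
move: jt; rewrite in_take // -(nth_fset_ranks_lt _ xs) ?index_mem //.
rewrite (nth_index _ js) nth_index ?mem_fset_ranks ?rc // => lt_j.
rewrite mem_fset_ranks in js.
have [y yc ry] := flag_rank_surj t_gt0 prJ cJ js.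
exists y => //; rewrite mem_enum inE yc /= -(comparable_rank_lt t_gt0) ?ry //.
exact: chc.
Qed.

Lemma flag_word_elt c x : c \in flags t n J -> x \in c ->
  forall i : 'I_k, i = index (Bt_rank x) s :> nat -> word_elt (flag_word c) i = x.
Proof.
move=> cJ xc i def_i; have [rc cc chc] := facesP t_gt0 _ _ prJ cJ.
apply/val_inj; have -> : val x = [ffun l => [set a | (flag_word c l a <= i)%N]].
  apply/ffunP=> l; apply/setP=> a; rewrite ffunE inE flag_wordE //.
  by rewrite def_i -(flag_pos cJ xc) -mem_flag_block.
rewrite /word_elt val_insubd; case: ifP => // /negP[].
suff -> : [ffun l => [set a | (flag_word c l a <= i)%N]] = val x by apply: (valP x).
apply/ffunP=> l; apply/setP=> a; rewrite ffunE inE flag_wordE //.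
by rewrite def_i -(flag_pos cJ xc) -mem_flag_block.
Qed.

Lemma flag_wordK c : c \in flags t n J -> word_flag (flag_word c) = c.
Proof.
move=> cJ; have [rc cc chc] := facesP t_gt0 _ _ prJ cJ.
apply/setP=> x; apply/imsetP/idP=> [[i _ ->]|xc].
  have iJ : nth 0%N s i \in J by rewrite -mem_fset_ranks mem_nth.
  have [y yc ry] := flag_rank_surj t_gt0 prJ cJ iJ.
  rewrite (flag_word_elt cJ yc) // ry index_uniq //.
  by rewrite sort_uniq fset_uniq.
have xs : (index (Bt_rank x) s < k)%N by rewrite index_mem mem_fset_ranks rc.
by exists (Ordinal xs) => //; rewrite (flag_word_elt cJ xc).
Qed.

Lemma flag_word_cum c l : c \in flags t n J -> flag_word c l \in cum_words n s.
Proof.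
move=> cJ; rewrite inE; apply/forallP=> i; apply/eqP.
have iJ : nth 0%N s i \in J by rewrite -mem_fset_ranks mem_nth.
have [y yc ry] := flag_rank_surj t_gt0 prJ cJ iJ.
have [rc cc chc] := facesP t_gt0 _ _ prJ cJ.
rewrite -ry -(Bt_card y l); apply: eq_card => a; rewrite inE flag_wordE //.
rewrite (mem_flag_block _ _ chc yc) (flag_pos cJ yc) ry index_uniq //.
by rewrite sort_uniq fset_uniq.
Qed.

Lemma word_eltE (V : words) i l : (forall l, V l \in cum_words n s) ->
  word_elt V i l = [set a | (V l a <= i)%N].
Proof.
move=> cumV; pose X : {ffun 'I_t -> {set 'I_n}} := [ffun l => [set a | (V l a <= i)%N]].
have eqX : val (insubd (Bt_bot t n) X) = X.
  rewrite val_insubd ifT //; apply/forallP=> l1; apply/forallP=> l2.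
  rewrite !ffunE; have := cumV l1; have := cumV l2.
  by rewrite !inE => /forallP/(_ i)/eqP-> /forallP/(_ i)/eqP->.
by have /ffunP/(_ l) := eqX; rewrite [X l]ffunE.
Qed.

Lemma word_elt_rank (V : words) i : (forall l, V l \in cum_words n s) ->
  Bt_rank (word_elt V i) = nth 0%N s i.
Proof.
move=> cumV; rewrite -(Bt_card _ (Ordinal t_gt0)) word_eltE //.
by have := cumV (Ordinal t_gt0); rewrite inE => /forallP/(_ i)/eqP.
Qed.

Lemma word_flag_flag (V : words) : (forall l, V l \in cum_words n s) ->
  word_flag V \in flags t n J.
Proof.
move=> cumV; apply: chain_flag => //.
- move=> _ _ /imsetP[i _ ->] /imsetP[j _ ->]; rewrite /Order.comparable.
  apply/orP; case: (leqP i j) => [|/ltnW] le_ij; [left | right];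
    apply/Bt_leP=> l; rewrite !word_eltE //; apply/subsetP=> a; rewrite !inE;
    by move/leq_trans->.
- move=> _ /imsetP[i _ ->]; rewrite word_elt_rank // -mem_fset_ranks.
  exact: mem_nth.
- move=> j jJ; have js : (index j s < k)%N by rewrite index_mem mem_fset_ranks.
  exists (word_elt V (Ordinal js)); first exact: imset_f.
  by rewrite word_elt_rank // nth_index // mem_fset_ranks.
Qed.

Lemma word_flagK (V : words) : (forall l, V l \in cum_words n s) ->
  flag_word (word_flag V) = V.
Proof.
move=> cumV; apply/ffunP=> l; apply/ffunP=> a; apply: val_inj => /=.
rewrite flag_wordE ?word_flag_flag //.
have inj : injective (word_elt V).
  move=> i j /(congr1 (@Bt_rank t n)); rewrite !word_elt_rank // => eq_ij.
  apply: val_inj => /=; apply/eqP; move/eqP: eq_ij.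
  by rewrite nth_uniq // sort_uniq fset_uniq.
rewrite /block (_ : [set x in _ | _] = word_elt V @: [set i : 'I_k | (i < V l a)%N]).
  by rewrite (card_imset _ inj) card_ord_lt (minn_idPl _) // -ltnS.
apply/setP=> x; rewrite inE; apply/andP/imsetP.
  case=> /imsetP[i _ ->]; rewrite word_eltE // inE -ltnNge => lt_i.
  by exists i; rewrite ?inE.
case=> i; rewrite inE => lt_i ->; split; first exact: imset_f.
by rewrite word_eltE // inE -ltnNge.
Qed.

Lemma flag_word_act c (g : symt t n) l :
  flag_word (((Bt_action t n)^*)%act c g) l = word_act (flag_word c l) (g l).
Proof.
apply/ffunP=> a; rewrite !ffunE; congr inord.
rewrite /block -[RHS](card_imset _ (act_inj (Bt_action t n) g)).
apply: eq_card => x; rewrite inE; apply/andP/imsetP.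
  case=> /imsetP[y yc ->] ay; exists y => //; rewrite inE yc /=.
  by apply: contra ay => ay; rewrite /= ffunE -[a](permKV (g l)) imset_f.
case=> y; rewrite inE => /andP[yc ay] ->; split; first exact: imset_f.
apply: contra ay; rewrite /= ffunE => /imsetP[b yb ->].
by rewrite permK.
Qed.

(** Coordinates are tied only through their cardinalities, which the type prescribes, so they vary
    independently, and the group acts on each of them separately. *)
Lemma card_fixed_flags_words (g : symt t n) :
  #|[set c in flags t n J | ((Bt_action t n)^*)%act c g == c]| =
  (\prod_(l < t) #|[set v in cum_words n s | word_act v (g l) == v]|)%N.
Proof.
set A := [set c in _ | _].
pose B := [set V : words | [forall l,
  (V l \in cum_words n s) && (word_act (V l) (g l) == V l)]].
have AJ c : c \in A -> c \in flags t n J by rewrite inE => /andP[].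
have inj : {in flags t n J &, injective flag_word}.
  by move=> c d cJ dJ eq_cd; rewrite -(flag_wordK cJ) eq_cd flag_wordK.
have actJ c : c \in flags t n J -> ((Bt_action t n)^*)%act c g \in flags t n J.
  move=> cJ; have := acts_faces (@Bt_act_mono t n) (@acts_Bt_proper t n J) #|` J|.
  by move/acts_act=> actsJ; rewrite /flags actsJ ?in_setT.
have -> : #|A| = #|B|.
  rewrite -(card_in_imset (f := flag_word)); last first.
    by move=> c d /AJ cJ /AJ dJ; apply: inj.
  apply: eq_card => V; apply/imsetP/idP.
    case=> c; rewrite inE => /andP[cJ /eqP cg] ->; rewrite inE.
    apply/forallP=> l; rewrite flag_word_cum // -flag_word_act.
    by rewrite [X in flag_word X]cg eqxx.
  rewrite inE => /forallP BV; have cumV l : V l \in cum_words n s.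
    by have /andP[] := BV l.
  exists (word_flag V); last by rewrite word_flagK.
  have VJ := word_flag_flag cumV; rewrite inE VJ /=; apply/eqP.
  apply: inj => //; first exact: actJ.
  apply/ffunP=> l; rewrite flag_word_act word_flagK //.
  by have /andP[_ /eqP] := BV l.
under eq_bigr do rewrite -sum1_card.
rewrite bigA_distr_big_dep /= -sum1_card; apply: eq_big => [V|V _].
  rewrite inE; apply/forallP/familyP=> BV l; have := BV l.
    by rewrite -topredE /= !inE.
  by rewrite -topredE /= !inE.
by rewrite big1.
Qed.

End FlagWords.

(** * Specht modules *)

Section Intertwiners.

Context (F : fieldType) (gT : finGroupType) (G : {group gT}) (n1 n2 : nat).
Context (r1 : mx_representation F G n1) (r2 : mx_representation F G n2).

Definition intertwines (X : 'M[F]_(n1, n2)) := {in G, forall g, r1 g *m X = X *m r2 g}.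

Definition avg_mx (X : 'M[F]_(n1, n2)) : 'M[F]_(n1, n2) :=
  \sum_(g in G) r1 g^-1%g *m X *m r2 g.

Lemma avg_mx_intertwines X : intertwines (avg_mx X).
Proof.
move=> h Gh; rewrite /avg_mx mulmx_sumr mulmx_suml (reindex_inj (mulIg h)).
apply: eq_big => [g|g]; rewrite groupMr // => Gg.
rewrite invMg repr_mxM ?groupV // !mulmxA -[r1 h *m r1 h^-1%g]repr_mxM ?groupV //.
by rewrite mulgV repr_mx1 mul1mx repr_mxM // !mulmxA.
Qed.

Lemma avg_mx_id X : intertwines X -> avg_mx X = #|G|%:R *: X.
Proof.
move=> iX; rewrite /avg_mx (eq_bigr (fun=> X)) => [|g Gg].
  by rewrite sumr_const scaler_nat.
by rewrite -mulmxA -iX // mulmxA -repr_mxM ?groupV // mulVg repr_mx1 mul1mx.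
Qed.

(** The device of Schur orthogonality: the product of two diagonal entries is an entry of a
    conjugated matrix unit. *)
Lemma sum_trace_avg :
  \sum_(g in G) \tr (r1 g^-1%g) * \tr (r2 g) =
  \sum_i \sum_j avg_mx (delta_mx i j) i j.
Proof.
transitivity (\sum_(g in G) \sum_i \sum_j (r1 g^-1%g i i * r2 g j j)).
  apply: eq_bigr => g _; rewrite /mxtrace mulr_suml; apply: eq_bigr => i _.
  by rewrite mulr_sumr.
rewrite exchange_big /=; apply: eq_bigr => i _; rewrite exchange_big /=.
apply: eq_bigr => j _; rewrite summxE; apply: eq_bigr => g _.
rewrite mxE (bigD1 j) //= mxE (bigD1 i) //= mxE !eqxx mulr1 big1 ?addr0 => [|k nk].
  rewrite big1 ?addr0 // => k nk; rewrite mxE big1 ?mul0r // => l _.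
  by rewrite mxE (negbTE nk) andbF mulr0.
by rewrite mxE (negbTE nk) mulr0.
Qed.

Lemma sum_trace0 : (forall X, intertwines X -> X = 0) ->
  \sum_(g in G) \tr (r1 g^-1%g) * \tr (r2 g) = 0.
Proof.
move=> X0; rewrite sum_trace_avg big1 // => i _; rewrite big1 // => j _.
by rewrite (X0 _ (avg_mx_intertwines _)) mxE.
Qed.

(** The average of the matrix unit (i, j) is a multiple [a i j] of [X0]; expanding the average of
    [X0] itself, which is |G| times [X0], evaluates the sum of the [X0 i j * a i j]. *)
Lemma sum_trace1 X0 : X0 != 0 -> intertwines X0 ->
    (forall X, intertwines X -> exists a, X = a *: X0) ->
  \sum_(g in G) \tr (r1 g^-1%g) * \tr (r2 g) = #|G|%:R.
Proof.
move=> nz iX0 allX; rewrite sum_trace_avg.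
have ex ij : exists a, avg_mx (delta_mx ij.1 ij.2) == a *: X0.
  by have [a ->] := allX _ (avg_mx_intertwines (delta_mx ij.1 ij.2)); exists a.
pose a i j := xchoose (ex (i, j)).
have aP i j : avg_mx (delta_mx i j) = a i j *: X0 := eqP (xchooseP (ex (i, j))).
have avgE X : avg_mx X = \sum_i \sum_j X i j *: avg_mx (delta_mx i j).
  rewrite {1}[X]matrix_sum_delta /avg_mx.
  under [RHS]eq_bigr do under eq_bigr do rewrite scaler_sumr.
  under [RHS]eq_bigr do rewrite exchange_big /=.
  rewrite [RHS]exchange_big /=; apply: eq_bigr => g _.
  rewrite mulmx_sumr mulmx_suml; apply: eq_bigr => i _.
  rewrite mulmx_sumr mulmx_suml; apply: eq_bigr => j _.
  by rewrite -scalemxAr -scalemxAl.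
have : (\sum_i \sum_j X0 i j * a i j - #|G|%:R) *: X0 = 0.
  rewrite scalerBl -avg_mx_id // avgE scaler_suml.
  apply/eqP; rewrite subr_eq0; apply/eqP; apply: eq_bigr => i _.
  by rewrite scaler_suml; apply: eq_bigr => j _; rewrite aP scalerA.
move/eqP; rewrite scaler_eq0 (negbTE nz) orbF subr_eq0 => /eqP <-.
apply: eq_bigr => i _; apply: eq_bigr => j _.
by rewrite aP mxE mulrC.
Qed.

End Intertwiners.

(** * Column antisymmetrizers and dominance *)

Section SpechtHom.

Context (m : nat).
Local Notation box := ('I_m * 'I_m)%type.
Implicit Types (mu nu : part m) (T : {ffun 'I_m -> box}) (w r : {ffun 'I_m -> 'I_m}) (s u : 'S_m).

Definition psum nu (i : nat) : nat := \sum_(j < m | (j < i)%N) nu j.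

Definition dominates mu nu : bool := [forall i : 'I_m.+1, (psum nu i <= psum mu i)%N].

Definition colstab T : pred 'S_m := fun s => [forall x, (T (s x)).2 == (T x).2].

Lemma colstabP T s : reflect (forall x, (T (s x)).2 = (T x).2) (colstab T s).
Proof. by apply: (iffP forallP) => H x; apply/eqP. Qed.

Lemma colstabM T s u : colstab T s -> colstab T (u * s)%g = colstab T u.
Proof.
move/colstabP=> cs; apply/colstabP/colstabP=> cu x; have := cu x.
  by rewrite permM cs.
by move=> <-; rewrite permM cs.
Qed.

(** Coefficient of [r] in the image of [w] under the column antisymmetrizer of [T]. *)
Definition col_sym T w r : rat :=
  \sum_(s : 'S_m | colstab T s) (-1) ^+ s * (r == tabloid_act w s)%:R.

Definition tab_rows T : {ffun 'I_m -> 'I_m} := [ffun x => (T x).1].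

Lemma polytabloid_col_sym T r : polytabloid_coef T r = col_sym T (tab_rows T) r.
Proof. by []. Qed.

Lemma col_sym_act T w r s : colstab T s ->
  col_sym T (tabloid_act w s) r = (-1) ^+ s * col_sym T w r.
Proof.
move=> cs; have csV : colstab T s^-1%g.
  by apply/colstabP=> x; rewrite -(colstabP _ _ cs) permKV.
rewrite /col_sym mulr_sumr [RHS](reindex_inj (mulgI s)) /=.
apply: eq_big => [u|u _].
  by apply/idP/idP => [cu|]; [rewrite colstabM | move=> csu; rewrite -(mulKg s u) colstabM].
rewrite tabloid_actM odd_permM signr_addb !mulrA -signr_addb addbb mul1r.
by [].
Qed.

Definition transversal_word T w : bool :=
  [forall x, forall y, ((T x).2 == (T y).2) && (w x == w y) ==> (x == y)].

(** Swapping two entries of a column with equal letters fixes [w] but reverses the sign. *)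
Lemma col_sym_nontransversal T w r : ~~ transversal_word T w -> col_sym T w r = 0.
Proof.
rewrite negb_forall => /existsP[x]; rewrite negb_forall => /existsP[y].
rewrite negb_imply => /andP[/andP[/eqP eqT /eqP eqw] neq].
have cs : colstab T (tperm x y).
  by apply/colstabP=> z; case: tpermP => [->|->|].
have fix_w : tabloid_act w (tperm x y) = w.
  apply/ffunP=> z; rewrite ffunE tpermV; case: tpermP => [->|->|] //.
have := col_sym_act w r cs; rewrite fix_w odd_tperm neq expr1 mulN1r => /eqP.
rewrite -subr_eq0 opprK -mulr2n -mulr_natl mulf_eq0 pnatr_eq0 /=.
by move/eqP.
Qed.

Section OneTableau.

Context (mu : part m) (T : {ffun 'I_m -> box}).
Context (T_tab : T \in tableaux mu).

Lemma tab_inj : injective T.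
Proof. by move: T_tab; rewrite inE => /andP[/injectiveP]. Qed.

Lemma tab_in x : T x \in diagram mu.
Proof. by move: T_tab; rewrite inE => /andP[_ /forallP]. Qed.

Lemma card_diagram : #|diagram mu| = m.
Proof.
transitivity (shape_size mu); last exact: part_size.
by rewrite -card_shape_cells.
Qed.

Lemma tab_onto : T @: setT = diagram mu.
Proof.
apply/eqP; rewrite eqEcard card_imset; last exact: tab_inj.
rewrite cardsT card_ord card_diagram leqnn andbT.
by apply/subsetP=> _ /imsetP[x _ ->]; apply: tab_in.
Qed.

Lemma tab_surj c : c \in diagram mu -> exists x, T x = c.
Proof. by rewrite -tab_onto => /imsetP[x _ ->]; exists x. Qed.

Definition col_rows (c : 'I_m) : {set 'I_m} := [set r | (r, c) \in diagram mu].

Lemma mem_col_rows c (r : 'I_m) : (r \in col_rows c) = (r < #|col_rows c|)%N.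
Proof.
apply: mem_initial_ord => i j; rewrite !inE /= => lt_j le_ij.
apply: leq_trans lt_j _; rewrite -!row_lenE.
by apply: decr_row_len le_ij; apply: part_decr.
Qed.

Lemma card_col c (P : pred 'I_m) :
  #|[set x | ((T x).2 == c) && P (T x).1]| = #|[set r : 'I_m in col_rows c | P r]|.
Proof.
rewrite -(card_in_imset (f := fun x => (T x).1)); last first.
  move=> x y; rewrite !inE => /andP[/eqP cx _] /andP[/eqP cy _] eq1.
  by apply: tab_inj; rewrite (surjective_pairing (T x)) eq1 cx -cy -surjective_pairing.
apply: eq_card => r; rewrite inE; apply/imsetP/andP.
  case=> x; rewrite inE => /andP[/eqP <- Px] ->; split=> //.
  by rewrite inE -surjective_pairing tab_in.
rewrite inE => -[/tab_surj[x defx] Pr].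
by exists x; rewrite ?inE defx /= ?eqxx.
Qed.

Lemma card_col_lt c (i : nat) :
  #|[set x | ((T x).2 == c) && ((T x).1 < i)%N]| = minn i #|col_rows c|.
Proof.
rewrite (card_col c (fun k : 'I_m => k < i)%N).
have le_m : (#|col_rows c| <= m)%N by rewrite -[leqRHS](card_ord m) max_card.
rewrite -[RHS](minn_idPl (leq_trans (geq_minr i _) le_m)) -card_ord_lt.
by apply: eq_card => r; rewrite inE [RHS]inE mem_col_rows ltn_min andbC.
Qed.

Lemma card_col_all c : #|[set x | (T x).2 == c]| = #|col_rows c|.
Proof.
transitivity #|[set x | ((T x).2 == c) && xpredT (T x).1]|.
  by apply: eq_card => x; rewrite !inE andbT.
by rewrite (card_col c xpredT); apply: eq_card => r; rewrite !inE andbT.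
Qed.

(** Letters in a column are distinct, so at most [i] of them are below [i]; the row indices attain
    the minimum of [i] and the column length. *)
Lemma transversal_col_le w c i : transversal_word T w ->
  (#|[set x | ((T x).2 == c) && (w x < i)%N]| <=
   #|[set x | ((T x).2 == c) && ((T x).1 < i)%N]|)%N.
Proof.
move=> /forallP tr; rewrite card_col_lt leq_min; apply/andP; split; last first.
  rewrite -card_col_all; apply: subset_leq_card; apply/subsetP=> x.
  by rewrite !inE => /andP[].
rewrite -(card_in_imset (f := w)).
  apply: (@leq_trans #|[set r : 'I_m | (r < i)%N]|).
    apply: subset_leq_card; apply/subsetP=> _ /imsetP[x + ->].
    by rewrite !inE => /andP[].
  by rewrite card_ord_lt geq_minl.
move=> x y; rewrite !inE => /andP[/eqP cx _] /andP[/eqP cy _] eqw.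
have /forallP/(_ y)/implyP := tr x; rewrite cx cy eqw !eqxx.
by move/(_ isT)/eqP.
Qed.

Lemma card_by_col (P : pred 'I_m) :
  #|[set x | P x]| = (\sum_(c < m) #|[set x | ((T x).2 == c) && P x]|)%N.
Proof.
rewrite -sum1dep_card (partition_big (fun x => (T x).2) xpredT) //=.
apply: eq_bigr => c _; rewrite -sum1dep_card; apply: eq_bigl => x.
by rewrite andbC.
Qed.

Lemma tabloid_lt nu w i : w \in tabloids nu ->
  #|[set x | (w x < i)%N]| = psum nu i.
Proof.
rewrite inE => /forallP cw; rewrite -sum1dep_card /psum.
rewrite (partition_big w (fun j => j < i)%N) //=; apply: eq_bigr => j lt_ji.
rewrite -(eqP (cw j)) -sum1dep_card; apply: eq_bigl => x.
by case: eqP => [->|]; rewrite ?andbF ?lt_ji.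
Qed.

Lemma tab_rows_tabloid : tab_rows T \in tabloids mu.
Proof.
rewrite inE; apply/forallP=> i; apply/eqP.
rewrite -(big_pred1_eq addn i (fun i => mu i : nat)) -(card_shape_rows mu (pred1 i)).
rewrite -(card_imset _ tab_inj); apply: eq_card => c; apply/imsetP/idP.
  case=> x; rewrite inE ffunE => /eqP <- ->; rewrite !inE eqxx andbT.
  by have := tab_in x; rewrite inE.
rewrite !inE => /andP[lt_c /eqP <-].
have [x <-] : exists x, T x = c by apply: tab_surj; rewrite inE.
by exists x; rewrite ?inE ?ffunE.
Qed.

Lemma transversal_psum nu w i : w \in tabloids nu -> transversal_word T w ->
  (psum nu i <= psum mu i)%N.
Proof.
move=> wnu tr; rewrite -(tabloid_lt i wnu) -(tabloid_lt i tab_rows_tabloid).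
rewrite !(card_by_col (fun x => _ < i)%N); apply: leq_sum => c _.
apply: leq_trans (transversal_col_le c i tr) _; rewrite leq_eqVlt; apply/orP; left.
by apply/eqP/eq_card => x; rewrite !inE ffunE.
Qed.

(** Equal contents turn all the column inequalities into equalities, so in each column the letters
    are a rearrangement of the row indices. *)
Lemma transversal_content w : w \in tabloids mu -> transversal_word T w ->
  exists2 s, colstab T s & w = tabloid_act (tab_rows T) s.
Proof.
move=> wmu tr.
pose a i c := #|[set x | ((T x).2 == c) && (w x < i)%N]|.
pose b i c := #|[set x | ((T x).2 == c) && ((T x).1 < i)%N]|.
have le_ab i c : (a i c <= b i c)%N by apply: transversal_col_le.
have eq_ab i c : a i c = b i c.
  have [_ eqS] := leqif_sum (fun (c : 'I_m) (_ : true) => leqif_eq (le_ab i c)).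
  have : (\sum_c a i c == \sum_c b i c)%N.
    rewrite -!(card_by_col (fun x => _ < i)%N) (tabloid_lt i wmu).
    rewrite -(tabloid_lt i tab_rows_tabloid); apply/eqP/eq_card => x.
    by rewrite !inE ffunE.
  by rewrite eqS => /forallP/(_ c)/eqP.
(* [u] keeps the columns of [T] and takes its rows from [w]; once it is seen to be a tableau, the
   permutation linking it to [T] preserves columns. *)
pose u : {ffun 'I_m -> box} := [ffun x => (w x, (T x).2)].
have u_in x : u x \in diagram mu.
  rewrite ffunE; pose c := (T x).2; rewrite -/c.
  suff : w x \in col_rows c by rewrite inE.
  rewrite mem_col_rows; set h := #|col_rows c|.
  have eq_h : a h c = #|[set x | (T x).2 == c]|.
    by rewrite eq_ab /b card_col_lt card_col_all minnn.
  have sub : [set x | ((T x).2 == c) && (w x < h)%N] \subset [set x | (T x).2 == c].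
    by apply/subsetP=> z; rewrite !inE => /andP[].
  have : [set x | ((T x).2 == c) && (w x < h)%N] == [set x | (T x).2 == c].
    by rewrite eqEcard sub -/(a h c) eq_h leqnn.
  by move/eqP/setP/(_ x); rewrite !inE eqxx /=.
have u_inj : injective u.
  move=> x y; rewrite !ffunE => -[eqw eqc]; apply/eqP.
  have /forallP/(_ x)/forallP/(_ y)/implyP := tr.
  by rewrite eqw eqc !eqxx; apply.
have [|s def_u] := @content_orbit _ _ T u.
  exact: content_inj card_diagram tab_inj tab_in u_inj u_in.
exists s.
  apply/colstabP=> x; have /ffunP/(_ (s x)) := def_u; rewrite !ffunE permK => ->.
  by [].
by apply/ffunP=> x; have /ffunP/(_ x) := def_u; rewrite !ffunE => ->.
Qed.

End OneTableau.
End SpechtHom.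

(** * Homomorphisms and orthogonality of Specht characters *)

Section SpechtOrthogonality.

Context (m : nat).
Local Notation box := ('I_m * 'I_m)%type.
Implicit Types (mu nu : part m) (T : {ffun 'I_m -> box}) (w r : {ffun 'I_m -> 'I_m}) (s u : 'S_m).

Lemma col_sym_actr T w r s : colstab T s ->
  col_sym T w (tabloid_act r s^-1%g) = (-1) ^+ s * col_sym T w r.
Proof.
move=> cs; rewrite /col_sym mulr_sumr [RHS](reindex_inj (mulIg s)) /=.
apply: eq_big => [u|u _]; first by rewrite colstabM.
rewrite odd_permM signr_addb [_ * (-1) ^+ s]mulrC !mulrA -signr_addb addbb mul1r.
congr (_ * (nat_of_bool _)%:R); rewrite tabloid_actM.
by rewrite -[in RHS](inj_eq (act_inj (tabloid_action m) s^-1%g)) /= -!tabloid_actM mulgV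
  tabloid_actM tabloid_act1.
Qed.

Definition polytabloid_row mu T : 'rV[rat]_#|tabloids mu| :=
  \row_b polytabloid_coef T (enum_val b).

Lemma polytabloid_row_act mu T g :
  polytabloid_row mu T *m tabloid_repr mu g = polytabloid_row mu [ffun x => T (g^-1%g x)].
Proof.
apply/rowP=> b; rewrite (mulmx_set_perm (acts_tabloids mu)) !mxE.
rewrite enum_rankK_in ?(set_perm_in (acts_tabloids mu)) //.
by rewrite -(polytabloid_coef_act _ _ g) -[X in polytabloid_coef _ X]/
  (tabloid_action m _ g) actKV.
Qed.

Lemma polytabloid_row_colstab mu T s : colstab T s ->
  polytabloid_row mu T *m tabloid_repr mu s = (-1) ^+ s *: polytabloid_row mu T.
Proof.
move=> cs; apply/rowP=> b; rewrite (mulmx_set_perm (acts_tabloids mu)) !mxE.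
rewrite enum_rankK_in ?(set_perm_in (acts_tabloids mu)) //.
by rewrite !polytabloid_col_sym -col_sym_actr.
Qed.

Definition col_sym_mx nu T : 'M[rat]_#|tabloids nu| :=
  \sum_(s : 'S_m | colstab T s) (-1) ^+ s *: tabloid_repr nu s.

Lemma col_sym_mxE nu T a b :
  col_sym_mx nu T a b = col_sym T (enum_val a) (enum_val b).
Proof.
rewrite /col_sym_mx summxE; apply: eq_bigr => s _; rewrite !mxE.
by rewrite eq_sym.
Qed.

Lemma col_sym_mx0 mu nu T : T \in tableaux mu -> ~~ dominates mu nu ->
  col_sym_mx nu T = 0.
Proof.
move=> Tmu ndom; apply/matrixP=> a b; rewrite col_sym_mxE mxE.
apply: col_sym_nontransversal; apply: contra ndom => tr; apply/forallP=> i.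
exact: (transversal_psum Tmu i (enum_valP a) tr).
Qed.

(** Each tabloid of shape [mu] is sent to zero or to the polytabloid of [T] up to sign. *)
Lemma col_sym_mx_rank1 mu T : T \in tableaux mu ->
  exists e : 'cV_#|tabloids mu|, col_sym_mx mu T = e *m polytabloid_row mu T.
Proof.
move=> Tmu.
have ex (a : 'I_#|tabloids mu|) : exists e : rat, [forall b : 'I_#|tabloids mu|,
    col_sym_mx mu T a b == e * polytabloid_row mu T 0 b].
  case: (boolP (transversal_word T (enum_val a))) => tr.
    have [s cs def_a] := transversal_content Tmu (enum_valP a) tr.
    exists ((-1) ^+ s); apply/forallP=> b; rewrite col_sym_mxE def_a col_sym_act //.
    by rewrite mxE polytabloid_col_sym.
  by exists 0; apply/forallP=> b; rewrite col_sym_mxE col_sym_nontransversal // mul0r.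
exists (\col_a xchoose (ex a)); apply/matrixP=> a b.
by rewrite (eqP (forallP (xchooseP (ex a)) b)) [RHS]mxE big_ord1 [X in _ = X * _]mxE.
Qed.

Lemma colstab1 T : colstab T 1%g.
Proof. by apply/colstabP=> x; rewrite perm1. Qed.

Lemma polytabloid_row_neq0 mu T : T \in tableaux mu -> polytabloid_row mu T != 0.
Proof.
move=> Tmu; apply/rV0Pn; have rT := tab_rows_tabloid Tmu.
exists (enum_rank_in rT (tab_rows T)); rewrite mxE enum_rankK_in //.
rewrite polytabloid_col_sym /col_sym (bigD1 1%g) ?colstab1 //= odd_perm1 mul1r.
rewrite tabloid_act1 eqxx big1 ?addr0 ?oner_neq0 // => s /andP[/colstabP cs neq1].
rewrite (_ : _ == _ = false) ?mulr0 //; apply: contraNF neq1 => /eqP/ffunP eqr.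
apply/eqP/permP=> x; rewrite perm1; apply: (tab_inj Tmu).
rewrite (surjective_pairing (T (s x))) (surjective_pairing (T x)) cs.
by have := eqr (s x); rewrite !ffunE permK => ->.
Qed.

Lemma polytabloid_row_specht mu T : T \in tableaux mu ->
  (polytabloid_row mu T <= specht_mx mu)%MS.
Proof.
move=> Tmu; rewrite genmxE.
suff -> : polytabloid_row mu T = row (enum_rank_in Tmu T) (polytabloid_mx mu) by apply: row_sub.
by apply/rowP=> b; rewrite !mxE enum_rankK_in.
Qed.

Lemma tableaux_neq0 mu : exists T, T \in tableaux mu.
Proof.
have eq_m : m = #|diagram mu| by rewrite card_diagram.
pose T : {ffun 'I_m -> box} := [ffun x => enum_val (cast_ord eq_m x)].
exists T; rewrite inE; apply/andP; split.
  by apply/injectiveP=> x y; rewrite !ffunE => /enum_val_inj/cast_ord_inj.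
by apply/forallP=> x; rewrite ffunE; apply: enum_valP.
Qed.

Lemma tableaux_conj mu T T' : T \in tableaux mu -> T' \in tableaux mu ->
  exists g : 'S_m, T' = [ffun x => T (g^-1%g x)].
Proof.
move=> Tmu T'mu; have [|g <-] := @content_orbit _ _ T T'; last by exists g.
apply: (content_inj (card_diagram mu)); first exact: tab_inj Tmu.
- exact: tab_in Tmu.
- exact: tab_inj T'mu.
- exact: tab_in T'mu.
Qed.

Section Homs.

Context (mu nu : part m) (X : 'M[rat]_(\rank (specht_mx mu), #|tabloids nu|)).
Context (iX : intertwines (specht_repr mu) (tabloid_repr nu) X).

Local Notation gen T := (in_submod (specht_mx mu) (polytabloid_row mu T)).

Lemma gen_act T g : T \in tableaux mu ->
  gen T *m specht_repr mu g = gen [ffun x => T (g^-1%g x)].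
Proof.
move=> Tmu; rewrite -polytabloid_row_act.
apply/esym; apply: (in_submodJ (specht_module mu)).
exact: polytabloid_row_specht.
Qed.

(** Every column permutation scales the polytabloid of [T] by its sign, and [X] transports this to
    the image. *)
Lemma hom_col_sym T : T \in tableaux mu ->
  gen T *m X *m col_sym_mx nu T = #|[set s | colstab T s]|%:R *: (gen T *m X).
Proof.
move=> Tmu; rewrite /col_sym_mx mulmx_sumr.
rewrite (eq_bigr (fun=> gen T *m X)) => [|s cs].
  by rewrite sumr_const scaler_nat; congr (_ *+ _); apply: eq_card => s; rewrite inE.
rewrite -scalemxAr -mulmxA -iX ?inE // mulmxA.
have -> : gen T *m specht_repr mu s = (-1) ^+ s *: gen T.
  transitivity (in_submod (specht_mx mu) (polytabloid_row mu T *m tabloid_repr mu s)).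
    apply/esym; apply: (in_submodJ (specht_module mu)).
    exact: polytabloid_row_specht.
  rewrite polytabloid_row_colstab // in_submodE -scalemxAl.
  by congr (_ *: _); rewrite -in_submodE.
by rewrite -scalemxAl scalerA -signr_addb addbb scale1r.
Qed.

Lemma card_colstab_neq0 T : #|[set s | colstab T s]|%:R != 0 :> rat.
Proof.
rewrite pnatr_eq0 -lt0n; apply/card_gt0P; exists 1%g.
by rewrite inE colstab1.
Qed.

Lemma gen_full : row_full (in_submod (specht_mx mu) (polytabloid_mx mu)).
Proof.
by rewrite /row_full mxrank_in_submod ?genmxE.
Qed.

Lemma gen_row a : row a (in_submod (specht_mx mu) (polytabloid_mx mu)) = gen (enum_val a).
Proof.
rewrite in_submodE row_mul [in RHS]in_submodE; congr (_ *m _).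
by apply/rowP=> b; rewrite !mxE.
Qed.

Lemma hom_eq (Z : 'M[rat]_(\rank (specht_mx mu), #|tabloids nu|)) :
  (forall T, T \in tableaux mu -> gen T *m X = gen T *m Z) -> X = Z.
Proof.
move=> eqXZ; apply: (row_full_inj gen_full); apply/row_matrixP=> a.
by rewrite [LHS]row_mul [RHS]row_mul gen_row eqXZ ?enum_valP.
Qed.

End Homs.

(** By [hom_col_sym] the image of a polytabloid is a nonzero scalar times an antisymmetrization, and
    the antisymmetrizer kills all tabloids of shape [nu]. *)
Lemma hom_not_dominates mu nu X : ~~ dominates mu nu ->
  intertwines (specht_repr mu) (tabloid_repr nu) X -> X = 0.
Proof.
move=> ndom iX; apply: hom_eq => T Tmu; rewrite mulmx0.
have := hom_col_sym iX Tmu; rewrite (col_sym_mx0 Tmu ndom) mulmx0.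
by move/esym/eqP; rewrite scaler_eq0 (negbTE (card_colstab_neq0 T)) => /eqP.
Qed.

(** Here the antisymmetrizer has rank one, so one polytabloid is sent to a multiple of itself; the
    group carries this multiple to all others. *)
Lemma hom_diag mu X : intertwines (specht_repr mu) (tabloid_repr mu) X ->
  exists a, X = a *: val_submod (1%:M : 'M_(\rank (specht_mx mu))).
Proof.
move=> iX; have [T0 T0mu] := tableaux_neq0 mu.
have valg T : T \in tableaux mu -> in_submod (specht_mx mu) (polytabloid_row mu T) *m
    val_submod (1%:M : 'M_(\rank (specht_mx mu))) = polytabloid_row mu T.
  by move=> Tmu; rewrite -val_submodE in_submodK // polytabloid_row_specht.
have [a def_a] : exists a, in_submod (specht_mx mu) (polytabloid_row mu T0) *m X =
    a *: polytabloid_row mu T0.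
  have [e def_e] := col_sym_mx_rank1 T0mu; have := hom_col_sym iX T0mu.
  rewrite def_e mulmxA; set y := _ *m e; rewrite [y]mx11_scalar mul_scalar_mx.
  move/(congr1 (fun Z => #|[set s | colstab T0 s]|%:R^-1 *: Z)); rewrite !scalerA.
  rewrite mulVf ?card_colstab_neq0 // scale1r => <-.
  by eexists.
exists a; apply: hom_eq => T Tmu; have [g defT] := tableaux_conj T0mu Tmu.
rewrite -scalemxAr valg // defT -gen_act // -mulmxA iX ?inE // mulmxA def_a.
by rewrite -scalemxAl polytabloid_row_act.
Qed.

Lemma specht_incl_intertwines mu : intertwines (specht_repr mu) (tabloid_repr mu)
  (val_submod (1%:M : 'M_(\rank (specht_mx mu)))).
Proof.
move=> g Gg; rewrite -val_submodE -[specht_repr mu g]mul1mx.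
exact: (val_submodJ (specht_module mu)).
Qed.

Lemma specht_incl_neq0 mu : val_submod (1%:M : 'M_(\rank (specht_mx mu))) != 0.
Proof.
have [T Tmu] := tableaux_neq0 mu; apply/eqP=> v0.
have sub : (specht_mx mu <= val_submod (1%:M : 'M_(\rank (specht_mx mu))))%MS.
  by rewrite val_submod1.
have := submx_trans (polytabloid_row_specht Tmu) sub.
rewrite v0 => /submx0null row0.
by have := polytabloid_row_neq0 Tmu; rewrite row0 eqxx.
Qed.

Definition tabloid_char nu (g : 'S_m) : rat := \tr (tabloid_repr nu g).

Lemma specht_tabloid_sum0 mu nu : ~~ dominates mu nu ->
  \sum_(g : 'S_m) specht_char mu g^-1%g * tabloid_char nu g = 0.
Proof.
move=> ndom; have := sum_trace0 (fun X => @hom_not_dominates mu nu X ndom).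
by under eq_bigl do rewrite inE.
Qed.

Lemma specht_tabloid_sum1 mu :
  \sum_(g : 'S_m) specht_char mu g^-1%g * tabloid_char mu g = m`!%:R.
Proof.
have := sum_trace1 (specht_incl_neq0 mu) (@specht_incl_intertwines mu) (@hom_diag mu).
by under eq_bigl do rewrite inE; rewrite cardsT card_Sn.
Qed.

Lemma specht_specht_hom mu nu X : intertwines (specht_repr mu) (specht_repr nu) X ->
  intertwines (specht_repr mu) (tabloid_repr nu)
    (X *m val_submod (1%:M : 'M_(\rank (specht_mx nu)))).
Proof.
move=> iX g Gg; rewrite [LHS]mulmxA iX // -[LHS]mulmxA (@specht_incl_intertwines nu) //.
by rewrite [LHS]mulmxA.
Qed.

Lemma val_submod1_inj nu k (X Z : 'M[rat]_(k, \rank (specht_mx nu))) :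
  X *m val_submod 1%:M = Z *m val_submod 1%:M -> X = Z.
Proof. by rewrite -!val_submodE => /val_submod_inj. Qed.

Lemma specht_orth mu nu : ~~ dominates mu nu ->
  \sum_(g : 'S_m) specht_char mu g^-1%g * specht_char nu g = 0.
Proof.
move=> ndom; have := @sum_trace0 _ _ _ _ _ (specht_repr mu) (specht_repr nu).
under eq_bigl do rewrite inE.
apply=> X /specht_specht_hom/(hom_not_dominates ndom) X0.
by apply: val_submod1_inj; rewrite X0 mul0mx.
Qed.

Lemma specht_norm mu :
  \sum_(g : 'S_m) specht_char mu g^-1%g * specht_char mu g = m`!%:R.
Proof.
have := @sum_trace1 _ _ _ _ _ (specht_repr mu) (specht_repr mu) 1%:M.
under eq_bigl do rewrite inE; rewrite cardsT card_Sn; apply.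
- apply: contraNneq (specht_incl_neq0 mu) => one0.
  by rewrite one0 linear0.
- by move=> g Gg; rewrite mulmx1 mul1mx.
move=> X /specht_specht_hom/hom_diag[a def_a]; exists a.
by apply: val_submod1_inj; rewrite def_a -scalemxAl mul1mx.
Qed.

(** Tabloid matrices are orthogonal. The Gram matrix of a basis of the Specht module, invertible by
    positivity, therefore conjugates the action of [g] to the transpose of that of its inverse. *)
Lemma specht_charV mu g : specht_char mu g^-1%g = specht_char mu g.
Proof.
have [b bact bfree] : exists2 b : 'M_(\rank (specht_mx mu), #|tabloids mu|),
    forall h, b *m tabloid_repr mu h = specht_repr mu h *m b & row_free b.
  exists (val_submod 1%:M) => [h|]; last by rewrite /row_free val_submod1.
  by rewrite (@specht_incl_intertwines mu) ?inE.
have trV h : (tabloid_repr mu h)^T = tabloid_repr mu h^-1%g.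
  apply/matrixP=> i j; rewrite !mxE; congr (nat_of_bool _)%:R.
  by rewrite -[in RHS](inj_eq (act_inj (tabloid_action m) h)) actKV eq_sym.
pose Gm := b *m b^T.
have Gu : Gm \in unitmx.
  rewrite -row_free_unit -kermx_eq0; apply/rowV0P=> v /sub_kermxP vG.
  have vb : v *m b = 0.
    by apply: dotmx_eq0; rewrite trmx_mul mulmxA -(mulmxA v) vG mul0mx.
  by apply: (row_free_inj bfree); rewrite vb mul0mx.
have GE : specht_repr mu g *m Gm = Gm *m (specht_repr mu g^-1%g)^T.
  transitivity (b *m tabloid_repr mu g *m b^T); first by rewrite bact /Gm -[RHS]mulmxA.
  by rewrite /Gm -[RHS]mulmxA -trmx_mul -bact trmx_mul trV invgK -[LHS]mulmxA.
rewrite /specht_char -[LHS]mxtrace_tr.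
rewrite -[(specht_repr mu g^-1%g)^T](mulKmx Gu) -GE mxtrace_mulC -mulmxA.
by rewrite mulmxV // mulmx1.
Qed.

End SpechtOrthogonality.

(** * Young's rule *)

Section MonomialExpansion.

Context (m N : nat).
Implicit Types (al : {ffun 'I_N -> 'I_m.+1}).

Definition word_count al (g : 'S_m) : nat :=
  #|[set w : {ffun 'I_m -> 'I_N} | (content w == al) && (word_act w g == w)]|.

Definition tab_content (mu : part m) (T : {ffun cell mu -> 'I_N}) : {ffun 'I_N -> 'I_m.+1} :=
  [ffun a => inord #|[set c | T c == a]|].

Definition kostka (mu : part m) al : nat :=
  #|[set T : {ffun cell mu -> 'I_N} | semistandard T && (tab_content T == al)]|.

Lemma card_cell (mu : part m) : #|{: cell mu}| = m.
Proof. by rewrite card_sig -[RHS](card_diagram mu); apply: eq_card => c; rewrite inE. Qed.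

Lemma tab_contentE (mu : part m) (T : {ffun cell mu -> 'I_N}) a :
  tab_content T a = #|[set c | T c == a]| :> nat.
Proof.
by rewrite ffunE inordK // ltnS -[leqRHS](card_cell mu) max_card.
Qed.

Context (R : comNzRingType) (x : nat -> R).

Definition monom al : R := \prod_(i < N) x i ^+ al i.

Lemma word_sum_monom g :
  word_sum x N g = \sum_al (word_count al g)%:R * monom al.
Proof.
rewrite /word_sum (partition_big (@content m 'I_N) xpredT) //=.
apply: eq_bigr => al _; rewrite mulr_natl -sumr_const; apply: eq_big => [w|w].
  by rewrite inE andbC.
by case/andP=> _ /eqP <-; rewrite (prod_content (fun i : 'I_N => x i)).
Qed.

Lemma strip_schur_monom (mu : part m) :
  strip_schur x N mu = \sum_al (kostka mu al)%:R * monom al.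
Proof.
rewrite -sum_ssyt (partition_big (@tab_content mu) xpredT) //=.
apply: eq_bigr => al _; rewrite mulr_natl -sumr_const; apply: eq_big => [T|T].
  by rewrite inE.
case/andP=> _ /eqP <-; rewrite (partition_big T xpredT) //=.
apply: eq_bigr => i _; rewrite tab_contentE -prodr_const.
by apply: eq_big => [c|c /eqP->//]; rewrite inE.
Qed.

End MonomialExpansion.

Lemma strip_schur_nondecr m (R : comNzRingType) (x : nat -> R) N
    (mu : {ffun 'I_m -> 'I_m.+1}) : ~~ hstrip mu mu -> strip_schur x N mu = 0.
Proof.
move=> ndec; case: N => [|N] /=.
  case: eqP => // mu0; case/negP: ndec; apply/hstripP=> i.
  by rewrite !shape_size0.
rewrite big_pred0 // => ta; apply: contraNF ndec => hs.
by have [] := hstrip_diag hs.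
Qed.

Lemma sum_shapes_part m (R : nmodType) (F : {ffun 'I_m -> 'I_m.+1} -> R) :
    (forall mu, ~~ hstrip mu mu -> F mu = 0) ->
  \sum_(mu : {ffun 'I_m -> 'I_m.+1} | shape_size mu == m) F mu = \sum_(mu : part m) F mu.
Proof.
move=> F0; rewrite (bigID (fun mu => hstrip mu mu)) /= [X in _ + X]big1 ?addr0; last first.
  by move=> mu /andP[_ /F0].
rewrite (eq_bigl (@is_part m)); last by move=> mu; rewrite is_part_hstrip andbC.
rewrite (reindex_omap (@part_row m) insub) => [|mu pmu]; last by rewrite insubT.
by apply: eq_bigl => mu; rewrite (partP mu) (valK mu) eqxx.
Qed.

Lemma word_sum_part m (R : comNzRingType) (x y : nat -> R) r N :
  \sum_(g : 'S_m) word_sum x r g * word_sum y N g =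
  m`!%:R * \sum_(mu : part m) strip_schur x r mu * strip_schur y N mu.
Proof.
rewrite word_sum_pair sum_shapes_part // => mu ndec.
by rewrite strip_schur_nondecr ?mul0r.
Qed.

Lemma word_sum_rmorph m (R R' : comNzRingType) (f : {rmorphism R -> R'}) (x : nat -> R) N
    (g : 'S_m) : word_sum (fun i => f (x i)) N g = f (word_sum x N g).
Proof. by rewrite rmorph_sum; apply: eq_bigr => w _; rewrite rmorph_prod. Qed.

Lemma strip_schur_rmorph m (R R' : comNzRingType) (f : {rmorphism R -> R'}) (x : nat -> R) N
    (mu : {ffun 'I_m -> 'I_m.+1}) :
  strip_schur (fun i => f (x i)) N mu = f (strip_schur x N mu).
Proof.
elim: N mu => [|N IHN] mu /=; first by rewrite rmorph_nat.
by rewrite rmorph_sum; apply: eq_bigr => ta _; rewrite rmorphM rmorphXn IHN.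
Qed.

Lemma mpoly_monom_indep (S : comNzRingType) m r (c d : {ffun 'I_r -> 'I_m.+1} -> S)
    (x : nat -> {mpoly S[r]}) : (forall i : 'I_r, x i = 'X_i) ->
    \sum_al (c al)%:MP * monom x al = \sum_al (d al)%:MP * monom x al ->
  forall al, c al = d al.
Proof.
move=> xE eq_cd al.
pose mn (be : {ffun 'I_r -> 'I_m.+1}) : 'X_{1..r} := [multinom (be i : nat) | i < r].
have mnE be : monom x be = 'X_[mn be].
  rewrite mpolyXE_id; apply: eq_bigr => i _; rewrite xE mnmE.
  by [].
have coefE e : (\sum_be (e be)%:MP * monom x be)@_(mn al) = e al :> S.
  rewrite raddf_sum /= (bigD1 al) //= mnE mcoeffCM mcoeffX eqxx mulr1.
  rewrite big1 ?addr0 // => be neq; rewrite mnE mcoeffCM mcoeffX.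
  rewrite (_ : mn be == mn al = false) ?mulr0 //; apply: contraNF neq => /eqP eq_m.
  apply/eqP/ffunP=> i; apply: val_inj => /=.
  by have := congr1 (fun mm : 'X_{1..r} => mm i) eq_m; rewrite !mnmE.
by rewrite -(coefE c) eq_cd coefE.
Qed.

Definition mvar (S : comNzRingType) r (i : nat) : {mpoly S[r]} :=
  if insub i is Some j then 'X_j else 0.

Lemma mvarE (S : comNzRingType) r (i : 'I_r) : mvar S r i = 'X_i.
Proof. by rewrite /mvar valK. Qed.

(** Comparison of coefficients in [word_sum_part]. Polynomials in [x] over polynomials in [y] keep
    the two alphabets independent, so coefficients are extracted twice. *)
Lemma word_count_pair m r N (al : {ffun 'I_r -> 'I_m.+1}) (be : {ffun 'I_N -> 'I_m.+1}) :
  \sum_(g : 'S_m) (word_count al g)%:R * (word_count be g)%:R =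
  m`!%:R * \sum_(mu : part m) (kostka mu al)%:R * (kostka mu be)%:R :> rat.
Proof.
pose S := {mpoly rat[N]}; pose x := mvar S r; pose y0 := mvar rat N.
pose y i : {mpoly S[r]} := (y0 i)%:MP.
have wE g : word_sum y N g = (word_sum y0 N g)%:MP.
  exact: (word_sum_rmorph (mpolyC r (R := S))).
have sE (mu : part m) : strip_schur y N mu = (strip_schur y0 N mu)%:MP.
  exact: (strip_schur_rmorph (mpolyC r (R := S))).
have eqS : \sum_(g : 'S_m) (word_count al g)%:R * word_sum y0 N g =
    m`!%:R * \sum_(mu : part m) (kostka mu al)%:R * strip_schur y0 N mu.
  apply: (@mpoly_monom_indep S m r
    (fun al => \sum_(g : 'S_m) (word_count al g)%:R * word_sum y0 N g)
    (fun al => m`!%:R * \sum_(mu : part m) (kostka mu al)%:R * strip_schur y0 N mu) x).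
    by move=> i; rewrite /x mvarE.
  have LE (g : 'S_m) : word_sum x r g * word_sum y N g = \sum_(a : {ffun 'I_r -> 'I_m.+1})
      ((word_count a g)%:R * word_sum y0 N g)%:MP * monom x a.
    rewrite word_sum_monom wE mulr_suml; apply: eq_bigr => a _.
    by rewrite rmorphM rmorph_nat mulrAC.
  have RE (mu : part m) : m`!%:R * (strip_schur x r mu * strip_schur y N mu) =
      \sum_(a : {ffun 'I_r -> 'I_m.+1})
        (m`!%:R * ((kostka mu a)%:R * strip_schur y0 N mu))%:MP * monom x a.
    rewrite strip_schur_monom sE mulr_suml mulr_sumr; apply: eq_bigr => a _.
    by rewrite !rmorphM !rmorph_nat -!mulrA; congr (_ * (_ * _)); rewrite mulrC.
  have := @word_sum_part m _ x y r N.
  rewrite (eq_bigr _ (fun g _ => LE g)) mulr_sumr (eq_bigr _ (fun mu _ => RE mu)).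
  rewrite exchange_big [X in _ = X -> _]exchange_big /= => eqL.
  transitivity (\sum_(a : {ffun 'I_r -> 'I_m.+1}) \sum_(g : 'S_m)
      ((word_count a g)%:R * word_sum y0 N g)%:MP * monom x a).
    by apply: eq_bigr => a _; rewrite rmorph_sum mulr_suml.
  rewrite eqL; apply: eq_bigr => a _.
  by rewrite mulr_sumr rmorph_sum mulr_suml.
apply: (@mpoly_monom_indep rat m N
  (fun be => \sum_(g : 'S_m) (word_count al g)%:R * (word_count be g)%:R)
  (fun be => m`!%:R * \sum_(mu : part m) (kostka mu al)%:R * (kostka mu be)%:R) y0).
  by move=> i; rewrite /y0 mvarE.
transitivity (\sum_(g : 'S_m) (word_count al g)%:R * word_sum y0 N g).
  under [LHS]eq_bigr do rewrite rmorph_sum mulr_suml.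
  rewrite exchange_big /=; apply: eq_bigr => g _; rewrite word_sum_monom mulr_sumr.
  by apply: eq_bigr => b _; rewrite rmorphM !rmorph_nat mulrA.
rewrite eqS mulr_sumr.
transitivity (\sum_(mu : part m) \sum_(be : {ffun 'I_N -> 'I_m.+1}) (m`!%:R * ((kostka mu al)%:R * (kostka mu be)%:R))%:MP
                 * monom y0 be).
  apply: eq_bigr => mu _; rewrite strip_schur_monom !mulr_sumr.
  by apply: eq_bigr => b _; rewrite !rmorphM !rmorph_nat -!mulrA.
rewrite exchange_big /=; apply: eq_bigr => b _.
by rewrite mulr_sumr rmorph_sum mulr_suml.
Qed.

(** * Triangularity and the Frobenius formula *)

Section YoungRule.

Context (m : nat).
Implicit Types (mu nu : part m).

Lemma card_cells_rows mu (P : pred 'I_m) :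
  #|[set c : cell mu | P (val c).1]| = (\sum_(i < m | P i) mu i)%N.
Proof.
rewrite -card_shape_rows -!sum1dep_card.
rewrite -(big_sub_cond (mem (diagram mu)) (fun c => P c.1) (fun=> 1%N)) /=.
by apply: eq_bigl => c; rewrite !inE.
Qed.

(** Entries grow strictly down a column, starting from at least 0. *)
Lemma ssyt_row_le N mu (T : {ffun cell mu -> 'I_N}) (c : cell mu) :
  semistandard T -> ((val c).1 <= T c)%N.
Proof.
move=> /forallP ss; case: c => -[i j] cmu /=.
have [k lt_ik] := ubnP i; elim: k i cmu lt_ik => // k IHk i cmu lt_ik.
case: (posnP i) => [->//|i_gt0].
have lt_i' : (i.-1 < m)%N by apply: leq_ltn_trans (leq_pred i) (ltn_ord i).
have c'mu : (Ordinal lt_i', j) \in diagram mu.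
  move: cmu; rewrite !inE /= -!row_lenE => lt_j; apply: leq_trans lt_j _.
  by apply: decr_row_len (part_decr mu) _; apply: leq_pred.
have le_i' := IHk (Ordinal lt_i') c'mu.
apply: (@leq_trans (T (Sub (Ordinal lt_i', j) c'mu)).+1).
  by apply: leq_trans (leqSpred i) _; rewrite ltnS; apply: le_i' => /=; lia.
have /forallP/(_ (Sub (i, j) cmu))/andP[_ /implyP] := ss (Sub (Ordinal lt_i', j) c'mu).
by apply; rewrite /= eqxx /= prednK.
Qed.

Lemma ssyt_content_lt mu nu (T : {ffun cell mu -> 'I_m}) k :
  tab_content T = nu -> #|[set c | (T c < k)%N]| = psum nu k.
Proof.
move=> cT; rewrite -sum1dep_card (partition_big T (fun j => j < k)%N) //=.
apply: eq_bigr => j lt_jk; rewrite -cT tab_contentE -sum1dep_card.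
by apply: eq_bigl => c; case: eqP => [->|]; rewrite ?andbF ?lt_jk.
Qed.

Lemma ssyt_lt_sub N mu (T : {ffun cell mu -> 'I_N}) k : semistandard T ->
  [set c | (T c < k)%N] \subset [set c : cell mu | ((val c).1 < k)%N].
Proof.
move=> ss; apply/subsetP=> c; rewrite !inE.
by apply: leq_ltn_trans; apply: ssyt_row_le.
Qed.

Lemma kostka_dominates mu nu : ~~ dominates mu nu -> kostka mu nu = 0%N.
Proof.
move=> ndom; apply/eqP; rewrite cards_eq0; apply: contraR ndom => /set0Pn[T].
rewrite inE => /andP[ss /eqP cT]; apply/forallP=> k.
rewrite -(ssyt_content_lt k cT) /psum -(card_cells_rows mu (fun i : 'I_m => i < k)%N).
exact/subset_leq_card/ssyt_lt_sub.
Qed.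

Lemma kostka_diag mu : kostka mu mu = 1%N.
Proof.
pose T0 : {ffun cell mu -> 'I_m} := [ffun c => (val c).1].
apply/eqP/cards1P; exists T0; apply/setP=> T; rewrite !inE; apply/andP/eqP.
  case=> ss /eqP cT; apply/ffunP=> c; apply: val_inj; rewrite /= ffunE /=.
  apply/eqP; rewrite eqn_leq ssyt_row_le // andbT.
  have : [set c' | (T c' < (val c).1.+1)%N] == [set c' : cell mu | ((val c').1 < (val c).1.+1)%N].
    rewrite eqEcard ssyt_lt_sub // (ssyt_content_lt _ cT).
    by rewrite (card_cells_rows mu (fun i : 'I_m => i < (val c).1.+1)%N) leqnn.
  by move/eqP/setP/(_ c); rewrite !inE ltnS leqnn.
move=> ->; split.
  apply/forallP=> c; apply/forallP=> e; rewrite !ffunE; apply/andP; split.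
    by apply/implyP=> /andP[/eqP -> _].
  by apply/implyP=> /andP[_].
apply/eqP/ffunP=> i; apply: val_inj; rewrite /= tab_contentE.
rewrite -[RHS](big_pred1_eq addn i (fun i => mu i : nat)).
rewrite -(card_cells_rows mu (pred1 i)).
by apply: eq_card => c; rewrite !inE ffunE.
Qed.

(** A statistic strictly increasing in the dominance order, for inductions along it. *)
Definition dom_rank mu : nat := \sum_(k < m.+1) psum mu k.

Lemma psum_inj mu nu : (forall k : 'I_m.+1, psum mu k = psum nu k) -> mu = nu.
Proof.
move=> eq_p; apply: val_inj; apply/ffunP=> i; apply: val_inj => /=.
have rec la : psum la i.+1 = (psum la i + la i)%N.
  rewrite /psum (bigD1 i) ?leqnn //= addnC; congr (_ + _)%N.
  apply: eq_bigl => j; rewrite ltnS -val_eqE /=; lia.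
have := eq_p (inord i.+1); rewrite inordK ?ltnS // !rec.
have := eq_p (inord i); rewrite inordK; last by rewrite ltnS ltnW.
by move=> -> /addnI.
Qed.

Lemma dominates_rank mu nu : dominates mu nu -> (dom_rank mu <= dom_rank nu)%N -> mu = nu.
Proof.
move=> /forallP dom le_r.
have [le_r' eqS] := leqif_sum (fun (k : 'I_m.+1) (_ : true) => leqif_eq (dom k)).
have : (dom_rank nu == dom_rank mu) by rewrite eqn_leq le_r' le_r.
rewrite eqS => /forallP eq_p; apply: psum_inj => k.
by apply/esym/eqP; apply: eq_p.
Qed.

Lemma specht_inner mu nu :
  \sum_(g : 'S_m) specht_char mu g * specht_char nu g = m`!%:R * (mu == nu)%:R.
Proof.
have inner la ka : \sum_(g : 'S_m) specht_char la g * specht_char ka g =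
    \sum_(g : 'S_m) specht_char la g^-1%g * specht_char ka g.
  by apply: eq_bigr => g _; rewrite specht_charV.
have [<-|neq] := eqVneq mu nu; first by rewrite mulr1 inner specht_norm.
rewrite mulr0; case: (boolP (dominates mu nu)) => [dom|ndom]; last first.
  by rewrite inner specht_orth.
have ndom : ~~ dominates nu mu.
  apply: contra neq => dom'; apply/eqP.
  case: (leqP (dom_rank mu) (dom_rank nu)) => [|/ltnW] le_r.
    exact: dominates_rank.
  exact/esym/dominates_rank.
rewrite (eq_bigr (fun g => specht_char nu g * specht_char mu g)) => [|g _].
  by rewrite inner specht_orth.
by rewrite mulrC.
Qed.

Lemma tabloid_char_count nu g : tabloid_char nu g = (word_count nu g)%:R.
Proof.
rewrite /tabloid_char mxtrace_set_perm_mx; congr _%:R; apply: eq_card => w.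
rewrite inE [RHS]inE; congr (_ && _); rewrite inE; apply/forallP/eqP=> [cw|cw i].
  by apply/ffunP=> i; apply: val_inj; rewrite /= contentE; apply/eqP.
by rewrite -cw contentE.
Qed.

Definition specht_mult N mu (al : {ffun 'I_N -> 'I_m.+1}) : rat :=
  m`!%:R^-1 * \sum_(g : 'S_m) specht_char mu g * (word_count al g)%:R.

Lemma fact_neq0 : m`!%:R != 0 :> rat.
Proof. by rewrite pnatr_eq0 -lt0n fact_gt0. Qed.

Lemma specht_multE N mu (al : {ffun 'I_N -> 'I_m.+1}) :
  \sum_(g : 'S_m) specht_char mu g * (word_count al g)%:R = m`!%:R * specht_mult mu al.
Proof. by rewrite mulrA divff ?fact_neq0 // mul1r. Qed.

(** Under this condition [mu] equals [nu] or does not dominate it, the two cases settled by the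
    computation of homomorphisms. *)
Lemma specht_mult_part mu nu : (dom_rank mu <= dom_rank nu)%N ->
  specht_mult mu nu = (kostka mu nu)%:R.
Proof.
move=> le_r; rewrite /specht_mult.
rewrite (eq_bigr (fun g => specht_char mu g^-1%g * tabloid_char nu g)); last first.
  by move=> g _; rewrite specht_charV tabloid_char_count.
case: (boolP (dominates mu nu)) => [dom|ndom].
  have <- := dominates_rank dom le_r.
  by rewrite specht_tabloid_sum1 kostka_diag mulVf // fact_neq0.
by rewrite specht_tabloid_sum0 // kostka_dominates // mulr0.
Qed.

(** At a shape of maximal rank in the support of [d], only the diagonal Kostka number survives in
    the equation. *)
Lemma kostka_triangular (d : part m -> rat) k :
    (forall mu, (dom_rank mu < k)%N -> d mu = 0) ->
    (forall nu, (k <= dom_rank nu)%N -> \sum_mu d mu * (kostka mu nu)%:R = 0) ->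
  forall mu, d mu = 0.
Proof.
move=> d_low sum0 mu0; apply/eqP/negPn/negP=> d0.
have [mu dmu maxmu] := @arg_maxnP _ mu0 (fun mu => d mu != 0) dom_rank d0.
have le_k : (k <= dom_rank mu)%N.
  by rewrite leqNgt; apply: contra dmu => /d_low->.
have := sum0 mu le_k; rewrite (bigD1 mu) //= kostka_diag mulr1 big1 ?addr0 => [|nu neq].
  by move/eqP; apply/negP.
have [->|dnu] := eqVneq (d nu) 0; first by rewrite mul0r.
rewrite kostka_dominates ?mulr0 //; apply: contra neq => dom.
by apply/eqP/(dominates_rank dom)/maxmu.
Qed.

(** Both norms and the scalar product of the two sides equal the same sum [Q] of squared Kostka
    numbers times m!, so the difference has norm zero. *)
Lemma young_rule_of_mult N (al : {ffun 'I_N -> 'I_m.+1}) :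
    (forall mu, specht_mult mu al = (kostka mu al)%:R) ->
  forall g, (word_count al g)%:R = \sum_mu (kostka mu al)%:R * specht_char mu g :> rat.
Proof.
move=> multE; pose D (g : 'S_m) : rat :=
  (word_count al g)%:R - \sum_mu (kostka mu al)%:R * specht_char mu g.
suff D0 : \sum_(g : 'S_m) D g ^+ 2 = 0.
  move=> g; apply/eqP; rewrite -subr_eq0 -/(D g) -sqrf_eq0.
  move/eqP: D0; rewrite psumr_eq0 => [/allP/(_ g)|h _]; last exact: sqr_ge0.
  by rewrite mem_index_enum => /(_ isT).
pose Q : rat := \sum_(mu : part m) (kostka mu al)%:R ^+ 2.
have MM : \sum_(g : 'S_m) (word_count al g)%:R ^+ 2 = m`!%:R * Q.
  by have := word_count_pair al al.
have MX : \sum_(g : 'S_m) (word_count al g)%:R *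
    (\sum_mu (kostka mu al)%:R * specht_char mu g) = m`!%:R * Q.
  under eq_bigr do rewrite mulr_sumr.
  rewrite exchange_big mulr_sumr /=; apply: eq_bigr => mu _.
  transitivity ((kostka mu al)%:R * \sum_(g : 'S_m) specht_char mu g * (word_count al g)%:R).
    by rewrite mulr_sumr; apply: eq_bigr => g _; ring.
  by rewrite specht_multE multE expr2 mulrCA.
have XX : \sum_(g : 'S_m) (\sum_mu (kostka mu al)%:R * specht_char mu g) ^+ 2 = m`!%:R * Q.
  transitivity (\sum_(mu : part m) \sum_(nu : part m) (kostka mu al)%:R * (kostka nu al)%:R *
      \sum_(g : 'S_m) specht_char mu g * specht_char nu g).
    under eq_bigr do rewrite expr2 big_distrlr /=.
    rewrite exchange_big /=; apply: eq_bigr => mu _; rewrite exchange_big /=.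
    apply: eq_bigr => nu _; rewrite mulr_sumr; apply: eq_bigr => g _.
    by rewrite mulrACA.
  rewrite mulr_sumr; apply: eq_bigr => mu _; rewrite (bigD1 mu) //= [X in _ + X]big1 ?addr0.
    by rewrite specht_inner eqxx mulr1 -expr2 mulrC.
  by move=> nu neq; rewrite specht_inner eq_sym (negbTE neq) !mulr0.
transitivity (\sum_(g : 'S_m) ((word_count al g)%:R ^+ 2 -
    2%:R * ((word_count al g)%:R * (\sum_mu (kostka mu al)%:R * specht_char mu g)) +
    (\sum_mu (kostka mu al)%:R * specht_char mu g) ^+ 2)).
  by apply: eq_bigr => g _; rewrite /D; ring.
rewrite big_split /= sumrB -mulr_sumr MM MX XX; ring.
Qed.

(** The scalar product of the characters of [al] and [nu] is computed by Young's rule for [nu] and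
    by [word_count_pair]. *)
Lemma specht_mult_pair N (al : {ffun 'I_N -> 'I_m.+1}) nu :
    (forall g, (word_count nu g)%:R = \sum_mu (kostka mu nu)%:R * specht_char mu g :> rat) ->
  \sum_mu (specht_mult mu al - (kostka mu al)%:R) * (kostka mu nu)%:R = 0.
Proof.
move=> young; under eq_bigr do rewrite mulrBl; rewrite sumrB.
apply/eqP; rewrite subr_eq0; apply/eqP; apply: (mulfI fact_neq0).
rewrite -word_count_pair mulr_sumr.
transitivity (\sum_(g : 'S_m) (word_count al g)%:R * \sum_mu (kostka mu nu)%:R * specht_char mu g : rat).
  under [RHS]eq_bigr do rewrite mulr_sumr.
  rewrite exchange_big /=; apply: eq_bigr => mu _; rewrite mulrA -specht_multE mulr_suml.
  by apply: eq_bigr => g _; ring.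
by apply: eq_bigr => g _; rewrite young.
Qed.

(** Downward induction on [dom_rank]: [specht_mult_part] settles the multiplicities of shapes of
    rank at most that of [nu], and Young's rule for the higher shapes supplies a triangular system
    for the rest. *)
Lemma young_rule_part nu g :
  (word_count nu g)%:R = \sum_mu (kostka mu nu)%:R * specht_char mu g :> rat.
Proof.
pose B := (\max_nu dom_rank nu)%N.
have [k] := ubnP (B - dom_rank nu); elim: k nu g => // k IHk nu g lt_k.
apply: young_rule_of_mult => mu; apply/eqP; rewrite -subr_eq0; apply/eqP; move: mu.
apply: (@kostka_triangular _ (dom_rank nu).+1) => [mu le_r|nu' lt_r].
  by rewrite specht_mult_part // subrr.
apply: specht_mult_pair => h; apply: IHk.
have : (dom_rank nu' <= B)%N by apply: leq_bigmax.
lia.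
Qed.

Lemma young_rule N (al : {ffun 'I_N -> 'I_m.+1}) g :
  (word_count al g)%:R = \sum_mu (kostka mu al)%:R * specht_char mu g :> rat.
Proof.
apply: young_rule_of_mult => mu; apply/eqP; rewrite -subr_eq0; apply/eqP; move: mu.
apply: (@kostka_triangular _ 0) => // nu _.
by apply: specht_mult_pair => h; apply: young_rule_part.
Qed.

(** Young's rule, read off at each monomial. *)
Lemma frobenius_formula K (x : nat -> {mpoly rat[K]}) N (g : 'S_m) :
  \sum_mu specht_char mu g *: strip_schur x N mu = word_sum x N g.
Proof.
rewrite word_sum_monom.
under eq_bigr do rewrite strip_schur_monom scaler_sumr.
rewrite exchange_big /=; apply: eq_bigr => al _.
transitivity (\sum_mu ((kostka mu al)%:R * specht_char mu g) *: monom x al).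
  apply: eq_bigr => mu _; rewrite mulr_natl -scaler_nat scalerA.
  by rewrite mulrC.
by rewrite -scaler_suml -young_rule scaler_nat mulr_natl.
Qed.

End YoungRule.

(** * Product Frobenius characteristic *)

Section CompleteSymmetric.

Context (N k : nat).

Definition tuple_word (u : k.-tuple 'I_N) : {ffun 'I_k -> 'I_N} := [ffun i => tnth u i].

Lemma count_tuple_word (u : k.-tuple 'I_N) a : count_mem a u = content (tuple_word u) a.
Proof.
rewrite contentE -[in LHS](map_tnth_enum u) count_map count_enum.
by apply: eq_card => i; rewrite !inE ffunE.
Qed.

Lemma tuple_content_perm (u v : k.-tuple 'I_N) :
  (content (tuple_word u) == content (tuple_word v)) = perm_eq u v.
Proof.
apply/eqP/idP=> [eq_c|/seq.permP eq_c].
  by apply/allP=> a _ /=; rewrite !count_tuple_word eq_c.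
by apply/ffunP=> a; apply: val_inj; rewrite /= -!count_tuple_word eq_c.
Qed.

Lemma sum_sorted_tuples (R : comNzRingType) (x : nat -> R) :
  \sum_(u : k.-tuple 'I_N | sorted leq (map val u)) \prod_(a <- u) x a = hsum N k x.
Proof.
rewrite /hsum (@csumE _ k.+1) // -big_set -[RHS]big_set /=.
have -> : [set be : {ffun 'I_N -> 'I_k.+1} | (\sum_(i < N) be i == k)%N] =
    (fun u => content (tuple_word u)) @: [set u : k.-tuple 'I_N | sorted leq (map val u)].
  apply/setP=> be; rewrite inE; apply/eqP/imsetP=> [/content_surj[w <-]|[u _ ->]]; last first.
    exact: sum_content.
  pose le := relpre (@nat_of_ord N) leq.
  pose u0 := [tuple w i | i < k]; pose u := [tuple of sort le u0].
  exists u.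
    by rewrite inE sorted_map; apply: sort_sorted => a b; apply: leq_total.
  have -> : w = tuple_word u0 by apply/ffunP=> i; rewrite ffunE tnth_mktuple.
  by apply/eqP; rewrite tuple_content_perm perm_sym; apply/permPl/perm_sort.
rewrite big_imset /= => [|u v]; last first.
  rewrite !inE => su sv /eqP; rewrite tuple_content_perm => puv.
  apply/val_inj/(inj_map val_inj)/(sorted_eq leq_trans anti_leq su sv).
  exact: perm_map.
apply: eq_bigr => u _; rewrite -(prod_content (fun a : 'I_N => x a)).
by rewrite big_tuple; apply: eq_bigr => i _; rewrite ffunE.
Qed.

End CompleteSymmetric.

(** * Contents given by gaps between ranks *)

Section Gaps.

Context (n : nat) (s : seq nat).
Context (s_sorted : sorted leq (0%N :: rcons s n)).

Definition gaps : seq nat := pairmap (fun a b => b - a)%N 0%N (rcons s n).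

Local Notation P i := (nth 0%N (0%N :: rcons s n) i).

Lemma size_gaps : size gaps = (size s).+1.
Proof. by rewrite size_pairmap size_rcons. Qed.

Lemma nth_gaps i : (i < (size s).+1)%N -> nth 0%N gaps i = (P i.+1 - P i)%N.
Proof. by move=> lt_i; rewrite (nth_pairmap 0%N) ?size_rcons. Qed.

Lemma cum_mono i j : (i <= j)%N -> (j < (size s).+2)%N -> (P i <= P j)%N.
Proof.
move=> le_ij lt_j; apply: (sorted_leq_nth leq_trans leqnn 0%N s_sorted) => //;
  by rewrite inE /= size_rcons // (leq_ltn_trans le_ij).
Qed.

Lemma cum_last : P (size s).+1 = n.
Proof. by rewrite /= nth_rcons ltnn eqxx. Qed.

Lemma nth_gaps_le i : (i < (size s).+1)%N -> (nth 0%N gaps i <= n)%N.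
Proof.
move=> lt_i; rewrite nth_gaps //; apply: leq_trans (leq_subr _ _) _.
by rewrite -[leqRHS]cum_last; apply: cum_mono.
Qed.

Definition gaps_content : {ffun 'I_(size s).+1 -> 'I_n.+1} :=
  [ffun i : 'I_(size s).+1 => inord (nth 0%N gaps i)].

Lemma gaps_contentE i : gaps_content i = nth 0%N gaps i :> nat.
Proof. by rewrite ffunE inordK // ltnS nth_gaps_le. Qed.

Definition cum_count k (v : {ffun 'I_n -> 'I_k}) i := #|[set a | (v a < i)%N]|.

Lemma cum_countS k (v : {ffun 'I_n -> 'I_k}) (i : 'I_k) :
  cum_count v i.+1 = (cum_count v i + content v i)%N.
Proof.
rewrite contentE /cum_count -cardsUI.
rewrite [X in (_ + X)%N](_ : _ = 0%N) ?addn0; last first.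
  apply/eqP; rewrite cards_eq0; apply/eqP/setP=> a; rewrite !inE.
  by apply/negP=> /andP[lt_a /eqP eq_a]; rewrite eq_a ltnn in lt_a.
by apply: eq_card => a; rewrite !inE ltnS leq_eqVlt -val_eqE orbC.
Qed.

Lemma cum_count_max k (v : {ffun 'I_n -> 'I_k}) : cum_count v k = n.
Proof.
rewrite -[RHS](card_ord n) -[RHS]cardsT; apply: eq_card => a.
by rewrite !inE ltn_ord.
Qed.

Lemma cum_wordsP (v : {ffun 'I_n -> 'I_(size s).+1}) :
  (v \in cum_words n s) = (content v == gaps_content).
Proof.
have cum0 : cum_count v 0 = 0%N.
  by apply/eqP; rewrite cards_eq0; apply/eqP/setP=> a; rewrite !inE.
rewrite inE; apply/forallP/eqP=> [cum|cont i].
  have cumE i : (i <= (size s).+1)%N -> cum_count v i = P i.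
    case: i => [//|i]; rewrite leq_eqVlt => /orP[/eqP[->]|lt_i].
      by rewrite cum_count_max cum_last.
    have /eqP := cum (Ordinal (lt_i : (i < size s)%N)).
    by rewrite /= nth_rcons (lt_i : (i < size s)%N) => <-; apply: eq_card => a; rewrite !inE.
  apply/ffunP=> i; apply: val_inj; rewrite /= gaps_contentE nth_gaps //.
  rewrite -!cumE ?ltn_ord //; last by rewrite ltnW.
  by rewrite cum_countS addKn.
have cumE j : (j <= (size s).+1)%N -> cum_count v j = P j.
  elim: j => [//|j IHj] lt_j; rewrite (@cum_countS _ v (Ordinal lt_j)) /= IHj ?(ltnW lt_j) //.
  rewrite cont gaps_contentE nth_gaps //= -[X in (_ + (X - _))%N]/(P j.+1) subnKC //.
  by rewrite cum_mono.
have := cumE i.+1; rewrite /= nth_rcons ltn_ord => cE.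
by rewrite -cE ?ltnS ?(ltnW (ltn_ord i)) //; apply/eqP/eq_card => a; rewrite !inE.
Qed.

Lemma sum_gaps_content : (\sum_i gaps_content i = n)%N.
Proof.
have sumE j : (j <= (size s).+1)%N -> (\sum_(i < j) nth 0%N gaps i = P j)%N.
  elim: j => [|j IHj] lt_j; first by rewrite big_ord0.
  rewrite big_ord_recr /= IHj ?(ltnW lt_j) // nth_gaps //.
  by rewrite subnKC // cum_mono.
rewrite -[RHS]cum_last -sumE //; apply: eq_bigr => i _.
by rewrite gaps_contentE.
Qed.

Lemma word_actV_fix k (v : {ffun 'I_n -> 'I_k}) g :
  (word_act v g^-1%g == v) = (word_act v g == v).
Proof.
rewrite -[LHS](inj_eq (act_inj (word_action n 'I_k) g)) /=.
by rewrite -word_actM mulVg word_act1 eq_sym.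
Qed.

Lemma word_sumV (R : comNzRingType) (x : nat -> R) N (g : 'S_n) :
  word_sum x N g^-1%g = word_sum x N g.
Proof. by apply: eq_bigl => w; apply: word_actV_fix. Qed.

(** [word_sum_content] for the indicator of the single content [gaps_content]. *)
Lemma sum_cum_words (R : comNzRingType) (y : nat -> R) N :
  \sum_(g : 'S_n) #|[set v in cum_words n s | word_act v g == v]|%:R * word_sum y N g^-1%g =
  n`!%:R * \prod_(a <- gaps) hsum N a y.
Proof.
have := word_sum_content y N (fun al => (al == gaps_content)%:R).
rewrite (bigD1 gaps_content) /= ?sum_gaps_content // eqxx mul1r.
rewrite [X in _ * (_ + X)]big1 ?addr0 => [|al /andP[_ /negbTE->]]; last by rewrite mul0r.
have -> : \prod_(i < (size s).+1) hsum N (gaps_content i) y = \prod_(a <- gaps) hsum N a y.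
  rewrite (big_nth 0%N) size_gaps big_mkord.
  by apply: eq_bigr => i _; rewrite gaps_contentE.
move=> <-; apply: eq_bigr => g _; rewrite word_sumV; congr (_ * _).
rewrite -sum1_card natr_sum big_mkcond [RHS]big_mkcond /=; apply: eq_bigr => v _.
by rewrite inE cum_wordsP; do 2!case: (_ == _).
Qed.

End Gaps.

(** * The characteristic as an average of power sums *)

Section ProductFrobenius.

Context (t m N : nat).

Definition alph (l : 'I_t) (k : nat) : {mpoly rat[t * N]} :=
  if insub k is Some j then alph_var l j else 0.

Lemma alphE l (j : 'I_N) : alph l j = alph_var l j.
Proof. by rewrite /alph valK. Qed.

Lemma schur_strip l (mu : part m) : schur N l mu = strip_schur (alph l) N mu.
Proof.
rewrite -sum_ssyt; apply: eq_bigr => T _; apply: eq_bigr => c _.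
by rewrite alphE.
Qed.

Lemma hsym_hsum l k : hsym N l k = hsum N k (alph l).
Proof.
rewrite -sum_sorted_tuples; apply: eq_bigr => u _; apply: eq_bigr => a _.
by rewrite alphE.
Qed.

(** Applying Frobenius' formula in every coordinate eliminates the irreducible characters; linearity
    in [phi] and multiplicativity over coordinates become visible. *)
Lemma product_frobE (phi : symt t m -> rat) :
  product_frob N phi = #|{: symt t m}|%:R^-1 *:
    \sum_(g : symt t m) phi g *: \prod_(l < t) word_sum (alph l) N (g l)^-1%g.
Proof.
rewrite scaler_sumr /product_frob /frob_mult.
under eq_bigr do rewrite mulr_sumr scaler_suml.
rewrite exchange_big /=; apply: eq_bigr => g _.
under [X in _ = _ *: (_ *: X)]eq_bigr do rewrite -frobenius_formula.
rewrite bigA_distr_bigA /= !scaler_sumr; apply: eq_bigr => mu _.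
rewrite -!scalerA; congr (_ *: (_ *: _)).
by rewrite scaler_prod; congr (_ *: _); apply: eq_bigr => l _; rewrite schur_strip.
Qed.

Lemma product_frob_sum (I : Type) (r : seq I) (phi : I -> symt t m -> rat) :
  product_frob N (fun g => \sum_(i <- r) phi i g) = \sum_(i <- r) product_frob N (phi i).
Proof.
rewrite product_frobE.
under [X in _ *: X]eq_bigr do rewrite scaler_suml.
by rewrite exchange_big scaler_sumr; apply: eq_bigr => i _; rewrite product_frobE.
Qed.

Lemma eq_product_frob (phi psi : symt t m -> rat) :
  phi =1 psi -> product_frob N phi = product_frob N psi.
Proof.
by move=> eq_phi; rewrite !product_frobE; congr (_ *: _); apply: eq_bigr => g _; rewrite eq_phi.
Qed.

Lemma sum_symt (R : nmodType) (F : {ffun 'I_t -> 'S_m} -> R) :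
  \sum_(g : symt t m) F g = \sum_(g : {ffun 'I_t -> 'S_m}) F g.
Proof.
by rewrite (reindex (fun g : {ffun 'I_t -> 'S_m} => g : symt t m)) //; exists id.
Qed.

Lemma card_symt : #|{: symt t m}| = (m`! ^ t)%N.
Proof.
rewrite -sum1_card (sum_symt (fun=> 1%N)) sum1_card card_ffun card_ord.
by rewrite -(card_Sn m) -cardsT.
Qed.

Lemma product_frob_prod (psi : 'S_m -> rat) :
  product_frob N (fun g : symt t m => \prod_(l < t) psi (g l)) =
  \prod_(l < t) (m`!%:R^-1 *: \sum_(h : 'S_m) psi h *: word_sum (alph l) N h^-1%g).
Proof.
rewrite product_frobE card_symt scaler_prod prodr_const card_ord natrX exprVn.
congr (_ *: _); rewrite bigA_distr_bigA /=.
rewrite (sum_symt (fun g => (\prod_(l < t) psi (g l)) *: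
  \prod_(l < t) word_sum (alph l) N (g l)^-1%g)).
by apply: eq_bigr => g _; rewrite scaler_prod.
Qed.

End ProductFrobenius.

(** * Summation over rank sets and the conclusion *)

Lemma fset_ranks_gaps n (J : {fset nat}) :
  (forall j, j \in J -> (j <= n)%N) -> sorted leq (0%N :: rcons (fset_ranks J) n).
Proof.
move=> leJ /=; rewrite rcons_path path_min_sorted ?sort_sorted //; last first.
  by apply/allP.
have := mem_last 0%N (fset_ranks J); rewrite inE mem_fset_ranks.
by case/orP=> [/eqP->//|/leJ].
Qed.

(** The two counts of fixed flags meet: homology on the left, words on the right. *)
Lemma sum_beta t n N (J : {fset nat}) : (0 < t)%N -> proper_ranks n J ->
  \sum_(K <- fpowerset J) beta t n K N =
  \prod_(l < t) \prod_(a <- gaps n (fset_ranks J)) hsum N a (alph N l).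
Proof.
move=> t_gt0 prJ.
have srt : sorted leq (0%N :: rcons (fset_ranks J) n).
  by apply: fset_ranks_gaps => j /prJ/andP[_ /ltnW].
rewrite -product_frob_sum.
pose psi (h : 'S_n) : rat :=
  #|[set v in cum_words n (fset_ranks J) | word_act v h == v]|%:R.
rewrite (@eq_product_frob _ _ _ _ (fun g => \prod_(l < t) psi (g l))); last first.
  move=> g; rewrite /psi -natr_prod -(card_fixed_flags_words t_gt0 prJ).
  rewrite card_fixed_flags //; exact: (big_seq_fsetE _ _ xpredT (fun K => Bt_top_char K g)).
rewrite product_frob_prod; apply: eq_bigr => l _.
have := sum_cum_words srt (alph N l) N.
rewrite (eq_bigr (fun h : 'S_n => psi h *: word_sum (alph N l) N h^-1%g)) => [->|h _].
  by rewrite mulr_natl -scaler_nat scalerA mulVf ?scale1r // pnatr_eq0 -lt0n fact_gt0.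
by rewrite mulr_natl scaler_nat.
Qed.

Lemma fset_ranks_rcons (J : {fset nat}) jr : (forall j, j \in J -> (j < jr)%N) ->
  fset_ranks (jr |` J)%fset = rcons (fset_ranks J) jr.
Proof.
move=> ltJ; apply: (sorted_eq leq_trans anti_leq); first exact: (sort_sorted leq_total).
  have : sorted leq (fset_ranks J) by apply: (sort_sorted leq_total).
  case: (fset_ranks J) (mem_fset_ranks J) => // j s mem srt.
  rewrite /= rcons_path; apply/andP; split; first exact: srt.
  by rewrite ltnW // ltJ // -mem mem_last.
apply: uniq_perm; first by rewrite sort_uniq fset_uniq.
  rewrite rcons_uniq sort_uniq fset_uniq andbT mem_fset_ranks.
  by apply/negP=> /ltJ; rewrite ltnn.
by move=> j; rewrite mem_rcons inE !mem_fset_ranks !inE.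
Qed.

Lemma gaps_rcons n s jr : gaps n (rcons s jr) = rcons (gaps jr s) (n - jr)%N.
Proof. by rewrite /gaps -cats1 pairmap_cat cats1 last_rcons. Qed.

Lemma sum_fpowersetU1 (R : nmodType) (J : {fset nat}) jr (F : {fset nat} -> R) : jr \notin J ->
  \sum_(K <- fpowerset (jr |` J)%fset) F K = \sum_(K <- fpowerset J) (F (jr |` K)%fset + F K).
Proof.
move=> jrJ; rewrite big_split /= addrC -(big_map (fun K => jr |` K)%fset xpredT F) -big_cat /=.
have subJ (K : {fset nat}) : (K `<=` J)%fset -> jr \notin K.
  by move=> sKJ; apply: contra jrJ; apply/fsubsetP.
apply: perm_big; apply: uniq_perm; first exact: fset_uniq.
  rewrite cat_uniq fset_uniq map_inj_in_uniq ?fset_uniq ?andbT.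
    apply/hasPn=> _ /mapP[K _ ->]; rewrite fpowersetE; apply/negP=> /subJ.
    by rewrite fset1U1.
  move=> K L; rewrite !fpowersetE => /subJ jrK /subJ jrL eqKL.
  by rewrite -(fsetU1K jrK) eqKL fsetU1K.
move=> K; rewrite mem_cat !fpowersetE; apply/idP/orP=> [sK|[sK|/mapP[L]]].
- case: (boolP (jr \in K)) => [jrK|jrK]; [right | left].
    apply/mapP; exists (K `\ jr)%fset; last by rewrite fsetD1K.
    rewrite fpowersetE; apply/fsubsetP=> j; rewrite !inE => /andP[neq jK].
    by have := fsubsetP sK j jK; rewrite !inE (negbTE neq).
  apply/fsubsetP=> j jK; have := fsubsetP sK j jK; rewrite !inE => /orP[/eqP eqj|//].
  by rewrite eqj (negbTE jrK) in jK.
- by apply: fsubset_trans sK (fsubsetU1 _ _).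
- by rewrite fpowersetE => sL ->; apply: fsetUS.
Qed.

Theorem theorem5p6 (t n : nat) (J : {fset nat}) (jr : nat)
    (t_ge1 : (1 <= t)%N) (n_ge2 : (2 <= n)%N)
    (J_sub : forall j, j \in J -> (1 <= j <= n - 1)%N)
    (jr_in : jr \in J) (jr_max : forall j, j \in J -> (j <= jr)%N) :
  forall N : nat,
    beta t n J N + beta t n (J `\ jr)%fset N =
    beta t jr (J `\ jr)%fset N * \prod_(i < t) hsym N i (n - jr).
Proof.
move=> N; rewrite -{1}(fsetD1K jr_in).
have jr_bd : (0 < jr < n)%N by have := J_sub jr jr_in; lia.
have prJ' : proper_ranks jr (J `\ jr)%fset.
  move=> j; rewrite !inE => /andP[neq jJ]; have := J_sub j jJ.
  by have := jr_max j jJ; lia.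
(* The claim is generalized to every set [J'] of ranks below [jr], for strong induction on its
   size. *)
move: (J `\ jr)%fset prJ' => J'; have [k] := ubnP #|` J'|.
elim: k J' => // k IHk J' lt_k prJ'.
set H := \prod_(i < t) _.
have jrJ' : jr \notin J' by apply/negP=> /prJ'; rewrite ltnn andbF.
have prJ : proper_ranks n (jr |` J')%fset.
  by move=> j; rewrite !inE => /orP[/eqP->//|/prJ']; lia.
have prodE : \prod_(l < t) \prod_(a <- gaps n (fset_ranks (jr |` J')%fset)) hsum N a (alph N l) =
    (\sum_(K <- fpowerset J') beta t jr K N) * H.
  rewrite fset_ranks_rcons => [|j /prJ'/andP[]//]; rewrite gaps_rcons sum_beta // -big_split.
  by apply: eq_bigr => l _; rewrite -cats1 big_cat big_seq1 hsym_hsum.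
have := sum_beta N t_ge1 prJ; rewrite sum_fpowersetU1 // prodE mulr_suml.
have J'in : J' \in fpowerset J' by rewrite fpowersetE.
(* The identity holds summed over all [K] inside [J']; induction accounts for the proper subsets,
   which then cancel. *)
have rest : \sum_(K <- fpowerset J' | K != J')
      (beta t n (jr |` K)%fset N + beta t n K N) =
    \sum_(K <- fpowerset J' | K != J') beta t jr K N * H.
  rewrite big_seq_cond [RHS]big_seq_cond; apply: eq_bigr => K /andP[].
  rewrite fpowersetE => sKJ neq; apply: IHk; last exact: proper_ranksS prJ'.
  have : (K `<` J')%fset by rewrite fproperEneq neq.
  by move/fproper_ltn_card; lia.
rewrite (bigD1_seq J') ?fset_uniq //= rest.
by rewrite [X in _ = X -> _](bigD1_seq J') ?fset_uniq //= => /addIr.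
Qed.
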